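(* Let $d_L$ be such that $d_L \geq (r_Lr_P - r_L + 1)r_P$. By $V$ we denote the (algebraic) set of all $L \in \bar{C}[x][\partial]$ of order $r_L$ and degree $\leq d_L$ such that the leading coefficient of $L$ does not vanish at $\alpha_1, \ldots, \alpha_{r_P}$. We consider two (algebraic) subsets in $V$ \begin{alignat*}1 X &= \bigl\{ L \in V \bigm| \text{$M(L)$ has an apparent singularity at $0$}\bigr\},\\ Y &= \bigl\{ L \in V \bigm| \text{$M(L)$ has an apparent singularity at $0$}\\[-2pt] &\hspace{50pt} \text{which is not removable at cost one} \bigr\}. \end{alignat*} Then, $\dim X > \dim Y$ as algebraic sets.
   Context: Let $C$ be a field of characteristic zero with algebraic closure $\bar C$, and $\partial x = x\partial+1$. Fix $P\in C[x,y]$ with $r_P=\deg_y P>1$, squarefree in $C(x)[y]$ and with no divisors in $\bar C[y]$. For an operator $L\in\bar C[x][\partial]$ of order $r_L$, $M(L)$ denotes the minimal operator $M$ with $M(f(g(x)))=0$ whenever $Lf=0$ and $P(x,g(x))=0$. A factor $p$ of the leading coefficient $\operatorname{lc}_\partial(M)$ is removable at cost $n$ if there is $Q\in \bar C(x)[\partial]$ of order at most $n$ with $QM\in \bar C[x][\partial]$ and $\gcd(\operatorname{lc}_\partial(QM),p)=1$. It is assumed that: (S1) $P(0,y)$ is a squarefree polynomial of degree $r_P$; (S2) $g(0)$ is not a singularity of $L$ for any root $g(x)$ of $P$; (G) the power series roots of $P(x,g(x))=0$ at zero are $g_i(x)=\alpha_i+\beta_i x+\gamma_i x^2+\ldots$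 ($1\le i\le r_P$), where $\beta_2,\ldots,\beta_{r_P}$ are nonzero and either $\beta_1$ or $\gamma_1$ is nonzero. Here $\alpha_i = g_i(0)$.
   Formalization: The formal theorem assumes that the order r_L is at least 1; for r_L = 0 the only solution of L is f = 0, so M(L) = 1, both X and Y are empty, and dim X > dim Y fails. *)

(* Defs.v *)
From HB Require Import structures.
From mathcomp Require Import all_boot all_order all_algebra.
From mathcomp Require Import fraction mpoly.
Set Implicit Arguments. Unset Strict Implicit. Unset Printing Implicit Defensive.
Import Order.TTheory GRing.Theory Num.Theory.
Local Open Scope ring_scope.

(* Formal power series over K, as coefficient sequences nat -> K.      *)
(* A series "at a" represents  sum_n f n (x - a)^n.                   *)
Section Series.
Variable K : fieldType.

Definition smul (f g : nat -> K) : nat -> K :=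
  fun n => \sum_(i < n.+1) f i * g (n - i)%N.
Definition sone : nat -> K := fun n => (n == 0%N)%:R.
Definition spow (f : nat -> K) (k : nat) : nat -> K := iter k (smul f) sone.
Definition sder (f : nat -> K) : nat -> K := fun n => f n.+1 *+ n.+1.
Definition sexp (p : {poly K}) (a : K) : nat -> K :=
  fun n => (p \Po ('X + a%:P))`_n.
(* composition f(h(x)), where f is a series at a and h a series at 0
   with h 0 = a  (so h - a has zero constant term) *)
Definition scomp (f : nat -> K) (a : K) (h : nat -> K) : nat -> K :=
  fun n => \sum_(k < n.+1)
     f k * spow (fun m => h m - (if m == 0%N then a else 0)) k n.

(* Differential operators in K[x][d] are represented as elements of
   {poly {poly K}}:  M = \sum_i M`_i d^i  (outer variable = d).
   Order of M = (size M).-1, leading coefficient = lead_coef M.       *)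
Definition sapply (M : {poly {poly K}}) (a : K) (f : nat -> K) : nat -> K :=
  fun n => \sum_(i < size M) smul (sexp M`_i a) (iter i sder f) n.
Definition solves (M : {poly {poly K}}) (a : K) (f : nat -> K) : Prop :=
  forall n, sapply M a f n = 0.

(* left multiplication by d in the Weyl algebra: d*(m d^i) = m' d^i + m d^(i+1) *)
Definition opD (M : {poly {poly K}}) : {poly {poly K}} :=
  map_poly (fun p : {poly K} => p^`()) M + 'X * M.

(* power series root y = h(x) at x = 0 of P(x,y) (P given with outer
   variable y) *)
Definition is_ser_root (PK : {poly {poly K}}) (h : nat -> K) : Prop :=
  forall n, \sum_(k < size PK) smul (sexp PK`_k 0) (spow h k) n = 0.

Definition annihilates_comp (PK L Q : {poly {poly K}}) : Prop :=
  forall h, is_ser_root PK h ->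
  forall f, solves L (h 0%N) f -> solves Q 0 (scomp f (h 0%N) h).

Definition op_primitive (M : {poly {poly K}}) : Prop :=
  forall d : {poly K}, (forall i, d %| M`_i) -> (size d <= 1)%N.

(* M is (a K[x]-primitive representative of) the minimal operator M(L) *)
Definition is_minop (PK L M : {poly {poly K}}) : Prop :=
  [/\ M != 0, op_primitive M, annihilates_comp PK L M &
      forall Q, Q != 0 -> annihilates_comp PK L Q -> (size M <= size Q)%N].

Definition apparent_sing0 (M : {poly {poly K}}) : Prop :=
  root (lead_coef M) 0 /\
  exists F : 'I_(size M).-1 -> nat -> K,
    (forall k, solves M 0 (F k)) /\
    (forall c : 'I_(size M).-1 -> K,
        (forall n, \sum_k c k * F k n = 0) -> forall k, c k = 0).

(* the factor x of lc(M) is removable at cost one: there is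
   Q = c^-1 (a + b d) in K(x)[d] (order <= 1) with QM in K[x][d] and
   gcd(lc(QM), x) = 1 *)
Definition removable_cost1_at0 (M : {poly {poly K}}) : Prop :=
  exists a b c : {poly K}, c != 0 /\
    let N := a%:P * M + b%:P * opD M in
    (forall i, c %| N`_i) /\ ~~ root (lead_coef N %/ c) 0.

Definition sqfree (F : fieldType) (p : {poly F}) : Prop :=
  forall q : {poly F}, q ^+ 2 %| p -> (size q <= 1)%N.
End Series.

Section Zariski.
Variables (K : fieldType) (n : nat).
Definition pt := 'I_n -> K.

Definition zclosed (A : pt -> Prop) : Prop :=
  exists S : {mpoly K[n]} -> Prop,
    forall v, A v <-> (forall p, S p -> p.@[v] = 0).

Definition zirred (A : pt -> Prop) : Prop :=
  [/\ zclosed A, exists v, A v &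
      forall A1 A2, zclosed A1 -> zclosed A2 ->
        (forall v, A v -> A1 v \/ A2 v) ->
        (forall v, A v -> A1 v) \/ (forall v, A v -> A2 v)].

Definition dim_ge (S : pt -> Prop) (k : nat) : Prop :=
  exists Z : nat -> pt -> Prop,
    [/\ forall i, (i <= k)%N -> zirred (Z i),
        forall i, (i < k)%N ->
          (forall v, Z i v -> Z i.+1 v) /\ exists v, Z i.+1 v /\ ~ Z i v &
        forall B, zclosed B -> (forall v, S v -> B v) ->
          forall v, Z k v -> B v].

(* dim X > dim Y (dimension of the empty set being -1) *)
Definition dim_gt (X Y : pt -> Prop) : Prop :=
  exists k, dim_ge X k /\ ~ dim_ge Y k.
End Zariski.

Definition opOf (K : fieldType) (rL dL : nat) (v : pt K (rL.+1 * dL.+1)) :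
  {poly {poly K}} :=
  \sum_(i < rL.+1) (\sum_(j < dL.+1) v (mxvec_index i j) *: 'X^j)%:P * 'X^i.

(* Main.v *)
Require Import Defs.
From HB Require Import structures.
From mathcomp Require Import all_boot all_order all_algebra.
From mathcomp Require Import fraction mpoly.
From mathcomp Require Import perm separable ring zify boolp.
Import Order.TTheory GRing.Theory Num.Theory.
Local Open Scope ring_scope.
Set Implicit Arguments. Unset Strict Implicit. Unset Printing Implicit Defensive.

(** Write [s] for the order of [L] and [r] for [deg_y P].  Near an ordinary [L] the
    compositions of the solutions of [L] at [g_j(0)] with [g_j] are power series; list
    their Taylor coefficients in a matrix with [r s] rows [(j, a)].  An operator of order
    [r s] annihilates all of them, because [d/dx] acts on the module [(K(x)[y]/P)^s].

    If the first [r s] columns are independent, [M(L)] is regular at [0]; if the first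
    [r s - 1] columns together with the column of [x^(r s)] are independent but the column
    of [x^(r s - 1)] is not, then the exponents are [0, ..., r s - 2, r s] and
    [x^-1 (d + a)] removes the singularity.  So [Y] lies in the locus where the rank drops
    further.  Since [d_L] is large enough for Hermite interpolation at the points [g_j(0)],
    the entries of a new column in the rows with [g_j'(0) <> 0] can be prescribed
    independently, and a rank drop determines coordinates of [L] rationally in terms of the
    others: two of them on [Y], while [X] contains the graph of a single one.  Finally, a
    set parametrised rationally by [K^m] contains no chain of [m + 2] irreducible closed
    sets, because such a chain yields [m + 1] algebraically independent functions. *)

(** * The ring of formal power series *)

(** The obstacle is a root with [g_1'(0) = 0]: the later entries of its rows cannot be prescribed,
    so every equation has to be read in a row of another root. This is possible because no nonzero
    left kernel vector of the first [r s - 1] columns lives on the rows of [g_1] alone: with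
    [g_1''(0) <> 0] the row [(1, a)] has valuation [2 a <= 2 (s - 1) < r s - 1]. The bound on [d_L]
    counts conditions: columns [s] to [r s] feel the Taylor coefficients 0 to [r s - s] of the
    coefficients of [L] at each of the [r] points. That the rank does not always drop further is not
    checked on an example: the bad locus is too small to fill all of [V], and from a good operator
    the gap is reached by moving along two coordinates. Only the upper bound [r s] for the order of
    [M(L)] is known in advance. Primitivity converts knowledge of the initial terms of solutions
    into values of the coefficients of [M(L)] at 0, and the exact order follows. *)

Definition series (K : fieldType) := nat -> K.

Section SeriesRing.
Variable K : fieldType.
Implicit Types f g h : series K.

HB.instance Definition _ := gen_eqMixin (series K).
HB.instance Definition _ := gen_choiceMixin (series K).

Definition series_trunc n f : {poly K} := \poly_(i < n) f i.

(** A coefficient of a product involves finitely many coefficients of the factors, so the ring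
    axioms and the Leibniz rule are inherited from truncations in [{poly K}]. *)
Lemma coef_smul n f g i : (i < n)%N ->
  smul f g i = (series_trunc n f * series_trunc n g)`_i.
Proof.
move=> lin; rewrite coefM; apply: eq_bigr => j _.
rewrite !coef_poly (leq_ltn_trans _ lin) ?(leq_ltn_trans _ lin) ?leq_subr //.
by rewrite -ltnS.
Qed.

Lemma series_truncM n f g i : (i < n)%N ->
  (series_trunc n (smul f g))`_i = (series_trunc n f * series_trunc n g)`_i.
Proof. by move=> lin; rewrite coef_poly lin (coef_smul _ _ lin). Qed.

Lemma eq_coefM (p p' q q' : {poly K}) n :
  (forall i, (i < n)%N -> p`_i = p'`_i) -> (forall i, (i < n)%N -> q`_i = q'`_i) ->
  forall i, (i < n)%N -> (p * q)`_i = (p' * q')`_i.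
Proof.
move=> hp hq i lin; rewrite !coefM; apply: eq_bigr => j _.
by rewrite hp ?hq // (leq_ltn_trans _ lin) ?leq_subr // -ltnS.
Qed.

Let addf f g : series K := fun n => f n + g n.
Let oppf f : series K := fun n => - f n.
Let zerof : series K := fun _ => 0.

Fact series_addA : associative addf.
Proof. by move=> f g h; apply: funext => n; rewrite /addf addrA. Qed.
Fact series_addC : commutative addf.
Proof. by move=> f g; apply: funext => n; rewrite /addf addrC. Qed.
Fact series_add0 : left_id zerof addf.
Proof. by move=> f; apply: funext => n; rewrite /addf add0r. Qed.
Fact series_addN : left_inverse zerof oppf addf.
Proof. by move=> f; apply: funext => n; rewrite /addf /oppf addNr. Qed.

HB.instance Definition _ := GRing.isZmodule.Build (series K)
  series_addA series_addC series_add0 series_addN.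

Fact series_mulA : associative (@smul K).
Proof.
move=> f g h; apply: funext => n.
rewrite !(@coef_smul n.+1) //.
rewrite (eq_coefM (n := n.+1) (p' := series_trunc n.+1 f)
  (q' := series_trunc n.+1 g * series_trunc n.+1 h)) //; last first.
  by move=> i lin; rewrite series_truncM.
rewrite mulrA; apply: (@eq_coefM _ _ _ _ n.+1) => // i lin.
by rewrite series_truncM.
Qed.

Fact series_mulC : commutative (@smul K).
Proof. by move=> f g; apply: funext => n; rewrite !(@coef_smul n.+1) // mulrC. Qed.

Fact series_mul1 : left_id (@sone K) (@smul K).
Proof.
move=> f; apply: funext => n; rewrite /smul big_ord_recl /sone /= mul1r subn0.
by rewrite big1 ?addr0 // => i _; rewrite mul0r.
Qed.

Fact series_mulDl : left_distributive (@smul K) addf.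
Proof.
move=> f g h; apply: funext => n; rewrite /addf /smul -big_split.
by apply: eq_bigr => i _; rewrite mulrDl.
Qed.

Fact series_1neq0 : (@sone K : series K) != (0 : series K).
Proof.
apply/eqP => /(congr1 (fun f : series K => f 0%N)) /eqP; rewrite /sone /=.
by rewrite oner_eq0.
Qed.

HB.instance Definition _ := GRing.Zmodule_isComNzRing.Build (series K)
  series_mulA series_mulC series_mul1 series_mulDl series_1neq0.

Lemma seriesD f g n : (f + g) n = f n + g n. Proof. by []. Qed.
Lemma seriesN f n : (- f) n = - f n. Proof. by []. Qed.
Lemma series0 n : (0 : series K) n = 0. Proof. by []. Qed.
Lemma series1 n : (1 : series K) n = (n == 0%N)%:R. Proof. by []. Qed.
Lemma seriesM f g n : (f * g) n = \sum_(i < n.+1) f i * g (n - i)%N.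
Proof. by []. Qed.
Lemma seriesM0 f g : (f * g) 0%N = f 0%N * g 0%N.
Proof. by rewrite seriesM big_ord1. Qed.
Lemma seriesX0 f k : (f ^+ k) 0%N = f 0%N ^+ k.
Proof. by elim: k => [|k IH]; rewrite ?expr0 // !exprS seriesM0 IH. Qed.

Lemma series_sum (I : Type) (r : seq I) (P : pred I) (F : I -> series K) n :
  (\sum_(i <- r | P i) F i) n = \sum_(i <- r | P i) F i n.
Proof. by elim/big_rec2: _ => [//|i x y _ <-]. Qed.

Lemma spowE f k : spow f k = (f : series K) ^+ k.
Proof. by elim: k => [//|k IH]; rewrite exprS -IH. Qed.

Definition series_of_poly (p : {poly K}) : series K := fun n => p`_n.

Fact series_of_poly_zmod : zmod_morphism series_of_poly.
Proof. by move=> p q; apply: funext => n; rewrite /series_of_poly coefB. Qed.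
Fact series_of_poly_monoid : monoid_morphism series_of_poly.
Proof.
split; first by apply: funext => n; rewrite /series_of_poly coef1.
by move=> p q; apply: funext => n; rewrite /series_of_poly coefM.
Qed.
HB.instance Definition _ := GRing.isZmodMorphism.Build _ _ series_of_poly
  series_of_poly_zmod.
HB.instance Definition _ := GRing.isMonoidMorphism.Build _ _ series_of_poly
  series_of_poly_monoid.

Lemma sexp0 p : sexp p (0 : K) = series_of_poly p.
Proof. by apply: funext => n; rewrite /sexp addr0 comp_polyXr. Qed.

Lemma sexpE p (a : K) : sexp p a = series_of_poly (p \Po ('X + a%:P)).
Proof. by []. Qed.

Lemma series_neq0P f : f <> 0 ->
  exists2 n, f n != 0 & forall i, (i < n)%N -> f i = 0.
Proof.
move=> f0.
have ex : exists n, f n != 0.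
  apply: contrapT => h; apply: f0; apply: funext => n; apply/eqP.
  by apply: contrapT => /negP hn; apply: h; exists n.
case: (ex_minnP ex) => n fn hmin; exists n => // i lin.
by apply/eqP; apply: contraLR lin => fi; rewrite -leqNgt hmin.
Qed.

Lemma seriesM_low f g m n : (forall i, (i < m)%N -> f i = 0) ->
  (forall i, (i < n)%N -> g i = 0) ->
  (forall i, (i < m + n)%N -> (f * g) i = 0) /\ (f * g) (m + n)%N = f m * g n.
Proof.
move=> hf hg; split=> [i li|].
  rewrite seriesM big1 // => j _; case: (ltnP j m) => [/hf-> |lmj].
    by rewrite mul0r.
  rewrite hg ?mulr0 //; have := ltn_ord j; rewrite ltnS => lji.
  by rewrite ltn_subLR // (leq_trans li) // leq_add2r.
have hm : (m < (m + n).+1)%N by rewrite ltnS leq_addr.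
rewrite seriesM (bigD1 (Ordinal hm)) //= addKn big1 ?addr0 // => j nj.
case: (ltngtP j m) => [/hf-> |lmj|jm]; first by rewrite mul0r.
  rewrite hg ?mulr0 //; have := ltn_ord j; rewrite ltnS => lji.
  by rewrite ltn_subLR // ltn_add2r.
by case/eqP: nj; apply: val_inj.
Qed.

(** The lowest nonzero coefficients would have a nonzero product. This allows denominators to be
    cleared before an identity is proved and cancelled afterwards. *)
Lemma series_mulf_eq0 f g : f * g = 0 -> f <> 0 -> g = 0.
Proof.
move=> fg0 /series_neq0P [m fm hm]; apply: contrapT => /series_neq0P [n gn hn].
have [_ /eqP] := seriesM_low hm hn; rewrite fg0 eq_sym mulf_eq0.
by rewrite (negPf fm) (negPf gn).
Qed.

Lemma seriesX_low f n : (forall i, (i < n)%N -> f i = 0) -> forall k,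
  (forall i, (i < k * n)%N -> (f ^+ k) i = 0) /\ (f ^+ k) (k * n)%N = f n ^+ k.
Proof.
move=> hf; elim=> [|k [IH1 IH2]]; first by rewrite mul0n !expr0 series1.
rewrite exprS mulSn; have [h1 h2] := seriesM_low hf IH1.
by split=> //; rewrite h2 IH2 exprS.
Qed.

Lemma series_of_poly_neq0 p : p != 0 -> series_of_poly p <> 0.
Proof.
move=> p0 h; case/eqP: p0; apply/polyP=> i.
by rewrite coef0 -[LHS]/(series_of_poly p i) h.
Qed.

Lemma series_coef0_neq0 f : f 0%N != 0 -> f <> 0.
Proof. by move=> f0 h; rewrite h series0 eqxx in f0. Qed.

(** * Derivation and composition *)

Lemma sder_is_zmod : zmod_morphism (@sder K : series K -> series K).
Proof. by move=> f g; apply: funext => n; rewrite seriesD seriesN /sder seriesD seriesN mulrnBl. Qed.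

Definition sderiv : series K -> series K := @sder K.
HB.instance Definition _ := GRing.isZmodMorphism.Build _ _ sderiv sder_is_zmod.

Lemma sderiv_trunc n f i : (i < n)%N ->
  sderiv f i = (series_trunc n.+1 f)^`()`_i.
Proof. by move=> lin; rewrite coef_deriv coef_poly ltnS lin. Qed.

Lemma sderivM f g : sderiv (f * g) = sderiv f * g + f * sderiv g.
Proof.
apply: funext => n.
rewrite (@sderiv_trunc n.+1) // coef_deriv series_truncM // -coef_deriv derivM.
rewrite coefD seriesD ; congr (_ + _).
  rewrite -[RHS]/(smul _ _ n) (@coef_smul n.+2) // !coefM; apply: eq_bigr => i _.
  rewrite [X in _ = X * _]coef_poly (@ltn_trans n.+1 i n.+2) //.
  by rewrite -sderiv_trunc // ltn_ord.
rewrite -[RHS]/(smul _ _ n) (@coef_smul n.+2) // !coefM; apply: eq_bigr => i _.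
rewrite [X in _ = _ * X]coef_poly.
have h : (n - i < n.+1)%N by rewrite ltnS leq_subr.
by rewrite (ltnW (h : (n - i).+1 < n.+2)%N) -sderiv_trunc.
Qed.

Lemma sderiv_poly p : sderiv (series_of_poly p) = series_of_poly p^`().
Proof. by apply: funext => n; rewrite /series_of_poly coef_deriv. Qed.

Lemma sderivX f k : sderiv (f ^+ k.+1) = (f ^+ k * sderiv f) *+ k.+1.
Proof.
elim: k => [|k IH]; first by rewrite expr1 expr0 mul1r.
rewrite exprS sderivM IH mulrnAr mulrA -exprS.
by rewrite [sderiv f * _]mulrC -mulrS.
Qed.

Lemma iter_sder i f n : iter i (@sder K) f n = f (n + i)%N *+ ((n + i) ^_ i)%N.
Proof.
elim: i n => [|i IH] n; first by rewrite addn0 ffactn0.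
rewrite iterS /sder IH addSnnS -mulrnA; congr (_ *+ _).
by rewrite ffactnSr mulnC addnS subSn ?leq_addl // addnK mulnC.
Qed.

Definition sconst (a : K) : series K := series_of_poly a%:P.
HB.instance Definition _ := GRing.RMorphism.copy sconst
  (series_of_poly \o (@polyC K)).

Lemma sconstE a n : sconst a n = if n == 0%N then a else 0.
Proof. by rewrite /sconst /series_of_poly coefC. Qed.

Lemma sconstM a f n : (sconst a * f) n = a * f n.
Proof.
rewrite seriesM big_ord_recl sconstE /= subn0 big1 ?addr0 // => i _.
by rewrite sconstE mul0r.
Qed.

Lemma sderiv_const a : sderiv (sconst a) = 0.
Proof. by rewrite sderiv_poly derivC rmorph0. Qed.
End SeriesRing.

Section Comp.
Variables (K : fieldType) (a : K) (h : series K).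
Hypothesis h0 : h 0%N = a.
Implicit Types (f g : series K) (p : {poly K}).

Let H := h - sconst a.

Let H0 : forall i, (i < 1)%N -> H i = 0.
Proof. by case=> // _; rewrite /H seriesD seriesN sconstE h0 subrr. Qed.

Lemma expH_low k i : (i < k)%N -> (H ^+ k) i = 0.
Proof. by move=> lik; apply: (seriesX_low H0 k).1; rewrite muln1. Qed.

(** [H] has no constant term, so [H ^+ k] with [k > n] does not reach index [n] and the upper bound
    of the sum is free. A common bound makes two compositions comparable term by term. *)
Lemma scompE B f n : (n < B)%N ->
  scomp f a h n = \sum_(k < B) f k * (H ^+ k) n.
Proof.
move=> lnB; rewrite /scomp.
have -> : (fun m => h m - (if m == 0%N then a else 0)) = H :> series K.
  by apply: funext => m; rewrite /H seriesD seriesN sconstE.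
rewrite (big_ord_widen_cond B (fun=> true)
  (fun k => f k * spow (H : nat -> K) k n)) //=.
rewrite big_mkcond; apply: eq_bigr => k _; rewrite spowE.
by case: ltnP => //; rewrite ltnNge -ltnS => ?; rewrite expH_low ?mulr0 // ltnNge.
Qed.

(** The polynomial case of composition is a ring morphism by construction; truncation transfers
    multiplicativity to [scomp]. *)
Definition hcomp (p : {poly K}) : series K := (map_poly (@sconst K) p).[H].
HB.instance Definition _ := GRing.RMorphism.copy hcomp
  (horner_eval H \o map_poly (@sconst K)).

Lemma hcompE B p n : (size p <= B)%N -> hcomp p n = \sum_(k < B) p`_k * (H ^+ k) n.
Proof.
move=> leB; rewrite /hcomp (@horner_coef_wide _ B); last first.
  by rewrite (leq_trans (size_poly _ _)).
by rewrite series_sum; apply: eq_bigr => k _; rewrite coef_map /= sconstM.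
Qed.

Lemma hcomp_low p B n : (forall i, (i < B)%N -> p`_i = 0) -> (n < B)%N -> hcomp p n = 0.
Proof.
move=> hp lnB; rewrite (hcompE _ (leqnn _)) big1 // => k _.
case: (ltnP k B) => [/hp->|lBk]; first by rewrite mul0r.
by rewrite expH_low ?mulr0 // (leq_trans lnB).
Qed.

Lemma scomp_trunc B f n : (n < B)%N -> scomp f a h n = hcomp (series_trunc B f) n.
Proof.
move=> lnB; rewrite (scompE _ lnB) (hcompE _ (size_poly _ _)).
by apply: eq_bigr => k _; rewrite coef_poly ltn_ord.
Qed.

Lemma scompM f g : scomp (f * g) a h = (scomp f a h : series K) * scomp g a h.
Proof.
apply: funext => n; rewrite (@scomp_trunc n.+1) //.
transitivity (hcomp (series_trunc n.+1 f * series_trunc n.+1 g) n).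
  apply/eqP; rewrite -subr_eq0 -seriesN -seriesD -rmorphB /=.
  rewrite (@hcomp_low _ n.+1) // => i lin; rewrite coefB series_truncM ?subrr //.
rewrite rmorphM /= !seriesM; apply: eq_bigr => i _.
by rewrite -!scomp_trunc // ltnS ?leq_subr // -ltnS.
Qed.

Lemma scompD f g : scomp (f + g) a h = (scomp f a h : series K) + scomp g a h.
Proof.
apply: funext => n; rewrite seriesD !(@scompE n.+1) // -big_split.
by apply: eq_bigr => k _; rewrite seriesD mulrDl.
Qed.

Lemma scomp0 : scomp (0 : series K) a h = (0 : series K).
Proof.
by apply: funext => n; rewrite (@scompE n.+1) // big1 // => k _; rewrite mul0r.
Qed.

Lemma scomp_sum (I : Type) (r : seq I) (F : I -> series K) :
  scomp (\sum_(i <- r) F i) a h = \sum_(i <- r) (scomp (F i) a h : series K).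
Proof. by elim/big_rec2: _ => [|i x y _ <-]; rewrite ?scomp0 // scompD. Qed.

Lemma scomp_der f :
  sderiv (scomp f a h) = (scomp (sderiv f) a h : series K) * sderiv h.
Proof.
apply: funext => n.
have dH : sderiv h = sderiv H by rewrite /H raddfB /= sderiv_const subr0.
rewrite dH {1}/sderiv /sder (@scompE n.+2) //.
transitivity ((\sum_(k < n.+2) (sconst (f k) * sderiv (H ^+ k))) n).
  rewrite series_sum -sumrMnl; apply: eq_bigr => k _.
  by rewrite sconstM /sderiv /sder mulrnAr.
rewrite big_ord_recl expr0 -[1](rmorph1 (@sconst K)) sderiv_const mulr0 add0r.
transitivity (((\sum_(k < n.+1) sconst (sderiv f k) * H ^+ k) * sderiv H) n).
  rewrite mulr_suml; congr ((_ : series K) n); apply: eq_bigr => k _.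
  rewrite lift0 sderivX -mulrnAl mulrA; congr (_ * _).
  by rewrite /sderiv /sder raddfMn /= mulrnAr mulrnAl.
rewrite !seriesM; apply: eq_bigr => i _; congr (_ * _).
rewrite (@scompE n.+1) // series_sum; apply: eq_bigr => k _.
by rewrite sconstM.
Qed.

End Comp.

(** * An annihilating operator of order at most [deg_y P * ord L] *)

(** Gaussian elimination without division, so that it works over [{poly K}]: the induction runs on
    the 2 x 2 minors containing the pivot [p], and the weight of the pivot row is chosen to cancel
    the pivot column. *)
Lemma wide_left_kernel (R : idomainType) n m (A : 'I_m -> 'I_n -> R) : (n < m)%N ->
  exists2 v : 'I_m -> R, exists i, v i != 0 & forall j, \sum_i v i * A i j = 0.
Proof.
elim: n m A => [|n IH] [//|m] A lnm.
  by exists (fun=> 1); [exists ord0; exact: oner_neq0|case].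
have [/existsP [i0 pi]|/existsPn npi] := boolP [exists i, A i ord0 != 0]; last first.
  have [v vn0 hv] := IH m.+1 (fun i j => A i (lift ord0 j)) (ltnW lnm).
  exists v => // j; case: (unliftP ord0 j) => [k ->|->]; first exact: hv.
  by rewrite big1 // => i _; move/negPn/eqP: (npi i) => ->; rewrite mulr0.
pose p := A i0 ord0.
have [w [i1 wn0] hw] := IH m (fun i j => p * A (lift i0 i) (lift ord0 j) -
   A (lift i0 i) ord0 * A i0 (lift ord0 j)) lnm.
pose v i := if unlift i0 i is Some k then w k * p else - \sum_k w k * A (lift i0 k) ord0.
have v0 : v i0 = - \sum_k w k * A (lift i0 k) ord0 by rewrite /v unlift_none.
have vl k : v (lift i0 k) = w k * p by rewrite /v liftK.
exists v; first by exists (lift i0 i1); rewrite vl mulf_neq0.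
have sumE j : \sum_i v i * A i j = v i0 * A i0 j + \sum_k v (lift i0 k) * A (lift i0 k) j.
  rewrite (bigD1 i0) //=; congr (_ + _).
  rewrite (reindex_omap (lift i0) (unlift i0)) => [|i ni].
    by apply: eq_bigl => k; rewrite liftK eqxx andbT eq_sym neq_lift.
  by case: unliftP ni => [k ->|->] //=; rewrite eqxx.
move=> j; rewrite sumE v0 mulNr mulr_suml addrC -sumrB.
case: (unliftP ord0 j) => [k ->|->].
  by rewrite -[RHS](hw k); apply: eq_bigr => i _; rewrite vl; ring.
by rewrite big1 // => i _; rewrite vl /p; ring.
Qed.

(** * Bivariate polynomials evaluated along a power series *)

Section Eval.
Variables (K : fieldType) (h : series K).
Implicit Types E : {poly {poly K}}.

Definition eval_series E : series K := (map_poly (@series_of_poly K) E).[h].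
HB.instance Definition _ := GRing.RMorphism.copy eval_series
  (horner_eval h \o map_poly (@series_of_poly K)).

Lemma eval_seriesE B E : (size E <= B)%N ->
  eval_series E = \sum_(k < B) series_of_poly E`_k * h ^+ k.
Proof.
move=> leB; rewrite /eval_series (@horner_coef_wide _ B).
  by apply: eq_bigr => k _; rewrite coef_map.
by rewrite (leq_trans (size_poly _ _)).
Qed.

Lemma eval_seriesC (p : {poly K}) : eval_series p%:P = series_of_poly p.
Proof. by rewrite /eval_series map_polyC hornerC. Qed.

Lemma eval_seriesM : {morph eval_series : E1 E2 / E1 * E2}.
Proof. exact: rmorphM. Qed.
Lemma eval_seriesD : {morph eval_series : E1 E2 / E1 + E2}.
Proof. exact: rmorphD. Qed.
Lemma eval_seriesB : {morph eval_series : E1 E2 / E1 - E2}.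
Proof. exact: rmorphB. Qed.
Lemma eval_seriesX k : {morph eval_series : E / E ^+ k}.
Proof. exact: rmorphXn. Qed.
Lemma eval_seriesMn k : {morph eval_series : E / E *+ k}.
Proof. exact: rmorphMn. Qed.

Lemma eval_seriesZ (p : {poly K}) E :
  eval_series (p *: E) = series_of_poly p * eval_series E.
Proof. by rewrite -mul_polyC eval_seriesM eval_seriesC. Qed.

Lemma eval_series0 E : eval_series E 0%N = (map_poly (fun q : {poly K} => q.[0]) E).[h 0%N].
Proof.
rewrite (eval_seriesE (leqnn _)) series_sum (@horner_coef_wide _ (size E)) ?size_poly //.
apply: eq_bigr => k _; rewrite seriesM0 seriesX0 coef_map_id0 ?horner0 //.
by rewrite horner_coef0.
Qed.

Lemma is_ser_rootE E : is_ser_root E h <-> eval_series E = 0.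
Proof.
have E1 n : \sum_(k < size E) smul (sexp E`_k 0) (spow h k) n = eval_series E n.
  rewrite (eval_seriesE (leqnn _)) series_sum; apply: eq_bigr => k _.
  by rewrite sexp0 spowE.
split=> [hE|hE n]; last by rewrite E1 hE.
by apply: funext => n; rewrite -E1.
Qed.

Lemma sderiv_eval E : sderiv (eval_series E) =
  eval_series (map_poly (@deriv K) E) + eval_series E^`() * sderiv h.
Proof.
pose B := size E.
rewrite (eval_seriesE (leqnSn B)) (@eval_seriesE B.+1) ?(leq_trans (size_poly _ _)) //.
rewrite (@eval_seriesE B) ?(leq_trans (size_poly _ _)) ?leq_pred //.
rewrite raddf_sum /= mulr_suml.
transitivity (\sum_(k < B.+1) series_of_poly (E`_k)^`() * h ^+ k +
              \sum_(k < B.+1) series_of_poly E`_k * sderiv (h ^+ k)).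
  rewrite -big_split; apply: eq_bigr => k _ /=.
  by rewrite sderivM sderiv_poly.
congr (_ + _); first by apply: eq_bigr => k _; rewrite coef_map.
rewrite big_ord_recl expr0 -[1](rmorph1 (@sconst K)) sderiv_const mulr0 add0r.
apply: eq_bigr => k _; rewrite lift0 sderivX coef_deriv raddfMn /=.
by rewrite mulrnAr !mulrnAl mulrA.
Qed.
End Eval.

(** Expanding [l] around [h 0] and substituting [h - h 0] gives back [l(h)]. The coefficients of [L]
    thereby become polynomials in [y] evaluated at a root. *)
Lemma scomp_sexp (K : fieldType) (h : series K) (l : {poly K}) :
  scomp (sexp l (h 0%N)) (h 0%N) h = eval_series h (map_poly polyC l) :> series K.
Proof.
set a := h 0%N.
transitivity (hcomp a h (l \Po ('X + a%:P))).
  apply: funext => n; set p := _ \Po _.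
  rewrite (@scompE _ _ _ erefl (maxn n.+1 (size p))) ?leq_max ?leqnn //.
  by rewrite (@hcompE _ _ _ (maxn n.+1 (size p))) // leq_max leqnn orbT.
rewrite /hcomp map_comp_poly rmorphD /= map_polyX map_polyC /= horner_comp.
rewrite hornerD hornerX hornerC subrK /eval_series -map_poly_comp //.
Qed.

Lemma eval_lift_coef0 (K : fieldType) (h : series K) (l : {poly K}) :
  eval_series h (map_poly polyC l) 0%N = l.[h 0%N].
Proof.
rewrite -scomp_sexp /scomp big_ord1 spowE expr0 series1 mulr1 /sexp.
by rewrite -horner_coef0 horner_comp !hornerE.
Qed.

Lemma sapplyE (K : fieldType) B (M : {poly {poly K}}) (a : K) (f : series K) :
  (size M <= B)%N ->
  sapply M a f = \sum_(i < B) (sexp M`_i a : series K) * iter i (@sder K) f :> series K.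
Proof.
move=> leB; apply: funext => n; rewrite series_sum /sapply.
rewrite (big_ord_widen B (fun i => smul (sexp M`_i a) (iter i (@sder K) f) n)) //.
rewrite big_mkcond; apply: eq_bigr => i _; case: ltnP => // lei.
by rewrite nth_default // sexpE comp_poly0 rmorph0 mul0r.
Qed.

Section Annihilator.
Variables (K : fieldType) (P L : {poly {poly K}}) (t : nat).
Hypothesis sL : size L = t.+2.
Hypothesis P_gt1 : (1 < size P)%N.
Hypothesis lcP0 : (lead_coef P).[0] != 0.
Let s := t.+1.
Let r := (size P).-1.
Let lam : {poly {poly K}} := map_poly polyC (lead_coef L).
Let Px := map_poly (@deriv K) P.
Let Py := P^`().
Let delta := lam * Py.
(** Along a root [h] of [P] one has [P_y h' = - P_x], so [theta E] represents [P_y] times the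
    derivative of [E(x, h(x))] and is still a polynomial. *)
Let theta E := map_poly (@deriv K) E * Py - E^`() * Px.
(** Let [F_i] be the composition of the [i]-th derivative of [f] with [h]. If [a] lists the
    coordinates of a combination of [F_0, ..., F_t], then [nabla a] lists those of [delta] times its
    derivative; the new [F_(t+1)] is eliminated by [L f = 0], at the price of the factor [lam]. *)
Let nabla (a : nat -> {poly {poly K}}) : nat -> {poly {poly K}} := fun i =>
  lam * theta (a i) - (if i is j.+1 then lam * Px * a j else 0)
    + a t * Px * map_poly polyC L`_i.
(** Coordinates of [delta ^+ (2 k)] times the [k]-th derivative of [F_0]. Each step costs two
    factors [delta]: one for [nabla], one to keep the derivative of the earlier power of [delta]
    polynomial. *)
Let vec := fix vec k : nat -> {poly {poly K}} :=
  if k is k'.+1 then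
    fun i => delta * nabla (vec k') i - (lam * theta delta * vec k' i) *+ (k'.*2)
  else fun i => (i == 0%N)%:R.

Section OneRoot.
Variable h : series K.
Hypothesis hroot : eval_series h P = 0.
Variable f : series K.
Hypothesis hf : solves L (h 0%N) f.
Let ev := eval_series h.
Let F i : series K := scomp (iter i (@sder K) f) (h 0%N) h.
Let Ev (a : nat -> {poly {poly K}}) := \sum_(i < s) ev (a i) * F i.

Let evM : {morph ev : E1 E2 / E1 * E2} := @eval_seriesM K h.
Let evD : {morph ev : E1 E2 / E1 + E2} := @eval_seriesD K h.
Let evB : {morph ev : E1 E2 / E1 - E2} := @eval_seriesB K h.
Let evMn k : {morph ev : E / E *+ k} := @eval_seriesMn K h k.

Let ev0 : ev 0 = 0 := rmorph0 (@eval_series K h).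
Let ev1 : ev 1 = 1 := rmorph1 (@eval_series K h).

Let evP : ev Py * sderiv h = - ev Px.
Proof.
apply/eqP; rewrite -addr_eq0 addrC /ev -sderiv_eval hroot.
by rewrite raddf0.
Qed.

Let ev_theta E : ev Py * sderiv (ev E) = ev (theta E).
Proof.
rewrite /ev sderiv_eval eval_seriesB !eval_seriesM mulrDr mulrCA evP mulrN.
by rewrite [eval_series h Py * _]mulrC.
Qed.

Let DF i : sderiv (F i) = F i.+1 * sderiv h.
Proof. by rewrite /F scomp_der. Qed.

Let LF : ev lam * F s = - \sum_(i < s) ev (map_poly polyC L`_i) * F i.
Proof.
apply/eqP; rewrite -addr_eq0; apply/eqP.
have h1 : \sum_(i < size L) (sexp L`_i (h 0%N) : series K) * iter i (@sder K) f = 0.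
  by apply: funext => n; rewrite series_sum; apply: hf.
have := congr1 (fun g : series K => scomp g (h 0%N) h : series K) h1.
rewrite scomp_sum // scomp0 // => E1; rewrite -[RHS]E1.
rewrite sL [RHS]big_ord_recr [LHS]addrC; congr (_ + _).
  by apply: eq_bigr => i _; rewrite scompM // scomp_sexp.
by rewrite scompM // scomp_sexp /lam lead_coefE sL.
Qed.

Let Ev_nabla a : ev delta * sderiv (Ev a) = Ev (nabla a).
Proof.
rewrite {1}/Ev raddf_sum /=.
transitivity (ev lam * (\sum_(i < s) ev (theta (a i)) * F i)
   - ev Px * (ev lam * \sum_(i < s) ev (a i) * F i.+1)).
  rewrite /delta evM -mulrA [ev Px * _]mulrCA -mulrBr; congr (_ * _).
  rewrite !mulr_sumr -sumrB; apply: eq_bigr => i _.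
  rewrite sderivM DF mulrDr mulrA ev_theta.
  rewrite (_ : ev Py * _ = ev Py * sderiv h * (ev (a i) * F i.+1)); last by ring.
  by rewrite evP mulNr.
rewrite [X in ev Px * (ev lam * X)]big_ord_recr /=.
rewrite [ev lam * (_ + _)]mulrDr [ev lam * (ev (a t) * _)]mulrCA LF.
rewrite mulrN mulrBr opprB [LHS]addrA addrAC.
transitivity (\sum_(i < s) (ev (lam * theta (a i)) * F i
  - ev (if val i is j.+1 then lam * Px * a j else 0) * F i
  + ev (a t * Px * map_poly polyC L`_i) * F i)); last first.
  by apply: eq_bigr => i _; rewrite evD evB !mulrDl mulNr.
rewrite big_split sumrB /=; congr (_ + _ + _).
- by rewrite mulr_sumr; apply: eq_bigr => i _; rewrite evM mulrA.
- rewrite big_ord_recl /= ev0 mul0r add0r mulrA mulr_sumr; congr (- _).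
  by apply: eq_bigr => i _; rewrite !evM; ring.
rewrite !mulr_sumr; apply: eq_bigr => i _; rewrite !evM; ring.
Qed.

Let vecP k : ev delta ^+ (k.*2) * iter k (@sderiv K) (F 0%N) = Ev (vec k).
Proof.
elim: k => [|k IH].
  rewrite expr0 mul1r /Ev big_ord_recl /= ev1 mul1r big1 ?addr0 // => i _.
  by rewrite ev0 mul0r.
rewrite doubleS iterS.
transitivity (ev delta * (ev delta * sderiv (ev delta ^+ k.*2 * iter k (@sderiv K) (F 0%N)))
  - (ev (lam * theta delta) * (ev delta ^+ k.*2 * iter k (@sderiv K) (F 0%N))) *+ k.*2).
  set X := iter k _ _; rewrite sderivM evM -ev_theta.
  rewrite (_ : ev lam * _ = ev delta * sderiv (ev delta)); last first.
    by rewrite mulrA -evM.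
  case: (k.*2) => [|e]; last by rewrite sderivX !exprS; ring.
  by rewrite expr0 -[1](rmorph1 (@sconst K)) sderiv_const rmorph1; ring.
rewrite IH Ev_nabla /Ev !mulr_sumr -sumrMnl -sumrB; apply: eq_bigr => i _ /=.
by rewrite evB evMn !evM; ring.
Qed.

Lemma vec_spec k : ev delta ^+ (k.*2) * iter k (@sderiv K) (scomp f (h 0%N) h) =
  \sum_(i < s) ev (vec k i) * F i.
Proof. exact: vecP. Qed.
End OneRoot.

(** Modulo [P] the coordinate vectors have [s r] entries in [{poly K}], so those of the derivatives
    of order 0 to [s r] are linearly dependent. The relation is computed from [P] and [L] alone and
    therefore serves all roots and all solutions at once. *)
Lemma exists_annihilator :
  (forall h, is_ser_root P h ->
     eval_series h P^`() 0%N != 0 /\ (lead_coef L).[h 0%N] != 0) ->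
  exists2 Q : {poly {poly K}}, Q != 0 /\ (size Q <= (t.+1 * (size P).-1).+1)%N &
    annihilates_comp P L Q.
Proof.
move=> hP; rewrite -/s -/r; set N := (s * r)%N.
pose w k i := delta ^+ (N - k).*2 * vec k i.
(* Pseudo-division by [P] multiplies by a power of its leading coefficient that varies with the
   entry; the sum of these exponents bounds them all. *)
pose M := (\sum_(k < N.+1) \sum_(i < s) scalp (w k i) P)%N.
pose lc := lead_coef P.
pose red k i := lc ^+ (M - scalp (w k i) P) *: (w k i %% P).
have P0 : P != 0 by rewrite -size_poly_gt0 ltnW.
have red_size k i : (size (red k i) <= r)%N.
  rewrite (leq_trans (size_scale_leq _ _)) // -ltnS /r prednK ?(ltnW P_gt1) //.
  by rewrite ltn_modp.
have evred h (k : 'I_N.+1) (i : 'I_s) : eval_series h P = 0 ->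
    eval_series h (red k i) = series_of_poly (lc ^+ M) * eval_series h (w k i).
  move=> hr; have leM : (scalp (w k i) P <= M)%N.
    by rewrite /M (bigD1 k) //= (bigD1 i) //= -addnA leq_addr.
  have := congr1 (eval_series h) (Pdiv.Idomain.divp_eq (w k i) P).
  rewrite eval_seriesD eval_seriesM hr mulr0 add0r eval_seriesZ => E1.
  rewrite eval_seriesZ -E1 mulrA -rmorphM /= -exprD subnK //.
pose A (k : 'I_N.+1) (j : 'I_N) : {poly K} :=
  mxvec (\matrix_(i < s, l < r) (red k i)`_l) 0 j.
have [q [k0 qk0] hq] := wide_left_kernel A (ltnSn N).
exists (\poly_(k < N.+1) q (inord k)); first split.
- apply/eqP => /(congr1 (fun Q : {poly {poly K}} => Q`_k0)).
  by rewrite coef_poly ltn_ord inord_val coef0; apply/eqP.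
- exact: size_poly.
move=> h hroot f hf n; have [Py0 l0] := hP h hroot.
have hr : eval_series h P = 0 by apply/is_ser_rootE.
set phi : series K := scomp f (h 0%N) h.
rewrite (sapplyE _ _ (size_poly _ _)).
set S := \sum_(i < _) _; suff -> : S = 0 by [].
(* The common factor of all terms. Its constant coefficient is nonzero because [lc], [P_y] and the
   leading coefficient of [L] do not vanish at the base point. *)
pose u : series K := series_of_poly (lc ^+ M) * eval_series h delta ^+ N.*2.
have u0 : u <> 0.
  apply: series_coef0_neq0; rewrite /u seriesM0 seriesX0 mulf_neq0 ?expf_neq0 //.
    by rewrite -[series_of_poly _ _]horner_coef0 horner_exp expf_neq0.
  rewrite /delta eval_seriesM seriesM0 mulf_neq0 //.
  by rewrite eval_lift_coef0.
apply: (series_mulf_eq0 _ u0); rewrite /S mulr_sumr.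
transitivity (\sum_(k < N.+1) \sum_(i < s) \sum_(l < r)
   series_of_poly (q k * (red k i)`_l) * ((h : series K) ^+ l *
     (scomp (iter i (@sder K) f) (h 0%N) h : series K))).
  apply: eq_bigr => k _; rewrite coef_poly ltn_ord inord_val sexp0.
  have lekN : (k <= N)%N by rewrite -ltnS.
  move: (vec_spec hr hf k : eval_series h delta ^+ k.*2 * iter k (@sder K) phi = _).
  move: (iter k (@sder K) phi : series K) => X vX.
  have -> : u * (series_of_poly (q k) * X) =
     series_of_poly (q k) * (series_of_poly (lc ^+ M) * (eval_series h delta ^+ (N - k).*2
      * (eval_series h delta ^+ k.*2 * X))).
    rewrite [eval_series h delta ^+ (N - k).*2 * _]mulrA -exprD -doubleD subnK //.
    by rewrite /u [LHS]mulrCA -[in LHS]mulrA.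
  rewrite vX !mulr_sumr; apply: eq_bigr => i _.
  rewrite -eval_seriesX (mulrA (eval_series h _)) -eval_seriesM -/(w k i).
  rewrite (mulrA (series_of_poly (lc ^+ M))) -evred //.
  rewrite (eval_seriesE _ (red_size k i)) mulr_suml mulr_sumr.
  by apply: eq_bigr => l _; rewrite rmorphM /=; ring.
rewrite exchange_big big1 // => i _; rewrite exchange_big big1 // => l _.
rewrite -mulr_suml -rmorph_sum /= -[X in series_of_poly X * _](_ : 0 = _).
  by rewrite rmorph0 mul0r.
rewrite -[LHS](hq (mxvec_index i l)); apply: eq_bigr => k _.
by rewrite /A mxvecE mxE.
Qed.

End Annihilator.

(** * Minimal operators and their singularity at the origin *)

Lemma ex_min_nat (A : nat -> Prop) : (exists n, A n) ->
  exists2 n, A n & forall m, A m -> (n <= m)%N.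
Proof.
move=> [n0 An0]; have ex : exists n, `[< A n >] by exists n0; apply/asboolP.
case: (ex_minnP ex) => n /asboolP An hn; exists n => // m Am.
by apply: hn; apply/asboolP.
Qed.

Section MinimalOperator.
Variables (K : fieldType) (PK L : {poly {poly K}}).

Lemma sapply_polyCM (d : {poly K}) (M : {poly {poly K}}) (f : series K) :
  sapply (d%:P * M) 0 f = series_of_poly d * (sapply M 0 f : series K) :> series K.
Proof.
have leB : (size (d%:P * M)%R <= size M)%N.
  by rewrite mul_polyC size_scale_leq.
rewrite (sapplyE _ _ leB) (sapplyE _ _ (leqnn _)) mulr_sumr.
by apply: eq_bigr => i _; rewrite !sexp0 coefCM rmorphM mulrA.
Qed.

(** Among the annihilating operators of least order, one whose leading coefficient has least degree
    is primitive: a common factor could be divided out, as series have no zero divisors. *)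
Lemma exists_minop (Q : {poly {poly K}}) :
  Q != 0 -> annihilates_comp PK L Q -> exists M, is_minop PK L M.
Proof.
move=> Q0 annQ.
pose A n := exists M : {poly {poly K}}, [/\ M != 0, annihilates_comp PK L M & size M = n].
have [|n An minn_] := @ex_min_nat A; first by exists (size Q), Q.
pose B d := exists M : {poly {poly K}}, [/\ M != 0, annihilates_comp PK L M, size M = n &
  size (lead_coef M) = d].
have [|d [M [M0 annM sM sd]] mind] := @ex_min_nat B.
  by have [M [M0 annM sM]] := An; exists (size (lead_coef M)), M.
exists M; split=> //; last by move=> Q' Q'0 annQ'; rewrite sM minn_ //; exists Q'.
move=> e he.
have e0 : e != 0.
  apply: contraNneq M0 => e0; apply/eqP/polyP => i; rewrite coef0; apply/eqP.
  by have := he i; rewrite e0 dvd0p.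
pose M' := map_poly (fun p => p %/ e) M.
have ME : M = e%:P * M'.
  by apply/polyP=> i; rewrite coefCM coef_map_id0 ?div0p // mulrC divpK.
have M'0 : M' != 0 by apply: contraNneq M0 => z; rewrite ME z mulr0.
have lcE : lead_coef M = e * lead_coef M' by rewrite {1}ME lead_coefM lead_coefC.
have sM' : size M' = n by rewrite -sM [in RHS]ME mul_polyC size_scale.
have annM' : annihilates_comp PK L M'.
  move=> h hr f hf.
  have := annM h hr f hf; rewrite ME => sol.
  suff : (sapply M' 0 (scomp f (h 0%N) h) : series K) = 0 by move=> + k => ->.
  apply: (@series_mulf_eq0 _ (series_of_poly e)); last exact: series_of_poly_neq0.
  by rewrite -sapply_polyCM; apply: funext.
have lc'0 : lead_coef M' != 0 by rewrite lead_coef_eq0.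
have lem : (d <= size (lead_coef M'))%N by apply: mind; exists M'.
move: lem; rewrite -sd lcE size_mul //.
move: lc'0; rewrite -size_poly_gt0; set x := size e; set y := size (lead_coef M').
by lia.
Qed.
End MinimalOperator.

Section Singularity.
Variables (K : fieldType) (M : {poly {poly K}}) (N : nat).
Hypothesis char0 : [pchar K] =i pred0.
Hypothesis primM : op_primitive M.
Hypothesis sM : (size M <= N.+1)%N.
Implicit Types f : series K.

Lemma natf_fact_neq0 i : (i`!)%:R != 0 :> K.
Proof. by rewrite (pcharf0P K).1 // -lt0n fact_gt0. Qed.

Lemma sapply_coef0 f : sapply M 0 f 0%N = \sum_(i < N.+1) (M`_i)`_0 * f i * (i`!)%:R.
Proof.
rewrite (sapplyE _ _ sM) series_sum; apply: eq_bigr => i _.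
by rewrite seriesM0 sexp0 iter_sder add0n ffactnn -[f i *+ _]mulr_natr mulrA.
Qed.

Lemma sapply_coef1 f : sapply M 0 f 1%N =
  \sum_(i < N.+1) ((M`_i)`_0 * f i.+1 * (i.+1`!)%:R + (M`_i)`_1 * f i * (i`!)%:R).
Proof.
rewrite (sapplyE _ _ sM) series_sum; apply: eq_bigr => i _.
rewrite seriesM !big_ord_recl big_ord0 addr0 sexp0 !iter_sder subn0 subnn.
rewrite lift0 add0n ffactnn add1n -[f i *+ _]mulr_natr -[f i.+1 *+ _]mulr_natr !mulrA.
by rewrite -[in RHS]ffactnn ffactnSr subSnn muln1.
Qed.

Lemma primitive_coef0 : exists2 i, (i < N.+1)%N & (M`_i)`_0 != 0.
Proof.
apply: contrapT => h.
have : forall i, 'X %| M`_i.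
  move=> i; rewrite -['X]subr0 -polyC0 dvdp_XsubCl rootE horner_coef0.
  case: (ltnP i N.+1) => [liN|leNi]; last first.
    by rewrite (nth_default _ (leq_trans sM leNi)) coef0.
  by apply: contrapT => /negP hi; apply: h; exists i.
by move/primM; rewrite size_polyX.
Qed.

(** If the top coefficient vanished at 0, the constant term of [M f = 0] for the solutions
    [f = x^j + O(x^N)] would force all other coefficients to vanish there too, against
    primitivity. *)
Lemma nonsingular_top :
  (forall j, (j < N)%N -> exists2 f, solves M 0 f &
     forall i, (i < N)%N -> f i = (i == j)%:R) ->
  (M`_N)`_0 != 0.
Proof.
move=> hW; apply/eqP => MN0; have [i liN] := primitive_coef0; case/eqP.
move: liN; rewrite ltnS leq_eqVlt => /orP [/eqP-> //|liN].
have [f solf hf] := hW i liN.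
have := solf 0%N; rewrite sapply_coef0 big_ord_recr /= MN0 !mul0r addr0.
rewrite (bigD1 (Ordinal liN)) //= hf // eqxx mulr1 big1 ?addr0 => [/eqP|j nj].
  by rewrite mulf_eq0 (negPf (natf_fact_neq0 _)) orbF => /eqP.
by rewrite hf // -val_eqE in nj *; rewrite (negPf nj) mulr0 mul0r.
Qed.
End Singularity.

(** * Operators whose exponents at the origin leave out a single integer *)

Section Removable.
Variables (K : fieldType) (M : {poly {poly K}}) (N : nat).
Hypothesis char0 : [pchar K] =i pred0.
Hypothesis primM : op_primitive M.
Hypothesis sM : (size M <= N.+2)%N.
Implicit Types f : series K.
Hypothesis low : forall j, (j < N)%N -> exists2 f, solves M 0 f &
     forall i, (i < N)%N -> f i = (i == j)%:R.
Hypothesis gap : exists2 f, solves M 0 f &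
     forall i, (i < N.+2)%N -> f i = (i == N.+1)%:R.

Lemma gap_top0 : (M`_N.+1)`_0 = 0.
Proof.
have [f solf hf] := gap; have /eqP := solf 0%N.
rewrite (sapply_coef0 sM) big_ord_recr /= big1 ?add0r => [|i _].
  by rewrite hf // eqxx mulr1 mulf_eq0 (negPf (natf_fact_neq0 char0 _)) orbF => /eqP.
by rewrite hf ?(ltn_eqF (ltn_ord i)) ?mulr0 ?mul0r // ltnS ltnW.
Qed.

Lemma gap_sub0 : (M`_N)`_0 != 0.
Proof.
apply/eqP => MN0; have [i liN] := primitive_coef0 primM sM; case/eqP.
move: liN; rewrite ltnS leq_eqVlt => /orP [/eqP-> |]; first exact: gap_top0.
rewrite ltnS leq_eqVlt => /orP [/eqP-> //|liN].
have [f solf hf] := low liN.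
have := solf 0%N; rewrite (sapply_coef0 sM) !big_ord_recr /= MN0 gap_top0 !mul0r !addr0.
rewrite (bigD1 (Ordinal liN)) //= hf // eqxx mulr1 big1 ?addr0 => [/eqP|j nj].
  by rewrite mulf_eq0 (negPf (natf_fact_neq0 char0 _)) orbF => /eqP.
by rewrite hf // -val_eqE in nj *; rewrite (negPf nj) mulr0 mul0r.
Qed.

(** For the solution [f = x^(N+1) + ...], only these two terms survive in the coefficient of [x] in
    [M f]. Hence the top coefficient has a simple zero at 0. *)
Lemma gap_top1 : (M`_N.+1)`_1 = - (M`_N)`_0.
Proof.
have [f solf hf] := gap; have /eqP := solf 1%N.
rewrite (sapply_coef1 sM) !big_ord_recr /= big1 ?add0r => [|i _].
  rewrite gap_top0 !mul0r add0r !hf // (ltn_eqF (ltnSn N)) mulr0 mul0r addr0.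
  rewrite eqxx !mulr1 -mulrDl mulf_eq0 (negPf (natf_fact_neq0 char0 _)) orbF.
  by rewrite addrC addr_eq0 => /eqP.
have li := ltn_ord i.
rewrite !hf; try lia.
by rewrite !ltn_eqF ?mulr0 ?mul0r ?addr0 //; lia.
Qed.

Lemma gap_size : size M = N.+2.
Proof.
apply/eqP; rewrite eqn_leq sM ltnNge; apply/negP => leM.
have := gap_top1; rewrite [M`_N.+1]nth_default // coef0 => /eqP.
by rewrite eq_sym oppr_eq0 (negPf gap_sub0).
Qed.

Lemma gap_root : root (lead_coef M) 0.
Proof. by rewrite lead_coefE gap_size rootE horner_coef0 gap_top0. Qed.

(** All coefficients of [(d + a) M] vanish at 0, so it can be divided by [x]; its leading
    coefficient is that of [M], whose zero is simple. *)
Lemma gap_removable : removable_cost1_at0 M.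
Proof.
(* The value that makes the coefficient of [d^N] in [(d + a) M] vanish at 0. *)
pose a : K := - ((M`_N)`_1 + (if N is N'.+1 then (M`_N')`_0 else 0)) / (M`_N)`_0.
exists a%:P, 1, 'X; split; first by rewrite polyX_eq0.
set Q := _ + _.
have QE i : Q`_i = a *: M`_i + (M`_i)^`() + (if i is j.+1 then M`_j else 0).
  rewrite /Q coefD mul1r coefCM mul_polyC /opD coefD coef_map_id0 ?deriv0 //.
  by rewrite coefXM addrA; case: i.
have QE0 i : (Q`_i)`_0 = a * (M`_i)`_0 + (M`_i)`_1 + (if i is j.+1 then (M`_j)`_0 else 0).
  rewrite QE !coefD coefZ coef_deriv mulr1n; case: i => [|i] //.
  by rewrite coef0.
have Q0 i : (Q`_i)`_0 = 0.
  have hi1 j : (N.+2 <= j)%N -> (Q`_j)`_0 = 0.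
    case: j => // j lj; rewrite QE0 [M`_j.+1]nth_default ?(leq_trans sM) //.
    rewrite !coef0 mulr0 !add0r; move: lj; rewrite ltnS leq_eqVlt => /orP [/eqP <-|lj].
      exact: gap_top0.
    by rewrite [M`_j]nth_default ?coef0 // (leq_trans sM).
  have hN1 : (Q`_N.+1)`_0 = 0 by rewrite QE0 gap_top0 gap_top1 mulr0 add0r addNr.
  have hN : (Q`_N)`_0 = 0.
    by rewrite QE0 -addrA /a mulrAC -mulrA mulfV ?gap_sub0 // mulr1 addNr.
  case: (ltngtP i N) => [liN|lNi|-> //]; last first.
    by move: lNi; rewrite leq_eqVlt => /orP [/eqP <- //|]; apply: hi1.
  have [f solf hf] := low liN.
  (* The constant term of [(d + a) M f = 0]. The uncontrolled coefficients of [f], from index [N]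
     on, meet coefficients of [Q] already known to vanish at 0. *)
  have E : \sum_(j < N.+3) (Q`_j)`_0 * f j * (j`!)%:R = 0.
    transitivity (a * sapply M 0 f 0%N + sapply M 0 f 1%N); last first.
      by rewrite !solf mulr0 addr0.
    rewrite (sapply_coef0 sM) (sapply_coef1 sM) mulr_sumr.
    rewrite [X in _ = _ + X]big_split /= [X in _ = _ + X]addrC addrA -big_split /=.
    rewrite [X in _ = _ + X](_ : _ = \sum_(j < N.+3)
      (if val j is k.+1 then (M`_k)`_0 else 0) * f j * (j`!)%:R); last first.
      by rewrite [RHS]big_ord_recl /= !mul0r add0r.
    transitivity (\sum_(j < N.+3) (a * (M`_j)`_0 + (M`_j)`_1) * f j * (j`!)%:R
      + \sum_(j < N.+3) (if val j is k.+1 then (M`_k)`_0 else 0) * f j * (j`!)%:R).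
      by rewrite -big_split; apply: eq_bigr => j _; rewrite QE0 [in LHS]mulrDl [in LHS]mulrDl.
    congr (_ + _); rewrite big_ord_recr /= [M`_N.+2]nth_default ?sM //.
    rewrite !coef0 mulr0 addr0 !mul0r addr0; apply: eq_bigr => j _; ring.
  move/eqP: E; rewrite !big_ord_recr /= hN hN1 hi1 // !mul0r !addr0.
  rewrite (bigD1 (Ordinal liN)) //= hf // eqxx mulr1 big1 ?addr0 => [|j nj].
    by rewrite mulf_eq0 (negPf (natf_fact_neq0 char0 _)) orbF => /eqP.
  by rewrite hf // -val_eqE in nj *; rewrite (negPf nj) mulr0 mul0r.
split=> [i|].
  by rewrite -['X]subr0 -polyC0 dvdp_XsubCl rootE horner_coef0 Q0.
have QN2 : Q`_N.+2 = M`_N.+1.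
  by rewrite QE [M`_N.+2]nth_default // scaler0 deriv0 !add0r.
have MN1 : (M`_N.+1)`_1 != 0 by rewrite gap_top1 oppr_eq0 gap_sub0.
have sQ : size Q = N.+3.
  apply/eqP; rewrite eqn_leq; apply/andP; split.
    apply/leq_sizeP => j lj; rewrite QE; case: j lj => // j lj.
    rewrite !nth_default ?(leq_trans sM) // ?scaler0 ?deriv0 ?addr0 //; lia.
  rewrite ltnNge; apply: contra MN1 => leQ.
  by rewrite -QN2 [Q`_N.+2]nth_default // coef0.
rewrite lead_coefE sQ /= QN2.
have /dvdpP [q qE] : 'X %| M`_N.+1.
  by rewrite -['X]subr0 -polyC0 dvdp_XsubCl rootE horner_coef0 gap_top0.
rewrite qE mulpK ?polyX_eq0 // rootE horner_coef0.
by rewrite qE coefMX /= in MN1.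
Qed.
End Removable.

(** * Power series roots of [P] *)

Lemma horner_taylor2 (R : comNzRingType) (p : {poly R}) (x e : R) :
  exists u, p.[x + e] = p.[x] + p^`().[x] * e + e ^+ 2 * u.
Proof.
elim/poly_ind: p => [|p c [u IH]].
  by exists 0; rewrite deriv0 !horner0 mul0r mulr0 !addr0.
exists (p^`().[x] + u * (x + e)).
rewrite !hornerE derivD derivM derivX derivC !hornerE IH; ring.
Qed.

Section Agree.
Variable K : fieldType.
Implicit Types f g : series K.

Lemma eq_upto_mul n f f' g g' :
  (forall i, (i <= n)%N -> f i = f' i) -> (forall i, (i <= n)%N -> g i = g' i) ->
  forall i, (i <= n)%N -> (f * g) i = (f' * g') i.
Proof.
move=> hf hg i lin; rewrite !seriesM; apply: eq_bigr => j _.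
rewrite hf ?hg // ?(leq_trans (leq_subr _ _) lin) //.
by rewrite (leq_trans _ lin) // -ltnS.
Qed.

Lemma eq_upto_exp n f g k : (forall i, (i <= n)%N -> f i = g i) ->
  forall i, (i <= n)%N -> (f ^+ k) i = (g ^+ k) i.
Proof.
move=> hfg; elim: k => [|k IH] i lin; first by rewrite !expr0.
by rewrite !exprS; apply: (eq_upto_mul hfg IH).
Qed.

Lemma eq_upto_eval n f g (E : {poly {poly K}}) : (forall i, (i <= n)%N -> f i = g i) ->
  forall i, (i <= n)%N -> eval_series f E i = eval_series g E i.
Proof.
move=> hfg i lin; rewrite !(eval_seriesE _ (leqnn _)) !series_sum.
apply: eq_bigr => k _; apply: (@eq_upto_mul n) => //.
exact: eq_upto_exp.
Qed.

Lemma eval_series_poly (E : {poly {poly K}}) (q : {poly K}) :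
  eval_series (series_of_poly q) E = series_of_poly E.[q].
Proof. by rewrite /eval_series horner_map. Qed.
End Agree.

(** Newton's method, one coefficient per step: by Taylor's formula a correction in [x^(n+1)] acts on
    the coefficient of that index through the nonzero factor [d] alone. *)
Lemma hensel (K : fieldType) (P : {poly {poly K}}) (a : K) :
  (map_poly (fun q : {poly K} => q.[0]) P).[a] = 0 ->
  (map_poly (fun q : {poly K} => q.[0]) P^`()).[a] != 0 ->
  exists2 h : series K, eval_series h P = 0 & h 0%N = a.
Proof.
move=> Pa0; set d := (_).[a] => d0.
have ev0 (E : {poly {poly K}}) (q : {poly K}) : q`_0 = a ->
    (E.[q])`_0 = (map_poly (fun q : {poly K} => q.[0]) E).[a].
  move=> <-; rewrite -!horner_coef0.
  exact: (esym (horner_map (horner_eval (0 : K)) E q)).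
pose q := fix q n := if n is n'.+1 then
  q n' - ((P.[q n'])`_(n'.+1) / d) *: 'X^(n'.+1) else a%:P.
have q0 n : (q n)`_0 = a.
  elim: n => [|n IH] /=; first by rewrite coefC.
  by rewrite coefB coefZ coefXn mulr0 subr0 IH.
have hq n i : (i <= n)%N -> (P.[q n])`_i = 0.
  elim: n i => [|n IH] i; first by rewrite leqn0 => /eqP ->; rewrite ev0 ?q0.
  move=> lin /=; set c := _ / d.
  have [u ->] := horner_taylor2 P (q n) (- (c *: 'X^(n.+1))).
  rewrite !coefD mulrN coefN -scalerAr coefZ coefMXn.
  have -> : ((- (c *: 'X^(n.+1))) ^+ 2 * u)`_i = 0.
    rewrite sqrrN exprZn -exprM -mul_polyC -mulrA coefCM mulrC.
    rewrite [_ * u]mulrC coefMXn.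
    by rewrite (leq_ltn_trans lin) ?mul0r // muln2 -addnn -addSnnS leq_addr.
  rewrite addr0; move: lin; rewrite leq_eqVlt => /orP [/eqP->|lin].
    by rewrite ltnn subnn ev0 ?q0 // -/d /c divfK ?subrr.
  by rewrite lin IH // mulr0 subr0.
pose h : series K := fun n => (q n)`_n.
have hE n i : (i <= n)%N -> (q n)`_i = h i.
  elim: n => [|n IH]; first by rewrite leqn0 => /eqP ->.
  rewrite leq_eqVlt => /orP [/eqP-> //|lin] /=.
  by rewrite coefB coefZ coefXn (ltn_eqF lin) mulr0 subr0 IH.
exists h; last by rewrite /h /= coefC.
apply: funext => n.
rewrite (@eq_upto_eval _ n _ (series_of_poly (q n))) // => [|i /hE <- //].
by rewrite eval_series_poly /series_of_poly hq.
Qed.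

Section Roots.
Variables (C : fieldType) (K : closedFieldType) (iota : {rmorphism C -> K}).
Hypothesis charC0 : [pchar C] =i pred0.
Variable P : {poly {poly C}}.
Hypothesis hrP : (1 < (size P).-1)%N.
Hypothesis hS1 : size (map_poly (fun q : {poly C} => q.[0]) P) = size P /\
         sqfree (map_poly (fun q : {poly C} => q.[0]) P).
Variable g : 'I_(size P).-1 -> nat -> K.
Let PK := map_poly (map_poly iota) P.
Hypothesis hg : forall h, is_ser_root PK h <-> exists i, h = g i.

Lemma size_PK : size PK = size P.
Proof. by rewrite size_map_inj_poly // ?rmorph0 //; apply: map_inj_poly; [exact: fmorph_inj|exact: rmorph0]. Qed.

Let P0 := map_poly (fun q : {poly C} => q.[0]) P.
Let Q0 := map_poly (fun q : {poly K} => q.[0]) PK.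

Lemma spec0_map (E : {poly {poly C}}) :
  map_poly (fun q : {poly K} => q.[0]) (map_poly (map_poly iota) E) =
  map_poly iota (map_poly (fun q : {poly C} => q.[0]) E).
Proof.
apply/polyP=> i; rewrite coef_map_id0 ?horner0 // coef_map coef_map /=.
by rewrite coef_map_id0 ?horner0 // -{1}(rmorph0 iota) horner_map.
Qed.

(** In characteristic zero squarefree implies separable, and separability, being a gcd condition,
    survives the extension to [K]. *)
Lemma spec0_separable : separable_poly Q0.
Proof.
rewrite /Q0 spec0_map separable_map; apply/separable_polyP.
have P00 : P0 != 0 by rewrite -size_poly_gt0 hS1.1; case: size hrP.
split=> [u v uv|u up su].
  apply/coprimepP => d du dv; rewrite -size_poly_eq1 eqn_leq.
  have d0 : d != 0.
    apply: contraTneq uv => d0; rewrite d0 dvd0p in du.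
    by rewrite (eqP du) mul0r dvd0p.
  rewrite size_poly_gt0 d0 andbT; apply: hS1.2.
  by apply: dvdp_trans uv; rewrite expr2 dvdp_mul.
rewrite -size_poly_gt0.
have -> : size u^`() = (size u).-1.
  apply/eqP; rewrite eqn_leq; apply/andP; split.
    by have := lt_size_deriv (p := u); rewrite -size_poly_gt0 (ltnW su) => /(_ isT); lia.
  rewrite leqNgt; apply/negP => lt.
  have su2 : (size u).-2.+1 = (size u).-1 by case: size su => [|[]].
  have : (u^`())`_(size u).-2 = 0 by rewrite nth_default // -ltnS su2.
  rewrite coef_deriv su2 -mulr_natr => /eqP; rewrite mulf_eq0.
  rewrite -lead_coefE lead_coef_eq0 -size_poly_eq0 (pcharf0P C).1 //.
  by case: size su => [|[]].
by case: size su => [|[]].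
Qed.

Lemma lead_PK_0 : (lead_coef PK).[0] != 0.
Proof.
have sQ : size Q0 = size PK.
  by rewrite /Q0 spec0_map size_map_poly hS1.1 size_PK.
have -> : (lead_coef PK).[0] = lead_coef Q0.
  by rewrite !lead_coefE sQ [in RHS]/Q0 [RHS]coef_map_id0 ?horner0.
by rewrite lead_coef_eq0 -size_poly_gt0 sQ size_PK; case: size hrP.
Qed.

Lemma spec0_deriv : map_poly (fun q : {poly K} => q.[0]) PK^`() = Q0^`().
Proof.
apply/polyP => i; rewrite [LHS]coef_map_id0 ?horner0 // !coef_deriv hornerMn.
by rewrite [in RHS]/Q0 [Y in _ = Y *+ _]coef_map_id0 ?horner0.
Qed.

Lemma ser_root_deriv h : is_ser_root PK h -> eval_series h PK^`() 0%N != 0.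
Proof.
move/is_ser_rootE=> hr; rewrite eval_series0 spec0_deriv.
have r0 : root Q0 (h 0%N) by rewrite rootE -eval_series0 hr.
apply/negP => rd.
have := spec0_separable; rewrite unlock => /coprimepP /(_ ('X - (h 0%N)%:P)).
rewrite !dvdp_XsubCl r0 rootE rd => /(_ isT isT).
by rewrite -size_poly_eq1 size_XsubC.
Qed.

(** [P(0, y)] has as many roots as there are indices, and by [hensel] each root is the constant term
    of some [g i]; a surjection between finite sets of equal size is injective. *)
Lemma ser_root_coef0_inj : injective (fun i => g i 0%N).
Proof.
have [rs rsE] := closed_field_poly_normal Q0.
have lc0 : lead_coef Q0 != 0.
  by rewrite lead_coef_eq0 separable_poly_neq0 // spec0_separable.
have sr : size rs = (size P).-1.
  have : size Q0 = (size rs).+1 by rewrite rsE size_scale // size_prod_XsubC.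
  by rewrite /Q0 spec0_map size_map_poly hS1.1 => ->.
have urs : uniq rs.
  have := spec0_separable; rewrite rsE (eqp_separable (eqp_scale _ lc0)).
  by rewrite separable_prod_XsubC.
apply/injectiveP; rewrite /injectiveb /dinjectiveb.
apply: (leq_size_uniq urs); last by rewrite size_map -cardE card_ord sr.
move=> z zrs.
have rz : root Q0 z by rewrite rsE rootZ // root_prod_XsubC.
have dz : Q0^`().[z] != 0.
  apply/negP => rd; have := spec0_separable; rewrite unlock => /coprimepP /(_ ('X - z%:P)).
  rewrite !dvdp_XsubCl rz rootE rd => /(_ isT isT).
  by rewrite -size_poly_eq1 size_XsubC.
have [h hr h0] : exists2 h : series K, eval_series h PK = 0 & h 0%N = z.
  by apply: hensel; [exact/eqP|rewrite spec0_deriv].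
have /hg [i hi] : is_ser_root PK h by apply/is_ser_rootE.
by apply/mapP; exists i; rewrite ?mem_enum // -hi h0.
Qed.
End Roots.

(** * Polynomial and rational functions *)

Section PolyFun.
Variables (K : fieldType) (T : Type).
Implicit Types (f g D : (T -> K) -> K).

(** Polynomials are handled as functions, in variables of any type, so that substitution and
    restriction to a line are plain composition. *)
Inductive polyfun : ((T -> K) -> K) -> Prop :=
| polyfun_cst c : polyfun (fun=> c)
| polyfun_var t : polyfun (fun u => u t)
| polyfun_add f g : polyfun f -> polyfun g -> polyfun (fun u => f u + g u)
| polyfun_mul f g : polyfun f -> polyfun g -> polyfun (fun u => f u * g u).

Lemma polyfun_ext f g : polyfun f -> f =1 g -> polyfun g.
Proof. by move=> pf /funext <-. Qed.

Lemma polyfun_sum (I : Type) (r : seq I) (P : pred I) (F : I -> (T -> K) -> K) :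
  (forall i, P i -> polyfun (F i)) -> polyfun (fun u => \sum_(i <- r | P i) F i u).
Proof.
move=> pF; elim: r => [|i r IH].
  by apply: (polyfun_ext (polyfun_cst 0)) => u; rewrite big_nil.
have [Pi|nPi] := boolP (P i).
  by apply: (polyfun_ext (polyfun_add (pF i Pi) IH)) => u; rewrite big_cons Pi.
by apply: (polyfun_ext IH) => u; rewrite big_cons (negPf nPi).
Qed.

Lemma polyfun_prod (I : Type) (r : seq I) (P : pred I) (F : I -> (T -> K) -> K) :
  (forall i, P i -> polyfun (F i)) -> polyfun (fun u => \prod_(i <- r | P i) F i u).
Proof.
move=> pF; elim: r => [|i r IH].
  by apply: (polyfun_ext (polyfun_cst 1)) => u; rewrite big_nil.
have [Pi|nPi] := boolP (P i).
  by apply: (polyfun_ext (polyfun_mul (pF i Pi) IH)) => u; rewrite big_cons Pi.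
by apply: (polyfun_ext IH) => u; rewrite big_cons (negPf nPi).
Qed.

Lemma polyfun_exp f k : polyfun f -> polyfun (fun u => f u ^+ k).
Proof.
move=> pf; elim: k => [|k IH].
  by apply: (polyfun_ext (polyfun_cst 1)) => u; rewrite expr0.
by apply: (polyfun_ext (polyfun_mul pf IH)) => u; rewrite exprS.
Qed.

Lemma polyfun_line f (u0 u1 : T -> K) : polyfun f ->
  exists p : {poly K}, forall x, f (fun t => u0 t + x * u1 t) = p.[x].
Proof.
elim=> [c|t|g h _ [p hp] _ [q hq]|g h _ [p hp] _ [q hq]].
- by exists c%:P => x; rewrite hornerC.
- by exists ((u0 t)%:P + (u1 t) *: 'X) => x; rewrite !hornerE mulrC.
- by exists (p + q) => x; rewrite hornerD hp hq.
by exists (p * q) => x; rewrite hornerM hp hq.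
Qed.

(** A fraction with a power of [D] as denominator. Nothing is asked where [D] vanishes, so the
    default value of division by zero does no harm. *)
Definition ratfun D f := exists e N, polyfun N /\
  forall u, D u != 0 -> N u = D u ^+ e * f u.

Lemma ratfun_eq D f g : ratfun D f -> (forall u, D u != 0 -> f u = g u) -> ratfun D g.
Proof.
by move=> [e [N [pN hN]]] fg; exists e, N; split=> // u Du; rewrite hN // fg.
Qed.

Lemma ratfun_poly D f : polyfun f -> ratfun D f.
Proof. by move=> pf; exists 0%N, f; split=> // u _; rewrite expr0 mul1r. Qed.

Lemma ratfun_cst D c : ratfun D (fun=> c).
Proof. exact/ratfun_poly/polyfun_cst. Qed.

Section Ops.
Variable D : (T -> K) -> K.
Hypothesis pD : polyfun D.

Lemma ratfun_add f g : ratfun D f -> ratfun D g -> ratfun D (fun u => f u + g u).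
Proof.
move=> [e [N [pN hN]]] [e' [N' [pN' hN']]].
exists (e + e')%N, (fun u => D u ^+ e' * N u + D u ^+ e * N' u); split.
  by apply: polyfun_add; apply: polyfun_mul => //; apply: polyfun_exp.
by move=> u Du; rewrite hN // hN' // exprD; ring.
Qed.

Lemma ratfun_mul f g : ratfun D f -> ratfun D g -> ratfun D (fun u => f u * g u).
Proof.
move=> [e [N [pN hN]]] [e' [N' [pN' hN']]].
exists (e + e')%N, (fun u => N u * N' u); split; first exact: polyfun_mul.
by move=> u Du; rewrite hN // hN' // exprD; ring.
Qed.

Lemma ratfun_opp f : ratfun D f -> ratfun D (fun u => - f u).
Proof.
move=> rf; apply: (ratfun_eq (ratfun_mul (ratfun_cst _ (-1)) rf)) => u _.
by rewrite mulN1r.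
Qed.

Lemma ratfun_sub f g : ratfun D f -> ratfun D g -> ratfun D (fun u => f u - g u).
Proof. by move=> rf rg; apply: ratfun_add => //; apply: ratfun_opp. Qed.

Lemma ratfun_sum (I : Type) (r : seq I) (P : pred I) (F : I -> (T -> K) -> K) :
  (forall i, P i -> ratfun D (F i)) -> ratfun D (fun u => \sum_(i <- r | P i) F i u).
Proof.
move=> pF; elim: r => [|i r IH].
  by apply: (ratfun_eq (ratfun_cst _ 0)) => u _; rewrite big_nil.
have [Pi|nPi] := boolP (P i).
  by apply: (ratfun_eq (ratfun_add (pF i Pi) IH)) => u; rewrite big_cons Pi.
by apply: (ratfun_eq IH) => u; rewrite big_cons (negPf nPi).
Qed.

Lemma ratfun_prod (I : Type) (r : seq I) (P : pred I) (F : I -> (T -> K) -> K) :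
  (forall i, P i -> ratfun D (F i)) -> ratfun D (fun u => \prod_(i <- r | P i) F i u).
Proof.
move=> pF; elim: r => [|i r IH].
  by apply: (ratfun_eq (ratfun_cst _ 1)) => u _; rewrite big_nil.
have [Pi|nPi] := boolP (P i).
  by apply: (ratfun_eq (ratfun_mul (pF i Pi) IH)) => u; rewrite big_cons Pi.
by apply: (ratfun_eq IH) => u; rewrite big_cons (negPf nPi).
Qed.

Lemma ratfun_exp f k : ratfun D f -> ratfun D (fun u => f u ^+ k).
Proof.
move=> rf; elim: k => [|k IH].
  by apply: (ratfun_eq (ratfun_cst _ 1)) => u; rewrite expr0.
by apply: (ratfun_eq (ratfun_mul rf IH)) => u; rewrite exprS.
Qed.

Lemma ratfun_det k (A : 'I_k -> 'I_k -> (T -> K) -> K) :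
  (forall i j, ratfun D (A i j)) -> ratfun D (fun u => \det (\matrix_(i, j) A i j u)).
Proof.
move=> rA; apply: (@ratfun_eq _ (fun u =>
   \sum_(s : {perm 'I_k}) (-1) ^+ s * \prod_i A i (s i) u)).
  apply: ratfun_sum => s _; apply: ratfun_mul; first exact: ratfun_cst.
  by apply: ratfun_prod => i _.
move=> u _; apply: eq_bigr => s _; congr (_ * _); apply: eq_bigr => i _.
by rewrite mxE.
Qed.

Lemma ratfun_adj k (A : 'I_k -> 'I_k -> (T -> K) -> K) i j :
  (forall i j, ratfun D (A i j)) ->
  ratfun D (fun u => (\adj (\matrix_(i, j) A i j u)) i j).
Proof.
case: k A i j => [|k] A i j rA; first by case: i.
apply: (@ratfun_eq _ (fun u => (-1) ^+ (j + i) *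
   \det (\matrix_(a, b) A (lift j a) (lift i b) u))).
  apply: ratfun_mul; first exact: ratfun_cst.
  by apply: ratfun_det => a b.
move=> u _; rewrite mxE /cofactor; congr (_ * \det _).
by apply/matrixP => a b; rewrite !mxE.
Qed.

Lemma ratfun_inv_factor f g : polyfun f -> polyfun g ->
  (forall u, D u = f u * g u) -> ratfun D (fun u => (f u)^-1).
Proof.
move=> pf pg Dfg; exists 1%N, g; split=> // u; rewrite Dfg mulf_eq0 negb_or.
by case/andP=> fu gu; rewrite expr1 mulrAC mulfV // mul1r.
Qed.

Lemma ratfun_refine g f : polyfun g -> ratfun D f -> ratfun (fun u => D u * g u) f.
Proof.
move=> pg [e [N [pN hN]]]; exists e, (fun u => g u ^+ e * N u); split.
  by apply: polyfun_mul => //; apply: polyfun_exp.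
move=> u; rewrite mulf_eq0 negb_or => /andP [Du gu].
by rewrite hN // exprMn; ring.
Qed.

Lemma ratfun_inv f : ratfun D f -> exists N, [/\ polyfun N,
  forall u, D u != 0 -> (N u == 0) = (f u == 0) &
  ratfun (fun u => D u * N u) (fun u => (f u)^-1)].
Proof.
move=> [e [N [pN hN]]].
have NE u : D u != 0 -> (N u == 0) = (f u == 0).
  by move=> Du; rewrite hN // mulf_eq0 expf_eq0 (negPf Du) andbF.
exists N; split=> //; exists 1%N, (fun u => D u ^+ e.+1); split.
  exact: polyfun_exp.
move=> u; rewrite mulf_eq0 negb_or => /andP [Du Nu].
by rewrite expr1 hN // -!mulrA mulfV ?mulr1 ?exprS // -NE.
Qed.
End Ops.
End PolyFun.

Lemma polyfun_comp (K : fieldType) (T U : Type) (D : (U -> K) -> K)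
    (f : (T -> K) -> K) (v : (U -> K) -> T -> K) :
  polyfun D -> polyfun f -> (forall t, ratfun D (fun u => v u t)) ->
  ratfun D (fun u => f (v u)).
Proof.
move=> pD pf rv; elim: pf => {f} [c|t|f g _ IHf _ IHg|f g _ IHf _ IHg].
- exact: ratfun_cst.
- exact: rv.
- exact: ratfun_add.
exact: ratfun_mul.
Qed.

Lemma polyfun_comp_poly (K : fieldType) (T U : Type)
    (f : (T -> K) -> K) (v : (U -> K) -> T -> K) :
  polyfun f -> (forall t, polyfun (fun u => v u t)) ->
  polyfun (fun u => f (v u)).
Proof.
move=> pf rv; elim: pf => {f} [c|t|f g _ IHf _ IHg|f g _ IHf _ IHg].
- exact: polyfun_cst.
- exact: rv.
- exact: polyfun_add.
exact: polyfun_mul.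
Qed.

Lemma ratfun_comp (K : fieldType) (T U : Type) (D : (T -> K) -> K) (D' : (U -> K) -> K)
    (f : (T -> K) -> K) (v : (U -> K) -> T -> K) :
  polyfun D' -> ratfun D f -> (forall t, ratfun D' (fun u => v u t)) ->
  (forall u, D' u != 0 -> D (v u) != 0) ->
  ratfun D' (fun u => (D (v u))^-1) ->
  ratfun D' (fun u => f (v u)).
Proof.
move=> pD' [e [N [pN hN]]] rv nz rinv.
have rN := polyfun_comp pD' pN rv.
apply: (ratfun_eq (ratfun_mul rN (ratfun_exp e rinv))) => u Du.
by rewrite hN ?nz // exprVn mulrAC mulfV ?mul1r // expf_neq0 ?nz.
Qed.

Lemma polyfun_meval (K : fieldType) n (p : {mpoly K[n]}) :
  polyfun (fun v : 'I_n -> K => p.@[v]).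
Proof.
apply: (@polyfun_ext _ _ (fun v => \sum_(m <- msupp p) p@_m * \prod_i v i ^+ m i)).
  apply: polyfun_sum => m _; apply: polyfun_mul; first exact: polyfun_cst.
  by apply: polyfun_prod => i _; apply: polyfun_exp; apply: polyfun_var.
by move=> v; rewrite mevalE.
Qed.

Lemma polyfun_mpoly (K : fieldType) (T : finType) (f : (T -> K) -> K) : polyfun f ->
  exists p : {mpoly K[#|T|]}, forall u, f u = p.@[fun i => u (enum_val i)].
Proof.
elim=> [c|t|g h _ [p hp] _ [q hq]|g h _ [p hp] _ [q hq]].
- by exists c%:MP => u; rewrite mevalC.
- by exists 'X_(enum_rank t) => u; rewrite mevalXU enum_rankK.
- by exists (p + q) => u; rewrite mevalD hp hq.
by exists (p * q) => u; rewrite mevalM hp hq.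
Qed.

(** * More rational functions than variables are algebraically dependent *)

Section Degree.
Variables (K : fieldType) (n : nat).
Implicit Types p q : {mpoly K[n]}.

Lemma msize_mul_le a b p q : (msize p <= a.+1)%N -> (msize q <= b.+1)%N ->
  (msize (p * q) <= (a + b).+1)%N.
Proof.
move=> pa qb; have [->|p0] := eqVneq p 0; first by rewrite mul0r msize0.
have [->|q0] := eqVneq q 0; first by rewrite mulr0 msize0.
by rewrite msizeM // -subn1 leq_subLR add1n -addSn -addnS leq_add.
Qed.

Lemma msize_exp_le a k p : (msize p <= a.+1)%N -> (msize (p ^+ k) <= (k * a).+1)%N.
Proof.
move=> pa; elim: k => [|k IH]; first by rewrite expr0 msize1.
by rewrite exprS mulSn; apply: msize_mul_le.
Qed.

Lemma msize_prod_le (I : finType) a (F : I -> {mpoly K[n]}) :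
  (forall i, (msize (F i) <= a.+1)%N) -> (msize (\prod_i F i) <= (#|I| * a).+1)%N.
Proof.
move=> hF; have -> : (#|I| * a)%N = (\sum_(i : I) a)%N by rewrite sum_nat_const.
apply: (big_ind2 (fun p b => (msize p <= b.+1)%N)).
- by rewrite msize1.
- by move=> p1 b1 p2 b2; apply: msize_mul_le.
by move=> i _; apply: hF.
Qed.

Lemma card_bmultinom S : (#|{: 'X_{1..n < S}}| <= S ^ n)%N.
Proof.
case: S => [|S].
  by rewrite eq_card0 // => -[m hm].
pose phi (m : 'X_{1..n < S.+1}) : {ffun 'I_n -> 'I_S.+1} := [ffun i => inord (bmnm m i)].
have phi_inj : injective phi.
  move=> m1 m2 /ffunP h; apply/val_inj/mnmP => i; move: (h i); rewrite !ffunE.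
  have lt (m : 'X_{1..n < S.+1}) : (bmnm m i < S.+1)%N.
    case: m => m hm /=; rewrite (leq_ltn_trans _ hm) // mdegE (bigD1 i) //=.
    exact: leq_addr.
  by move/(congr1 val); rewrite /= !inordK.
by rewrite (leq_trans (leq_card _ phi_inj)) // card_ffun !card_ord.
Qed.
End Degree.

(** A count of dimensions. With denominators cleared, the products of powers below [B] of the
    functions have degree linear in [B], so they span a space of dimension of order [B ^ #|T|],
    while there are [B ^ (#|T| + 1)] of them. *)
Lemma algebraic_dependence (K : fieldType) (T : finType) (D : (T -> K) -> K)
    (t : 'I_(#|T|.+1) -> (T -> K) -> K) :
  polyfun D -> (forall i, ratfun D (t i)) ->
  exists2 F : {mpoly K[#|T|.+1]}, F != 0 &
    forall u, D u != 0 -> F.@[fun i => t i u] = 0.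
Proof.
move=> pD rt; set m := #|T|.
have [e /choice [N hN]] : exists e, forall i, exists N, polyfun N /\
    forall u, D u != 0 -> N u = D u ^+ e * t i u.
  have [e he] := choice rt; exists (\sum_i e i)%N => i.
  have [N [pN hN]] := he i; exists (fun u => D u ^+ (\sum_i e i - e i) * N u); split.
    by apply: polyfun_mul => //; apply: polyfun_exp.
  move=> u Du; rewrite hN // mulrA -exprD subnK //.
  by rewrite (bigD1 i) //= leq_addr.
have [p hp] := polyfun_mpoly (polyfun_exp e pD).
have [q hq] := choice (fun i => polyfun_mpoly (hN i).1).
pose E := (msize p + \sum_i msize (q i))%N.
(* Chosen so that [S <= c * B]; then [B > c ^ m] gives [S ^ m <= c ^ m * B ^ m < B ^ m.+1]. *)
pose c := (m.+1 * (E + E) + 1)%N.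
pose B := (c ^ m).+1.
(* Each monomial in the fractions [q i / p] is multiplied by the same power of [p], so linear
   relations carry over to the fractions. *)
pose mon (al : {ffun 'I_m.+1 -> 'I_B}) := \prod_i (q i ^+ al i * p ^+ (B - al i)).
pose S := (m.+1 * (B * E + B * E)).+1.
have pE : (msize p <= E.+1)%N by rewrite /E leqW // leq_addr.
have qE i : (msize (q i) <= E.+1)%N.
  by rewrite /E leqW // (bigD1 i) //= addnCA leq_addr.
have smon al : (msize (mon al) <= S)%N.
  rewrite /S -[m.+1]card_ord; apply: msize_prod_le => i; apply: msize_mul_le.
    apply: leq_trans (msize_exp_le _ (qE i)) _.
    by rewrite ltnS leq_mul2r (ltnW (ltn_ord _)) orbT.
  apply: leq_trans (msize_exp_le _ pE) _.
  by rewrite ltnS leq_mul2r leq_subr orbT.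
have Scard : (S ^ m < B ^ m.+1)%N.
  have SB : (S <= c * B)%N by rewrite /S /c mulnDl mul1n; lia.
  have : (S ^ m <= (c * B) ^ m)%N by case: (m) => // k; rewrite leq_exp2r.
  move=> h; apply: leq_ltn_trans h _; rewrite expnMn expnS ltn_pmul2r ?expn_gt0 //.
have lt_card : (#|{: 'X_{1..m < S}}| < #|{ffun 'I_m.+1 -> 'I_B}|)%N.
  by rewrite card_ffun !card_ord (leq_ltn_trans (card_bmultinom _ _)).
have [w [a0 wa0] hw] := wide_left_kernel
  (fun a b => (mon (enum_val a))@_(bmnm (enum_val b : 'X_{1..m < S}))) lt_card.
have mon0 : \sum_a w a *: mon (enum_val a) = 0.
  apply/mpolyP => mu; rewrite mcoeff0 raddf_sum /=.
  case: (ltnP (mdeg mu) S) => hmu; last first.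
    rewrite big1 // => a _; rewrite mcoeffZ memN_msupp_eq0 ?mulr0 //.
    apply/negP => /msize_mdeg_lt; rewrite ltnNge (leq_trans (smon _)) //.
  rewrite -[RHS](hw (enum_rank (BMultinom hmu))); apply: eq_bigr => a _.
  by rewrite mcoeffZ enum_rankK.
pose mu (al : {ffun 'I_m.+1 -> 'I_B}) : 'X_{1..m.+1} := [multinom val (al i) | i < m.+1].
have mu_inj : injective mu.
  move=> a b /mnmP h; apply/ffunP => i; apply: val_inj; move: (h i).
  by rewrite !mnmE.
exists (\sum_a w a *: 'X_[mu (enum_val a)]).
  apply/negP => /eqP /mpolyP /(_ (mu (enum_val a0))); rewrite mcoeff0 raddf_sum /=.
  rewrite (bigD1 a0) //= mcoeffZ mcoeffX eqxx mulr1 big1 ?addr0 => [/eqP|a na].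
    by rewrite (negPf wa0).
  rewrite mcoeffZ mcoeffX (inj_eq mu_inj) (inj_eq enum_val_inj) (negPf na).
  by rewrite mulr0.
move=> u Du; set v := fun i => t i u.
have De : D u ^+ e != 0 by rewrite expf_neq0.
have : ((D u ^+ e) ^+ B) ^+ m.+1 != 0 by rewrite !expf_neq0.
move/mulfI; apply; rewrite mulr0 raddf_sum /= mulr_sumr.
have := congr1 (meval (fun i => u (enum_val i))) mon0.
rewrite meval0 raddf_sum /= => E0; rewrite -[RHS]E0; apply: eq_bigr => a _.
rewrite !mevalZ mulrCA; congr (_ * _).
rewrite mevalX rmorph_prod /= -[X in _ ^+ X](card_ord m.+1) -prodr_const -big_split /=.
apply: eq_bigr => i _; rewrite mevalM !rmorphXn /= -hp -hq (hN i).2 // mnmE exprMn.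
rewrite [RHS]mulrAC -exprD subnKC //.
by rewrite ltnW.
Qed.

(** * Upper bounds on the dimension *)

Lemma meval_muni (R : comNzRingType) k (p : {mpoly R[k.+1]}) (v : 'I_k.+1 -> R) :
  p.@[v] = (map_poly (meval (fun i => v (widen_ord (leqnSn k) i))) (muni p)).[v ord_max].
Proof.
rewrite mevalE muniE raddf_sum horner_sum; apply: eq_bigr => m _ /=.
rewrite -mul_polyC rmorphM /= map_polyC map_polyXn.
rewrite hornerM hornerC hornerXn /= mevalZ mevalX.
rewrite big_ord_recr /= mulrA; congr (_ * _ * _).
by apply: eq_bigr => i _; rewrite mnmE.
Qed.

Lemma muni_eq0 (R : comNzRingType) k (p : {mpoly R[k.+1]}) : muni p = 0 -> p = 0.
Proof.
move=> p0; apply/mpolyP => m; rewrite mcoeff0.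
have [msp|] := boolP (m \in msupp p); last by move/memN_msupp_eq0.
have /polyP /(_ (m ord_max)) := p0.
rewrite muniE coef_sum coef0.
move/(congr1 (mcoeff [multinom m (widen_ord (leqnSn k) i) | i < k])).
rewrite mcoeff0 raddf_sum /= (bigD1_seq m) //= ?msupp_uniq //.
rewrite coefZ coefXn eqxx mulr1 mcoeffZ mcoeffX eqxx mulr1 big1 ?addr0 // => m' nm.
rewrite coefZ coefXn; case: eqP => [e|_]; last by rewrite mulr0 mcoeff0.
rewrite mulr1 mcoeffZ mcoeffX; case: eqP => [/mnmP h|_]; last by rewrite mulr0.
case/eqP: nm; apply/mnmP => i; case: (unliftP ord_max i) => [j ->|->]; last by rewrite e.
have := h j; rewrite !mnmE; congr (_ = _); congr (fun_of_multinom _ _).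
all: by apply: val_inj; rewrite /= /bump leqNgt ltn_ord.
Qed.

Section Dimension.
Variables (K : fieldType) (n : nat).

(** Stands in for the bound [dim Y < k], in a form stable under subsets and finite unions. *)
Definition alg_dependent (Y : pt K n -> Prop) k :=
  forall t : 'I_k -> {mpoly K[n]}, exists F : {mpoly K[k]}, F != 0 /\
    forall v, Y v -> F.@[fun i => (t i).@[v]] = 0.

Lemma alg_dependent_sub (Y Y' : pt K n -> Prop) k :
  (forall v, Y v -> Y' v) -> alg_dependent Y' k -> alg_dependent Y k.
Proof.
by move=> sub h t; have [F [F0 hF]] := h t; exists F; split=> // v /sub; apply: hF.
Qed.

Lemma alg_dependent_bigcup (I : finType) (Y : I -> pt K n -> Prop) k :
  (forall i, alg_dependent (Y i) k) -> alg_dependent (fun v => exists i, Y i v) k.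
Proof.
move=> h t; have [F hF] := choice (fun i => h i t).
exists (\prod_i F i); split=> [|v [i Yi]].
  by rewrite prodf_seq_neq0; apply/allP => i _; apply/implyP => _; apply: (hF i).1.
by rewrite (bigD1 i) //= mevalM (hF i).2 // mul0r.
Qed.

Lemma alg_dependent_param (Y : pt K n -> Prop) (T : finType) (D : (T -> K) -> K)
    (w : (T -> K) -> 'I_n -> K) k :
  k = #|T| -> polyfun D -> (forall i, ratfun D (fun u => w u i)) ->
  (forall v, Y v -> exists2 u, D u != 0 & v = w u) -> alg_dependent Y k.+1.
Proof.
move=> -> pD rw hY t.
have rt i : ratfun D (fun u => (t i).@[w u]).
  exact: polyfun_comp pD (polyfun_meval (t i)) rw.
have [F F0 hF] := algebraic_dependence pD rt.
by exists F; split=> // v /hY [u Du ->]; apply: hF.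
Qed.

Lemma zclosed_zero (p : {mpoly K[n]}) : zclosed (fun v => p.@[v] = 0).
Proof. by exists (fun q => q = p) => v; split=> [h q ->|/(_ p erefl)]. Qed.

(* Along a chain [Z 0 < ... < Z k] pick [f j] vanishing on [Z j] but not on [Z j.+1]: *)
(* the [f j] are algebraically independent on [Z k].                               *)
Lemma chain_alg_independent (Z : nat -> pt K n -> Prop) k :
  (forall i, (i <= k)%N -> zirred (Z i)) ->
  (forall i, (i < k)%N ->
     (forall v, Z i v -> Z i.+1 v) /\ exists v, Z i.+1 v /\ ~ Z i v) ->
  exists t : 'I_k -> {mpoly K[n]}, forall F : {mpoly K[k]},
    (forall v, Z k v -> F.@[fun i => (t i).@[v]] = 0) -> F = 0.
Proof.
elim: k => [|k IH] irr incl.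
  exists (fun=> 0) => F hF; have [_ [v Zv] _] := irr 0%N (leqnn _).
  have FE : F = (F@_0)%:MP.
    apply/mpolyP => m; rewrite mcoeffC.
    have -> : m = 0%MM by apply/mnmP; case.
    by rewrite eqxx mulr1.
  by have := hF v Zv; rewrite FE mevalC => ->; rewrite mpolyC0.
have [t ht] := IH (fun i li => irr i (leqW li)) (fun i li => incl i (ltnW li)).
have [sub [v1 [Z1v1 Z0v1]]] := incl k (ltnSn k).
have [[S hS] _ _] := irr k (leqnSn k).
have [f Sf fv1] : exists2 f, S f & f.@[v1] <> 0.
  apply: contrapT => h; apply: Z0v1; apply/hS => p Sp.
  by apply: contrapT => pv; apply: h; exists p.
have f0 v : Z k v -> f.@[v] = 0 by move/hS/(_ f Sf).
pose t' (i : 'I_k.+1) := if unlift ord_max i is Some j then t j else f.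
have t'w j : t' (widen_ord (leqnSn k) j) = t j.
  rewrite /t' (_ : widen_ord _ j = lift ord_max j) ?liftK //.
  by apply: val_inj; rewrite /= /bump leqNgt ltn_ord.
have t'm : t' ord_max = f by rewrite /t' unlift_none.
exists t' => F hF; apply: contrapT => F0.
have evF v : F.@[fun i => (t' i).@[v]] =
    (map_poly (meval (fun i => (t i).@[v])) (muni F)).[f.@[v]].
  rewrite meval_muni t'm; congr ((map_poly (meval _) _).[_]).
  by apply: funext => j; rewrite t'w.
have ex : exists l, (muni F)`_l != 0.
  apply: contrapT => h; apply: F0; apply: muni_eq0; apply/polyP => l; rewrite coef0.
  by apply/eqP; apply: contrapT => /negP hl; apply: h; exists l.
(* Write [F] as the power [e] of its last variable times [G], with nonzero constant coefficient. On
   the irreducible [Z k.+1] the product of [f ^+ e] and [H = G(t, f)] vanishes while [f] does not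
   vanish identically, so [H] does. On [Z k], where [f = 0], only the constant coefficient of [G]
   remains, and it must be 0 by induction. *)
case: (ex_minnP ex) => e Fe mine.
pose G := Poly (drop e (muni F)).
have GE l : G`_l = (muni F)`_(e + l) by rewrite coef_Poly nth_drop.
have FG : muni F = 'X^e * G.
  apply/polyP => l; rewrite coefXnM; case: ltnP => [lle|lel].
    by apply/eqP; apply: contraLR lle => /mine; rewrite -leqNgt.
  by rewrite GE subnKC.
pose H : {mpoly K[n]} := \sum_(l < size G) (G`_l \mPo [tuple t i | i < k]) * f ^+ l.
have HE v : H.@[v] = (map_poly (meval (fun i => (t i).@[v])) G).[f.@[v]].
  rewrite (@horner_coef_wide _ (size G)) ?size_poly // raddf_sum.
  apply: eq_bigr => l _ /=; rewrite coef_map /= mevalM rmorphXn /= comp_mpoly_meval.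
  by congr (meval _ _ * _); apply: funext => i; rewrite tnth_mktuple.
have [_ _ irr1] := irr k.+1 (leqnn _).
case: (irr1 _ _ (zclosed_zero f) (zclosed_zero H)) => [v Zv|h|h].
- have := hF v Zv; rewrite evF FG rmorphM /= map_polyXn hornerM hornerXn -HE.
  by move/eqP; rewrite mulf_eq0 expf_eq0 => /orP [/andP [_ /eqP]|/eqP]; [left|right].
- exact: fv1 (h v1 Z1v1).
have : G`_0 = 0.
  apply: ht => v Zv; have := h v (sub v Zv).
  by rewrite HE f0 // horner_coef0 coef_map.
by rewrite GE addn0; apply/eqP.
Qed.

Lemma dim_ge_alg_dependent (Y : pt K n -> Prop) k :
  alg_dependent Y k -> ~ dim_ge Y k.
Proof.
move=> dep [Z [irr incl hZ]].
have [t ht] := chain_alg_independent irr incl.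
have [F [F0 hF]] := dep t.
case/eqP: F0; apply: ht => v Zv.
have := hZ _ (zclosed_zero (F \mPo [tuple t i | i < k])).
have E w : (F \mPo [tuple t i | i < k]).@[w] = F.@[fun i => (t i).@[w]].
  by rewrite comp_mpoly_meval; congr (meval _ _); apply: funext => i; rewrite tnth_mktuple.
by rewrite -E; apply=> // w Yw; rewrite E hF.
Qed.

Lemma dim_ge_sub (Y Y' : pt K n -> Prop) k :
  (forall v, Y v -> Y' v) -> dim_ge Y k -> dim_ge Y' k.
Proof.
by move=> sub [Z [irr incl hZ]]; exists Z; split=> // B cB sB; apply: hZ => // v /sub /sB.
Qed.
End Dimension.

(** * Lower bounds on the dimension *)

Lemma poly_nonroot (K : fieldType) (p : {poly K}) : [pchar K] =i pred0 ->
  p != 0 -> exists x, p.[x] != 0.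
Proof.
move=> char0 p0; apply: contrapT => h.
have := @max_poly_roots K p [seq i%:R | i <- iota 0 (size p)] p0.
rewrite size_map size_iota ltnn => hh; have : false; last by [].
apply: hh.
  apply/allP => x _; rewrite rootE; apply: contrapT => /negP hx.
  by apply: h; exists x.
rewrite map_inj_uniq ?iota_uniq // => i j /eqP.
wlog lij : i j / (i <= j)%N.
  by case/orP: (leq_total i j) => hij hw; [exact: hw | rewrite eq_sym => /(hw _ _ hij)].
rewrite eq_sym -subr_eq0 -natrB // (pcharf0P K).1 // subn_eq0 => lji.
by apply/eqP; rewrite eqn_leq lij.
Qed.

Section Graph.
Variables (K : fieldType) (n : nat) (i0 : 'I_n) (e : 'I_n -> K).
Hypothesis char0 : [pchar K] =i pred0.
Hypothesis ei0 : e i0 = 1.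

Definition embed_hyper (y : 'I_n.-1 -> K) : 'I_n -> K :=
  fun i => if unlift i0 i is Some k then y k else 0.

Lemma embed_hyper_lift y k : embed_hyper y (lift i0 k) = y k.
Proof. by rewrite /embed_hyper liftK. Qed.
Lemma embed_hyper0 y : embed_hyper y i0 = 0.
Proof. by rewrite /embed_hyper unlift_none. Qed.
Lemma polyfun_embed_hyper i : polyfun (fun y => embed_hyper y i).
Proof.
case: (unliftP i0 i) => [k ->|->].
  by apply: (polyfun_ext (polyfun_var _ k)) => y; rewrite embed_hyper_lift.
by apply: (polyfun_ext (polyfun_cst _ 0)) => y; rewrite embed_hyper0.
Qed.

Variables (D c : ('I_n.-1 -> K) -> K) (S : pt K n -> Prop) (y0 : 'I_n.-1 -> K).
Hypothesis pD : polyfun D.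
Hypothesis rc : ratfun D c.
Hypothesis hS : forall y, D y != 0 -> S (fun i => embed_hyper y i + c y * e i).
Hypothesis Dy0 : D y0 != 0.

Let V y : 'I_n -> K := fun i => embed_hyper y i + c y * e i.
Let U j (y : 'I_n.-1 -> K) := forall k : 'I_n.-1, (j <= k)%N -> y k = y0 k.
(** Zariski closure of the part of the graph on which the parameters of index at least [j] are
    frozen at [y0]. Releasing them one at a time gives the chain. *)
Let Z j (v : pt K n) := forall p : {mpoly K[n]},
  (forall y, U j y -> D y != 0 -> p.@[V y] = 0) -> p.@[v] = 0.

Let ZV j y : U j y -> D y != 0 -> Z j (V y).
Proof. by move=> Uy Dy p; apply. Qed.

Let rV (p : {mpoly K[n]}) : ratfun D (fun y => p.@[V y]).
Proof.
apply: (polyfun_comp pD (polyfun_meval p)) => i.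
apply: ratfun_add => //; first exact/ratfun_poly/polyfun_embed_hyper.
by apply: ratfun_mul => //; apply: ratfun_cst.
Qed.

Let Z_irred j : zirred (Z j).
Proof.
split.
- exists (fun p => forall y, U j y -> D y != 0 -> p.@[V y] = 0) => v.
  by split=> h p; apply: h.
- by exists (V y0); apply: ZV.
move=> A1 A2 [S1 hS1] [S2 hS2] cov; apply: contrapT => /not_orP [n1 n2].
have pick A SA : (forall v, A v <-> (forall p : {mpoly K[n]}, SA p -> p.@[v] = 0)) ->
    ~ (forall v, Z j v -> A v) ->
    exists p y, [/\ SA p, U j y, D y != 0 & p.@[V y] != 0].
  move=> hA nA; apply: contrapT => h; apply: nA => v Zv; apply/hA => p SAp.
  apply: Zv => y Uy Dy; apply/eqP; apply: contrapT => /negP py.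
  by apply: h; exists p, y.
have [p1 [y1 [Sp1 Uy1 Dy1 py1]]] := pick _ _ hS1 n1.
have [p2 [y2 [Sp2 Uy2 Dy2 py2]]] := pick _ _ hS2 n2.
have [e1 [N1 [pN1 hN1]]] := rV p1.
have [e2 [N2 [pN2 hN2]]] := rV p2.
(* The line through [y1] and [y2] stays in [U j], and on it [D] and both numerators are nonzero
   polynomials in one variable. A point avoiding their zeros lies on the graph but neither in [A1]
   nor in [A2]. *)
pose dy k := y2 k - y1 k.
pose L x := fun k => y1 k + x * dy k.
have L0 : L 0 = y1 by apply: funext => k; rewrite /L mul0r addr0.
have L1 : L 1 = y2 by apply: funext => k; rewrite /L mul1r addrC subrK.
have [d hd] := polyfun_line y1 dy pD.
have [q1 hq1] := polyfun_line y1 dy pN1.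
have [q2 hq2] := polyfun_line y1 dy pN2.
have : d * q1 * q2 != 0.
  rewrite !mulf_neq0 //; apply/eqP => z.
  - by have := hd 0; rewrite -/(L 0) L0 z horner0 => /eqP; rewrite (negPf Dy1).
  - have := hq1 0; rewrite -/(L 0) L0 z horner0 hN1 // => /eqP.
    by rewrite mulf_eq0 expf_eq0 (negPf Dy1) andbF (negPf py1).
  have := hq2 1; rewrite -/(L 1) L1 z horner0 hN2 // => /eqP.
  by rewrite mulf_eq0 expf_eq0 (negPf Dy2) andbF (negPf py2).
case/(poly_nonroot char0) => x; rewrite !hornerM -hd -hq1 -hq2 -/(L x).
rewrite !mulf_eq0 !negb_or => /andP [/andP [DL NL1] NL2].
have UL : U j (L x) by move=> k lk; rewrite /L /dy Uy1 // Uy2 // subrr mulr0 addr0.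
case: (cov _ (ZV UL DL)) => [/hS1 /(_ _ Sp1)|/hS2 /(_ _ Sp2)] z.
  by rewrite hN1 // z mulr0 eqxx in NL1.
by rewrite hN2 // z mulr0 eqxx in NL2.
Qed.

Lemma dim_ge_graph : dim_ge S n.-1.
Proof.
exists Z; split=> [i _||B [SB hB] sub v Zv]; first exact: Z_irred.
- move=> j ljn; split=> [v Zv p hp|].
    by apply: Zv => y Uy Dy; apply: hp => // k lk; apply: Uy; apply: ltnW.
  pose j0 := Ordinal ljn.
  have [d hd] := polyfun_line y0 (fun k => (k == j0)%:R) pD.
  pose L x := fun k : 'I_n.-1 => y0 k + x * (k == j0)%:R.
  have : 'X * d != 0.
    rewrite mulf_neq0 ?polyX_eq0 //; apply/eqP => z.
    have L0 : L 0 = y0 by apply: funext => k; rewrite /L mul0r addr0.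
    by have := hd 0; rewrite -/(L 0) L0 z horner0 => /eqP; rewrite (negPf Dy0).
  case/(poly_nonroot char0) => x; rewrite hornerM hornerX -hd -/(L x) mulf_eq0 negb_or.
  case/andP => x0 DL; exists (V (L x)); split.
    apply: ZV => // k lk; rewrite /L; case: eqP => [kj|_]; last by rewrite mulr0 addr0.
    by rewrite kj ltnn in lk.
  pose s := lift i0 j0.
  (* Since [e i0 = 1], the coordinate [i0] of a graph point is [c y], and removing its contribution
     recovers [y j0]. The polynomial vanishes on [Z j] but takes the value [x] at the new point. *)
  move/(_ ('X_s - e s *: 'X_i0 - (y0 j0)%:MP)).
  have E y : ('X_s - e s *: 'X_i0 - (y0 j0)%:MP).@[V y] = y j0 - y0 j0.
    rewrite !mevalB mevalZ !mevalXU mevalC /V embed_hyper0 /s embed_hyper_lift ei0.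
    by ring.
  rewrite E (_ : L x j0 - y0 j0 = x); last by rewrite /L eqxx mulr1; ring.
  move=> h; case/eqP: x0; apply: h => y Uy Dy.
  by rewrite E Uy // subrr.
apply/hB => p SBp; apply: Zv => y _ Dy.
by have /hB := sub _ (hS Dy); apply.
Qed.
End Graph.

Definition shift (K : fieldType) n (v : 'I_n -> K) (c : K) (e : 'I_n -> K) : 'I_n -> K :=
  fun i => v i + c * e i.

Section Shift.
Variables (K : fieldType) (n : nat).

Lemma ratfun_shift (T : Type) (D c : (T -> K) -> K) (w : (T -> K) -> 'I_n -> K) e i :
  polyfun D -> ratfun D c -> (forall i, ratfun D (fun u => w u i)) ->
  ratfun D (fun u => shift (w u) (c u) e i).
Proof.
move=> pD rc rw; apply: ratfun_add => //; apply: ratfun_mul => //.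
exact: ratfun_cst.
Qed.

Lemma ratfun_comp_poly (T : Type) (D f : ('I_n -> K) -> K) (w : (T -> K) -> 'I_n -> K) :
  polyfun D -> ratfun D f -> (forall i, polyfun (fun u => w u i)) ->
  ratfun (fun u => D (w u)) (fun u => f (w u)).
Proof.
move=> pD rf pw; have pDw := polyfun_comp_poly pD pw.
apply: (ratfun_comp pDw rf) => [i||]; [exact: ratfun_poly| by []|].
apply: (ratfun_inv_factor pDw (polyfun_cst _ 1)) => u; by rewrite mulr1.
Qed.
End Shift.

(** * A triangular pair of affine equations in two coordinates *)

Section TwoSlots.
Variables (K : fieldType) (n : nat) (i1 i2 : 'I_n) (e1 e2 : 'I_n -> K).
Variables (D0 D1 D2 F1 F2 : ('I_n -> K) -> K) (Y : pt K n -> Prop).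
Hypothesis ni : i1 != i2.
Hypotheses (e11 : e1 i1 = 1) (e12 : e1 i2 = 0) (e22 : e2 i2 = 1).
Hypothesis pD0 : polyfun D0.
Hypotheses (rD1 : ratfun D0 D1) (rD2 : ratfun D0 D2).
Hypotheses (rF1 : ratfun D0 F1) (rF2 : ratfun D0 F2).
Hypothesis D01 : forall v c, D0 (shift v c e1) = D0 v.
Hypothesis D02 : forall v c, D0 (shift v c e2) = D0 v.
Hypothesis D11 : forall v c, D0 v != 0 -> D1 (shift v c e1) = D1 v.
Hypothesis D12 : forall v c, D0 v != 0 -> D1 (shift v c e2) = D1 v.
Hypothesis D21 : forall v c, D0 v != 0 -> D2 (shift v c e1) = D2 v.
Hypothesis D22 : forall v c, D0 v != 0 -> D2 (shift v c e2) = D2 v.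
Hypothesis F11 : forall v c, D0 v != 0 -> F1 (shift v c e1) = F1 v + c * D1 v.
Hypothesis F12 : forall v c, D0 v != 0 -> F1 (shift v c e2) = F1 v.
Hypothesis F22 : forall v c, D0 v != 0 -> F2 (shift v c e2) = F2 v + c * D2 v.
Hypothesis hY : forall v, Y v -> [/\ D0 v != 0, D1 v != 0, D2 v != 0, F1 v = 0 & F2 v = 0].

(* The two slots are eliminated successively, so that [Y] is rationally parametrised *)
(* by the other [n - 2] coordinates.                                               *)
Lemma two_slots_alg_dependent : alg_dependent Y n.-1.
Proof.
pose T : finType := {i : 'I_n | (i != i1) && (i != i2)}.
have cT : n.-1 = #|T|.+1.
  rewrite card_sig /=.
  have := cardC [set i1; i2]; rewrite cards2 ni card_ord => /(congr1 predn) <-.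
  by rewrite add2n; congr (_.+1); apply: eq_card => i; rewrite !inE negb_or.
pose emb (u : T -> K) (i : 'I_n) : K := if insub i is Some t then u t else 0.
have pemb i : polyfun (fun u => emb u i).
  rewrite /emb; case: insubP => [t _ _|_]; [exact: polyfun_var|exact: polyfun_cst].
pose E0 u := D0 (emb u).
have pE0 : polyfun E0 := polyfun_comp_poly pD0 pemb.
have lift_emb f : ratfun D0 f -> ratfun E0 (fun u => f (emb u)).
  by move=> rf; apply: ratfun_comp_poly.
have [N1 [pN1 hN1 rN1]] := ratfun_inv pE0 (lift_emb _ rD1).
have [N2 [pN2 hN2 rN2]] := ratfun_inv pE0 (lift_emb _ rD2).
pose E u := E0 u * N1 u * N2 u.
have pE : polyfun E by do 2!apply: polyfun_mul => //.
have ref f : ratfun E0 f -> ratfun E f.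
  by move=> rf; do 2!apply: ratfun_refine => //.
have EE0 u : E u != 0 -> E0 u != 0.
  by rewrite /E !mulf_eq0 !negb_or => /andP [/andP []].
have r1 : ratfun E (fun u => (D1 (emb u))^-1) by apply: ratfun_refine.
have r2 : ratfun E (fun u => (D2 (emb u))^-1).
  have : ratfun (fun u => E0 u * N2 u * N1 u) (fun u => (D2 (emb u))^-1).
    exact: ratfun_refine.
  by congr ratfun; apply: funext => u; rewrite /E mulrAC.
(* [F1 = 0] is solved along [e1]. Then [F2 = 0], which may depend on the first slot, is solved along
   [e2], and this leaves [F1] unchanged. *)
pose c1 u := - F1 (emb u) * (D1 (emb u))^-1.
have rc1 : ratfun E c1.
  by apply: ratfun_mul => //; apply: ratfun_opp => //; apply: ref; apply: lift_emb.
pose w1 u := shift (emb u) (c1 u) e1.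
have rw1 i : ratfun E (fun u => w1 u i).
  by apply: ratfun_shift => // k; apply: ratfun_poly.
have rF2w : ratfun E (fun u => F2 (w1 u)).
  apply: (ratfun_comp pE rF2 rw1) => [u /EE0|]; first by rewrite /w1 D01.
  apply: (@ratfun_eq _ _ _ (fun u => (E0 u)^-1)) => [|u _]; last by rewrite /w1 D01.
  apply: ref; apply: (ratfun_inv_factor pE0 (polyfun_cst _ 1)) => u.
  by rewrite mulr1.
pose c2 u := - F2 (w1 u) * (D2 (emb u))^-1.
have rc2 : ratfun E c2 by apply: ratfun_mul => //; apply: ratfun_opp.
pose w u := shift (w1 u) (c2 u) e2.
rewrite cT; apply: (@alg_dependent_param _ _ _ T E w) => // [i|v Yv].
  exact: ratfun_shift.
have [D0v D1v D2v F1v F2v] := hY Yv.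
(* As [e1] vanishes at [i2], the coefficient along [e2] is read first; what remains after both
   subtractions is supported off [i1] and [i2]. *)
pose a2 := v i2; pose a1 := v i1 - a2 * e2 i1.
pose u (t : T) := v (val t) - a1 * e1 (val t) - a2 * e2 (val t).
have vE : v = shift (shift (emb u) a1 e1) a2 e2.
  apply: funext => i; rewrite /shift /emb; case: insubP => [t _ it|].
    by rewrite /u it; ring.
  rewrite negb_and !negbK => /orP [] /eqP ->.
    by rewrite e11 /a1; ring.
  by rewrite e12 e22 /a2; ring.
have D0u : D0 (emb u) != 0 by move: D0v; rewrite {1}vE D02 D01.
have D0u1 : D0 (shift (emb u) a1 e1) != 0 by rewrite D01.
have D1u : D1 (emb u) != 0 by move: D1v; rewrite {1}vE D12 // D11.
have D2u : D2 (emb u) != 0 by move: D2v; rewrite {1}vE D22 // D21.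
have a1E : a1 = c1 u.
  move: F1v; rewrite {1}vE F12 // F11 // => /eqP.
  rewrite addrC addr_eq0 => /eqP h.
  by rewrite /c1 -h mulfK.
have a2E : a2 = c2 u.
  move: F2v; rewrite {1}vE F22 // D21 // a1E => /eqP.
  rewrite addrC addr_eq0 => /eqP h.
  by rewrite /c2 -h mulfK.
exists u; last by rewrite {1}vE /w /w1 -a1E -a2E.
by rewrite /E !mulf_neq0 ?hN1 ?hN2.
Qed.
(** Solving only [F1 = 0] gives a graph over the other [n - 1] coordinates, on which [F2 <> 0] is an
    open condition. It holds somewhere: moving [v0] along [e1] achieves [F1 = 0], and moving on
    along [e2] achieves [F2 = 1] without disturbing [F1]. *)
Lemma one_slot_dim_ge (S : pt K n -> Prop) v0 : [pchar K] =i pred0 ->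
  (forall v, D0 v != 0 -> D1 v != 0 -> F1 v = 0 -> F2 v != 0 -> S v) ->
  D0 v0 != 0 -> D1 v0 != 0 -> D2 v0 != 0 -> dim_ge S n.-1.
Proof.
move=> char0 hS D0v0 D1v0 D2v0.
pose emb := @embed_hyper K n i1.
have pemb i : polyfun (fun u => emb u i) by apply: polyfun_embed_hyper.
pose E0 u := D0 (emb u).
have pE0 : polyfun E0 := polyfun_comp_poly pD0 pemb.
have lift_emb f : ratfun D0 f -> ratfun E0 (fun u => f (emb u)).
  by move=> rf; apply: ratfun_comp_poly.
have [N1 [pN1 hN1 rN1]] := ratfun_inv pE0 (lift_emb _ rD1).
pose E1 u := E0 u * N1 u.
have pE1 : polyfun E1 by apply: polyfun_mul.
have E10 u : E1 u != 0 -> E0 u != 0 /\ D1 (emb u) != 0.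
  by rewrite mulf_eq0 negb_or => /andP [E0u N1u]; rewrite E0u -hN1.
pose c u := - F1 (emb u) * (D1 (emb u))^-1.
have rc : ratfun E1 c.
  apply: ratfun_mul => //; apply: ratfun_opp => //.
  by apply: ratfun_refine => //; apply: lift_emb.
pose w u := shift (emb u) (c u) e1.
have rw i : ratfun E1 (fun u => w u i).
  by apply: ratfun_shift => // k; apply: ratfun_poly.
have rF2w : ratfun E1 (fun u => F2 (w u)).
  apply: (ratfun_comp pE1 rF2 rw) => [u /E10 []|]; first by rewrite /w D01.
  apply: (@ratfun_eq _ _ _ (fun u => (E0 u)^-1)) => [|u _]; last by rewrite /w D01.
  apply: ratfun_refine => //; apply: (ratfun_inv_factor pE0 (polyfun_cst _ 1)) => u.
  by rewrite mulr1.
have [N2 [pN2 hN2 _]] := ratfun_inv pE1 rF2w.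
pose E u := E1 u * N2 u.
have pE : polyfun E by apply: polyfun_mul.
have F1w u : E1 u != 0 -> F1 (w u) = 0.
  case/E10 => E0u D1u; rewrite /w F11 // /c mulrAC -mulrA mulfV // mulr1.
  by rewrite subrr.
pose a1 := - F1 v0 / D1 v0; pose v1 := shift v0 a1 e1.
have D0v1 : D0 v1 != 0 by rewrite /v1 D01.
pose a2 := (1 - F2 v1) / D2 v1; pose v2 := shift v1 a2 e2.
have F1v2 : F1 v2 = 0.
  by rewrite /v2 F12 // /v1 F11 // /a1 divfK // subrr.
have F2v2 : F2 v2 = 1.
  by rewrite /v2 F22 // /a2 divfK ?subrKC // /v1 D21.
have D0v2 : D0 v2 != 0 by rewrite /v2 D02.
have D1v2 : D1 v2 != 0 by rewrite /v2 D12 // /v1 D11.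
(* The projection of [v2] along [e1] to the hyperplane of parameters. *)
pose y0 k := v2 (lift i1 k) - v2 i1 * e1 (lift i1 k).
have v2E : v2 = shift (emb y0) (v2 i1) e1.
  apply: funext => i; rewrite /shift; case: (unliftP i1 i) => [k ->|->].
    by rewrite /emb embed_hyper_lift /y0 subrK.
  by rewrite /emb embed_hyper0 e11 mulr1 add0r.
have D0y : D0 (emb y0) != 0 by move: D0v2; rewrite {1}v2E D01.
have D1y : D1 (emb y0) != 0 by move: D1v2; rewrite {1}v2E D11.
have E1y : E1 y0 != 0 by rewrite mulf_neq0 // hN1.
have cy : c y0 = v2 i1.
  move: F1v2; rewrite {1}v2E F11 // => /eqP; rewrite addrC addr_eq0 => /eqP h.
  by rewrite /c -h mulfK.
apply: (@dim_ge_graph _ _ i1 e1 char0 e11 E c S y0) => //.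
- exact: ratfun_refine.
- move=> y; rewrite mulf_eq0 negb_or => /andP [E1yy]; rewrite hN2 // => F2y.
  have [E0y D1yy] := E10 _ E1yy.
  apply: hS => //; first by rewrite [X in D0 X](_ : _ = w y) // D01.
  + by rewrite [X in D1 X](_ : _ = w y) // D11.
  exact: F1w.
rewrite mulf_neq0 // hN2 // /w cy -v2E F2v2; exact: oner_neq0.
Qed.
End TwoSlots.

(** * Power series solutions at an ordinary point *)

Section StrongRec.
Variables (K : fieldType) (G : nat -> (nat -> K) -> K).
Hypothesis loc : forall n f g, (forall i, (i < n)%N -> f i = g i) -> G n f = G n g.

(** Course-of-values recursion through the list of earlier values; by [loc] that list determines the
    next value. *)
Fixpoint strong_rec_seq n : seq K :=
  if n is n'.+1 then rcons (strong_rec_seq n') (G n' (nth 0 (strong_rec_seq n'))) else [::].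
Definition strong_rec n := nth 0 (strong_rec_seq n.+1) n.

Lemma size_strong_rec_seq n : size (strong_rec_seq n) = n.
Proof. by elim: n => //= n IH; rewrite size_rcons IH. Qed.

Lemma nth_strong_rec_seq n i : (i < n)%N -> nth 0 (strong_rec_seq n) i = strong_rec i.
Proof.
elim: n => // n IH; rewrite ltnS leq_eqVlt => /orP [/eqP -> //|lin].
by rewrite /= nth_rcons size_strong_rec_seq lin IH.
Qed.

Lemma strong_recE n : strong_rec n = G n strong_rec.
Proof.
rewrite /strong_rec /= nth_rcons size_strong_rec_seq ltnn eqxx; apply: loc => i.
exact: nth_strong_rec_seq.
Qed.
End StrongRec.

Section LocalSolution.
Variables (K : fieldType) (s : nat).
Hypothesis char0 : [pchar K] =i pred0.
Implicit Types (b : 'I_s.+1 -> nat -> K) (f g : nat -> K).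

(* Coefficient of [x^k] in [L f], where [b i] is the Taylor series of the coefficient *)
(* of [d^i] in [L].                                                                  *)
Definition op_coef b f k := \sum_(i < s.+1) \sum_(m < k.+1)
  b i m * (f (k - m + i)%N *+ ((k - m + i) ^_ i)).

Lemma op_coefB b f g k : op_coef b (fun x => f x - g x) k = op_coef b f k - op_coef b g k.
Proof.
rewrite /op_coef -sumrB; apply: eq_bigr => i _; rewrite -sumrB; apply: eq_bigr => m _.
by rewrite mulrnBl mulrBr.
Qed.

Lemma op_coef_low b g k : (forall x, (x < k + s)%N -> g x = 0) ->
  op_coef b g k = b ord_max 0%N * (g (k + s)%N *+ ((k + s) ^_ s)).
Proof.
move=> hg; rewrite /op_coef big_ord_recr /= big1 ?add0r => [|i _]; last first.
  rewrite big1 // => m _; rewrite hg ?mul0rn ?mulr0 //=.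
  by rewrite -addnS leq_add ?leq_subr.
rewrite big_ord_recl /= subn0 big1 ?addr0 => [//|m _].
rewrite hg ?mul0rn ?mulr0 //= ltn_add2r /bump /=.
by have := ltn_ord m; lia.
Qed.

Lemma ffact_neq0 k : (((k + s) ^_ s)%:R != 0 :> K).
Proof. by rewrite (pcharf0P K).1 // -lt0n ffact_gt0 leq_addl. Qed.

Definition cut f n x := if (x < n)%N then f x else 0.

(** The solution [x^a + O(x^s)]. For [n >= s], the coefficient of [x^(n-s)] in [L f] is linear in
    [f n], with factor [b_s(0)] times a falling factorial; [cut] sets [f n] and all later
    coefficients to 0 and so isolates the contribution of the earlier ones. *)
Definition local_sol b a : nat -> K := strong_rec (fun n f =>
  if (n < s)%N then (n == a)%:R else
  - op_coef b (cut f n) (n - s) / (b ord_max 0%N * (n ^_ s)%:R)).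

Lemma local_solE b a n : local_sol b a n =
  if (n < s)%N then (n == a)%:R else
  - op_coef b (cut (local_sol b a) n) (n - s) / (b ord_max 0%N * (n ^_ s)%:R).
Proof.
rewrite {1}/local_sol strong_recE // => {}n f g hfg; case: ltnP => // _.
have -> : cut f n = cut g n.
  by apply: funext => x; rewrite /cut; case: ltnP => // /hfg.
by [].
Qed.

Lemma local_sol_init b a n : (n < s)%N -> local_sol b a n = (n == a)%:R.
Proof. by move=> lns; rewrite local_solE lns. Qed.

Lemma local_sol_op b a k : b ord_max 0%N != 0 -> op_coef b (local_sol b a) k = 0.
Proof.
move=> b0; set f := local_sol b a.
have h : op_coef b f k - op_coef b (cut f (k + s)) k =
    b ord_max 0%N * (f (k + s)%N *+ ((k + s) ^_ s)).
  rewrite -op_coefB op_coef_low /cut ?ltnn ?subr0 // => x lx.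
  by rewrite lx subrr.
rewrite -[LHS](subrK (op_coef b (cut f (k + s)) k)) h.
rewrite {1}/f local_solE ltnNge leq_addl /= addnK -/f -[_ *+ _]mulr_natr.
have D0 := ffact_neq0 k.
by field; rewrite b0 D0.
Qed.

Section Perturb.
Variables (b b' : 'I_s.+1 -> nat -> K) (h : nat -> K) (c : K) (a0 : 'I_s) (a kap : nat).
Hypothesis b0 : b ord_max 0%N != 0.
Hypothesis hb : forall i m,
  b' i m = b i m + c * (if val i == val a0 then h m else 0).
Hypothesis h_low : forall m, (m < kap)%N -> h m = 0.
Let f := local_sol b a.
Let f' := local_sol b' a.

Let b'0 : b' ord_max 0%N = b ord_max 0%N.
Proof. by rewrite hb /= gtn_eqF ?mulr0 ?addr0. Qed.

(** [L f = 0] and [L' f' = 0] with [L' = L + c h d^a0] give [L (f' - f) = - c h d^a0 f'], whose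
    right-hand side vanishes to the order [kap] of [h]. *)
Let op_diff k : op_coef b (fun x => f' x - f x) k =
  - c * \sum_(m < k.+1) h m * (f' (k - m + a0)%N *+ ((k - m + a0) ^_ a0)).
Proof.
have E : op_coef b' f' k = op_coef b f' k +
   c * \sum_(m < k.+1) h m * (f' (k - m + a0)%N *+ ((k - m + a0) ^_ a0)).
  rewrite /op_coef.
  under eq_bigr do under eq_bigr do rewrite hb mulrDl.
  under eq_bigr do rewrite big_split /=.
  rewrite big_split /=; congr (_ + _).
  have lt : (a0 < s.+1)%N by rewrite ltnW // ltnS ltn_ord.
  rewrite (bigD1 (Ordinal lt)) //= eqxx [X in _ + X]big1 ?addr0 => [|i ni].
    by rewrite mulr_sumr; apply: eq_bigr => m _; rewrite mulrA.
  rewrite big1 // => m _; rewrite -val_eqE /= in ni.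
  by rewrite (negPf ni) mulr0 mul0r.
rewrite op_coefB local_sol_op // subr0 mulNr -/f'.
by apply/eqP; rewrite -addr_eq0 -E local_sol_op // b'0.
Qed.

Lemma local_sol_perturb_low n : (n < s + kap)%N -> f' n = f n.
Proof.
elim/ltn_ind: n => n IH ln; case: (ltnP n s) => [lns|lsn].
  by rewrite /f /f' !local_sol_init.
have nE : n = (n - s + s)%N by rewrite subnK.
have := op_diff (n - s); rewrite op_coef_low => [|x lx]; last first.
  by rewrite IH ?subrr //; lia.
rewrite big1 ?mulr0 => [|m _]; last first.
  by rewrite h_low ?mul0r //; have := ltn_ord m; lia.
rewrite -nE -mulr_natr => /eqP; rewrite !mulf_eq0 (negPf b0) /=.
have /negPf -> : (n ^_ s)%:R != 0 :> K by rewrite nE ffact_neq0.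
by rewrite orbF subr_eq0 => /eqP.
Qed.

(** At the first index where the perturbation is felt, the right-hand side involves only the initial
    coefficient [f' a0], which is 1 or 0. So only the solution with [a = a0] moves, and linearly in
    [c]. *)
Lemma local_sol_perturb : f' (s + kap)%N = f (s + kap)%N -
  c * (if a == a0 then h kap * (a0 `!)%:R / (b ord_max 0%N * ((kap + s) ^_ s)%:R) else 0).
Proof.
have := op_diff kap; rewrite op_coef_low => [|x lx]; last first.
  by rewrite local_sol_perturb_low ?subrr // addnC.
rewrite big_ord_recr /= big1 => [|m _]; last by rewrite h_low ?mul0r.
rewrite add0r subnn add0n ffactnn [f' a0](local_sol_init b' a (ltn_ord a0)).
rewrite eq_sym [(kap + s)%N]addnC.
set D := (s + kap) ^_ s => E.
have D0 : b ord_max 0%N * D%:R != 0 by rewrite mulf_neq0 // /D addnC ffact_neq0.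
apply/eqP; rewrite -subr_eq0 -[X in X == 0](mulfK D0) mulf_eq0; apply/orP; left.
move: E; rewrite -[_ *+ D]mulr_natr => E.
rewrite (_ : _ * _ = b ord_max 0%N * ((f' (s + kap)%N - f (s + kap)%N) * D%:R) +
  c * (if a == a0 then h kap * (a0 `!)%:R else 0)).
  rewrite E; case: (a =P a0 :> nat) => _; last by rewrite mul0rn !mulr0 addr0.
  by rewrite mulNr addrC subrr.
case: eqP => _; last by ring.
have DD : D%:R != 0 :> K by rewrite /D addnC ffact_neq0.
by field; rewrite b0 DD.
Qed.
End Perturb.

Lemma ratfun_local_sol (T : Type) (D : (T -> K) -> K) (B : (T -> K) -> 'I_s.+1 -> nat -> K) a n :
  polyfun D -> (forall i m, ratfun D (fun u => B u i m)) ->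
  ratfun D (fun u => (B u ord_max 0%N)^-1) ->
  ratfun D (fun u => local_sol (B u) a n).
Proof.
move=> pD rB rinv; elim/ltn_ind: n => n IH.
apply: (ratfun_eq _ (fun u _ => esym (local_solE (B u) a n))).
case: ltnP => [_|lsn]; first exact: ratfun_cst.
apply: ratfun_mul; last first.
  apply: (@ratfun_eq _ _ _ (fun u => (B u ord_max 0%N)^-1 * (n ^_ s)%:R^-1)).
    by apply: ratfun_mul => //; apply: ratfun_cst.
  by move=> u _; rewrite invfM.
apply: ratfun_opp => //; rewrite /op_coef.
apply: ratfun_sum => // i _; apply: ratfun_sum => // m _; apply: ratfun_mul => //.
rewrite /cut; case: ltnP => [lt|_].
  apply: (@ratfun_eq _ _ _ (fun u => local_sol (B u) a (n - s - m + i) *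
    ((n - s - m + i) ^_ i)%:R)); last by move=> u _; rewrite mulr_natr.
  by apply: ratfun_mul; [exact: IH|exact: ratfun_cst].
apply: (ratfun_eq (ratfun_cst _ 0)) => u _; by rewrite mul0rn.
Qed.
End LocalSolution.

(** * Degeneracy of an infinite matrix with finitely many rows *)

Section RowsColumns.
Variables (K : fieldType) (R : finType).
Implicit Types (T : R -> nat -> K).

Definition minor_mx T k (I : 'I_k -> R) : 'M[K]_k := \matrix_(x, y) T (I x) y.

Definition col_free T k := forall x : 'I_k -> K,
  (forall rho, \sum_(y < k) T rho y * x y = 0) -> forall y, x y = 0.

Definition col_in_span T k c := exists x : 'I_k -> K,
  forall rho, T rho c = \sum_(y < k) T rho y * x y.

Lemma wide_left_kernel_fin m (A : R -> 'I_m -> K) : (m < #|R|)%N ->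
  exists2 w : R -> K, exists rho, w rho != 0 & forall j, \sum_rho w rho * A rho j = 0.
Proof.
move=> lt; have [w [i wi] hw] := wide_left_kernel (fun i => A (enum_val i)) lt.
exists (fun rho => w (enum_rank rho)); first by exists (enum_val i); rewrite enum_valK.
move=> j; rewrite -[RHS](hw j) (big_enum_val (fun rho => w (enum_rank rho) * A rho j)).
by apply: eq_bigr => k _; rewrite enum_valK.
Qed.

Lemma nonzero_minor T k (S : pred R) :
  (forall x : 'I_k -> K, (forall rho, rho \notin S -> \sum_(y < k) T rho y * x y = 0) ->
     forall y, x y = 0) ->
  exists I : 'I_k -> R, [/\ injective I, forall x, I x \notin S & \det (minor_mx T I) != 0].
Proof.
move=> free.
(* Rows in [S] are replaced by zero rows: the columns remain independent, and no nonzero minor can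
   use these rows. *)
pose A : 'M[K]_(#|R|, k) :=
  \matrix_(i, y) (if enum_val i \in S then 0 else T (enum_val i) y).
have fullA : row_full A.
  rewrite /row_full -mxrank_tr; apply: inj_row_free => v vA.
  apply/rowP => y; rewrite mxE; apply: (free (v 0)) => rho nS.
  have /rowP /(_ (enum_rank rho)) := vA; rewrite !mxE => E; rewrite -[RHS]E.
  by apply: eq_bigr => z _; rewrite !mxE enum_rankK (negPf nS) mulrC.
pose f := fullrankfun fullA.
have unitA : rowsub f A \in unitmx := fullrowsub_unit fullA.
pose I x := enum_val (f x).
have nS x : I x \notin S.
  apply/negP => Sx; have : \det (rowsub f A) = 0.
    by rewrite (expand_det_row _ x) big1 // => y _; rewrite !mxE -/(I x) Sx mul0r.
  by move/eqP; apply/negP; rewrite -unitfE -unitmxE.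
exists I; split=> //.
  by move=> x y /enum_val_inj; apply: fullrankfun_inj.
have -> : minor_mx T I = rowsub f A.
  by apply/matrixP => x y; rewrite !mxE -/(I x) (negPf (nS x)).
by rewrite -unitfE -unitmxE.
Qed.

(** For Taylor coefficients, this combines solutions into one that starts like [x^j]. *)
Lemma dual_vectors T k : col_free T k -> forall j, (j < k)%N -> exists lam : R -> K,
  forall i, (i < k)%N -> \sum_rho lam rho * T rho i = (i == j)%:R.
Proof.
move=> free j ljk; have [|I [_ _ detI]] := @nonzero_minor T k pred0.
  by move=> x h; apply: free => rho; apply: h.
pose A := minor_mx T I; pose j0 := Ordinal ljk.
have unitA : A \in unitmx by rewrite unitmxE unitfE.
exists (fun rho => \sum_x (if I x == rho then invmx A j0 x else 0)) => i lik.
pose i0 := Ordinal lik.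
have /matrixP /(_ j0 i0) := mulVmx unitA; rewrite !mxE => E.
have -> : (i == j) = (j0 == i0) by rewrite -val_eqE /= eq_sym.
rewrite -E; under eq_bigr do rewrite mulr_suml.
rewrite exchange_big; apply: eq_bigr => x _ /=.
rewrite (bigD1 (I x)) //= eqxx mxE big1 ?addr0 // => rho nrho.
by rewrite eq_sym (negPf nrho) mul0r.
Qed.

(** Cramer's rule without division: the rows of [I] fix the coefficients that express column [c],
    and these determine its entry in row [rho]. *)
Lemma minor_solve T k (I : 'I_k -> R) c rho : \det (minor_mx T I) != 0 ->
  col_in_span T k c ->
  \det (minor_mx T I) * T rho c -
  \sum_(x < k) \sum_(y < k) T rho x * (\adj (minor_mx T I)) x y * T (I y) c = 0.
Proof.
move=> d0 [z hz]; set A := minor_mx T I.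
apply/eqP; rewrite subr_eq0; apply/eqP; rewrite hz mulr_sumr; apply: eq_bigr => x _.
under eq_bigr do rewrite -mulrA; rewrite -mulr_sumr mulrCA; congr (_ * _).
have := congr1 (fun B : 'M_k => B *m \col_y z y) (mul_adj_mx A).
move/matrixP/(_ x 0); rewrite -mulmxA mul_scalar_mx !mxE => <-.
apply: eq_bigr => y _; rewrite hz !mxE; congr (_ * _); apply: eq_bigr => w _.
by rewrite !mxE.
Qed.

Lemma minor_solve_span T k (I : 'I_k -> R) c rho : \det (minor_mx T I) != 0 ->
  (forall rho', rho' = rho \/ exists x, rho' = I x) ->
  \det (minor_mx T I) * T rho c -
  \sum_(x < k) \sum_(y < k) T rho x * (\adj (minor_mx T I)) x y * T (I y) c = 0 ->
  col_in_span T k c.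
Proof.
set A := minor_mx T I; set d := \det A => d0 cov E.
exists (fun x => d^-1 * \sum_y (\adj A) x y * T (I y) c) => rho'.
case: (cov rho') => [->|[x0 ->]].
  apply: (mulfI d0); move/eqP: E; rewrite subr_eq0 => /eqP ->.
  rewrite mulr_sumr; apply: eq_bigr => x _.
  rewrite [in RHS]mulrCA mulVKf // mulr_sumr.
  by apply: eq_bigr => y _; rewrite mulrA.
apply: (mulfI d0).
have := congr1 (fun B : 'M_k => B *m \col_y T (I y) c) (mul_mx_adj A).
move/matrixP/(_ x0 0); rewrite -mulmxA mul_scalar_mx !mxE -/d => <-.
rewrite mulr_sumr; apply: eq_bigr => x _; rewrite !mxE [in RHS]mulrCA mulVKf //.
by congr (_ * _); apply: eq_bigr => y _; rewrite !mxE.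
Qed.

Lemma col_free_minor T k (I : 'I_k -> R) : \det (minor_mx T I) != 0 -> col_free T k.
Proof.
move=> d0 x hx y; set A := minor_mx T I.
have uA : A \in unitmx by rewrite unitmxE unitfE.
have : A *m \col_y x y = 0.
  by apply/colP => z; rewrite !mxE -[RHS](hx (I z)); apply: eq_bigr => w _; rewrite !mxE.
move/(congr1 (mulmx (invmx A))); rewrite mulKmx // mulmx0 => /colP /(_ y).
by rewrite !mxE.
Qed.

Lemma col_free_extend T k c : col_free T k -> ~ col_in_span T k c ->
  col_free (fun rho y => if (y < k)%N then T rho y else T rho c) k.+1.
Proof.
move=> free nspan x hx.
have hx' rho : \sum_(y < k) T rho y * x (widen_ord (leqnSn k) y) + T rho c * x ord_max = 0.
  rewrite -[RHS](hx rho) big_ord_recr /= ltnn; congr (_ + _).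
  by apply: eq_bigr => y _; rewrite ltn_ord.
have xm : x ord_max = 0.
  apply/eqP; apply: contrapT => /negP xm; apply: nspan.
  exists (fun y => - x (widen_ord (leqnSn k) y) / x ord_max) => rho.
  apply: (mulIf xm); move/eqP: (hx' rho); rewrite addrC addr_eq0 => /eqP ->.
  rewrite mulr_suml -sumrN; apply: eq_bigr => y _.
  by rewrite -mulrA divfK // mulrN.
move=> y; case: (unliftP ord_max y) => [j ->|-> //].
have -> : lift ord_max j = widen_ord (leqnSn k) j.
  by apply: val_inj; rewrite /= /bump leqNgt ltn_ord.
apply: (free (fun j => x (widen_ord (leqnSn k) j))) => rho.
by rewrite -[RHS](hx' rho) xm mulr0 addr0.
Qed.

Lemma col_dependent T k : col_free T k -> ~ col_free T k.+1 -> col_in_span T k k.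
Proof.
move=> free nfree; apply: contrapT => nspan; apply: nfree => x hx.
apply: (col_free_extend free nspan) => rho; rewrite -[RHS](hx rho).
apply: eq_bigr => y _; case: ltnP => // lky; congr (T _ _ * _).
by apply/eqP; rewrite eqn_leq lky -ltnS ltn_ord.
Qed.

Lemma square_row_free T k (lam : R -> K) : #|R| = k -> col_free T k ->
  (forall y, (y < k)%N -> \sum_rho lam rho * T rho y = 0) -> forall rho, lam rho = 0.
Proof.
move=> cR free ker; have [|I [injI _ dI]] := @nonzero_minor T k pred0.
  by move=> x h; apply: free => rho; apply: h.
have bijI : bijective I by apply: inj_card_bij => //; rewrite cR card_ord.
set A := minor_mx T I in dI; have uA : A \in unitmx by rewrite unitmxE unitfE.
have : (\row_x lam (I x)) *m A = 0.
  apply/rowP => y; rewrite !mxE -[RHS](ker y (ltn_ord y)).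
  by rewrite [RHS](reindex I (onW_bij _ bijI)); apply: eq_bigr => x _; rewrite !mxE.
move/(congr1 (mulmx^~ (invmx A))); rewrite mulmxK // mul0mx => /rowP z rho.
by have [I' _ I'K] := bijI; have := z (I' rho); rewrite !mxE I'K.
Qed.

(** * Rank drops charged to rows whose entries can be prescribed *)

Section Degeneracy.
Variables (T : R -> nat -> K) (n s : nat) (free : pred R).
Hypothesis cardR : #|R| = n.+1.
Hypothesis lesn : (s <= n)%N.
Hypothesis free_s : col_free T s.
Hypothesis left_kernel_free : forall lam : R -> K,
  (forall k, (k < n)%N -> \sum_rho lam rho * T rho k = 0) ->
  (forall rho, free rho -> lam rho = 0) -> forall rho, lam rho = 0.

Lemma left_kernel_free_row (lam : R -> K) : (exists rho, lam rho != 0) ->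
  (forall k, (k < n)%N -> \sum_rho lam rho * T rho k = 0) ->
  exists2 rho, free rho & lam rho != 0.
Proof.
move=> [rho0 nz] ker; apply: contrapT => h; case/eqP: nz.
apply: left_kernel_free => // rho fr; apply/eqP; apply: contrapT => /negP nz.
by apply: h; exists rho.
Qed.

(** A left kernel vector nonzero at [rho] expresses that row by the others, which therefore still
    have rank [n]. *)
Lemma full_rank_minor : col_free T n -> exists rho (I : 'I_n -> R),
  [/\ free rho, forall x, I x != rho, \det (minor_mx T I) != 0 &
     forall rho', rho' = rho \/ exists x, rho' = I x].
Proof.
move=> fn; have [|lam nz ker] := @wide_left_kernel_fin n (fun rho y => T rho y).
  by rewrite cardR.
have [|rho fr lr] := left_kernel_free_row nz.
  by move=> k lk; apply: (ker (Ordinal lk)).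
have [|I [injI nS dI]] := @nonzero_minor T n (pred1 rho).
  move=> x hx; apply: fn => rho'.
  have [->|ne] := eqVneq rho' rho; last by apply: hx; rewrite inE.
  apply: (mulfI lr); rewrite mulr0.
  transitivity (\sum_rho' lam rho' * \sum_(y < n) T rho' y * x y).
    rewrite (bigD1 rho) //= [X in _ = _ + X]big1 ?addr0 // => rho'' ne.
    by rewrite hx ?mulr0 // inE.
  under eq_bigr do rewrite mulr_sumr.
  rewrite exchange_big big1 // => y _ /=.
  under eq_bigr do rewrite mulrA.
  by rewrite -mulr_suml ker mul0r.
exists rho, I; split=> // rho'.
have : rho' \in rho |: [set I x | x : 'I_n].
  suff -> : rho |: [set I x | x : 'I_n] = setT by rewrite inE.
  have nin : rho \notin [set I x | x : 'I_n].
    by apply/negP => /imsetP [x _ rx]; have := nS x; rewrite -rx inE eqxx.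
  apply/eqP; rewrite eqEcard subsetT cardsT cardR cardsU1 nin card_imset // card_ord.
  by rewrite add1n ltnSn.
by rewrite inE => /orP [/set1P|/imsetP [x _]]; [left|right; exists x].
Qed.

Lemma rank_drop : ~ col_free T n -> exists k (I : 'I_k -> R) rho1 rho2,
  [/\ (s <= k < n)%N, free rho1, free rho2 & rho1 != rho2] /\
  [/\ forall x, I x != rho1, forall x, I x != rho2, \det (minor_mx T I) != 0 &
      col_in_span T k k].
Proof.
move=> nfn.
have [k [lsk lkn] [fk nfk]] : exists2 k, (s <= k)%N /\ (k < n)%N &
    col_free T k /\ ~ col_free T k.+1.
  apply: contrapT => h; apply: nfn.
  have H m : (s <= m <= n)%N -> col_free T m.
    elim: m => [|m IH] /andP [lsm lmn].
      by have -> : 0%N = s by lia.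
    have [->|ne] := eqVneq m.+1 s; first exact: free_s.
    have lsm' : (s <= m)%N by lia.
    apply: contrapT => nf; apply: h; exists m; split=> //.
    by apply: IH; rewrite lsm' ltnW.
  by apply: H; rewrite lesn leqnn.
have span := col_dependent fk nfk.
have [z hz] := span.
have kill (w : R -> K) : (forall y : nat, (y < k)%N -> \sum_rho w rho * T rho y = 0) ->
    \sum_rho w rho * T rho k = 0.
  move=> hw; under eq_bigr do rewrite hz mulr_sumr.
  rewrite exchange_big big1 // => y _ /=; under eq_bigr do rewrite mulrA.
  by rewrite -mulr_suml hw ?mul0r.
have [|lam nzl kl] := @wide_left_kernel_fin n (fun rho y => T rho y).
  by rewrite cardR.
have {}kl y : (y < n)%N -> \sum_rho lam rho * T rho y = 0.
  by move=> ly; apply: (kl (Ordinal ly)).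
have [rho1 fr1 l1] := left_kernel_free_row nzl kl.
(* Column [k] is redundant, so the condition [mu rho1 = 0] may take its place: there are still only
   [n] conditions on [n + 1] weights. *)
have [|mu nzm km] := @wide_left_kernel_fin n
  (fun rho y => if val y == k then (rho == rho1)%:R else T rho y).
  by rewrite cardR.
have mu1 : mu rho1 = 0.
  have := km (Ordinal lkn); rewrite /= eqxx (bigD1 rho1) //= eqxx mulr1 big1 ?addr0 //.
  by move=> rho ne; rewrite (negPf ne) mulr0.
have {}km y : (y < n)%N -> \sum_rho mu rho * T rho y = 0.
  have km' y' : (y' < n)%N -> y' != k -> \sum_rho mu rho * T rho y' = 0.
    by move=> ly ne; have := km (Ordinal ly); rewrite /= (negPf ne).
  move=> ly; have [->|ne] := eqVneq y k; last exact: km'.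
  by apply: kill => y' ly'; apply: km'; [exact: ltn_trans lkn|rewrite ltn_eqF].
have [rho2 fr2 m2] := left_kernel_free_row nzm km.
have ne12 : rho1 != rho2 by apply: contraNneq m2 => <-; rewrite mu1.
have [|I [injI nS dI]] := @nonzero_minor T k (pred2 rho1 rho2).
  move=> x hx; apply: fk.
  pose ev rho := \sum_(y < k) T rho y * x y.
  have out rho : rho != rho1 -> rho != rho2 -> ev rho = 0.
    by move=> n1 n2; apply: hx; rewrite inE negb_or n1.
  have kern (w : R -> K) : (forall y, (y < n)%N -> \sum_rho w rho * T rho y = 0) ->
      w rho1 * ev rho1 + w rho2 * ev rho2 = 0.
    move=> hw; transitivity (\sum_rho w rho * ev rho).
      rewrite (bigD1 rho1) //= (bigD1 rho2) 1?eq_sym //= [X in _ = _ + (_ + X)]big1 ?addr0 //.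
      by move=> rho /andP [n1 n2]; rewrite out ?mulr0.
    under eq_bigr do rewrite mulr_sumr.
    rewrite exchange_big big1 // => y _ /=; under eq_bigr do rewrite mulrA.
    by rewrite -mulr_suml hw ?mul0r // (ltn_trans _ lkn).
  have ev2 : ev rho2 = 0.
    by have /eqP := kern _ km; rewrite mu1 mul0r add0r mulf_eq0 (negPf m2) => /eqP.
  have ev1 : ev rho1 = 0.
    by have /eqP := kern _ kl; rewrite ev2 mulr0 addr0 mulf_eq0 (negPf l1) => /eqP.
  move=> rho; have [->|n1] := eqVneq rho rho1; first exact: ev1.
  by have [->|n2] := eqVneq rho rho2; [exact: ev2|exact: out].
exists k, I, rho1, rho2; split; first by rewrite lsk lkn.
by split=> // x; have := nS x; rewrite inE negb_or => /andP [].
Qed.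
End Degeneracy.
End RowsColumns.

(** * The matrix of Taylor coefficients of the composed solutions *)

Section Operators.
Variables (K : fieldType) (s d : nat).
Implicit Types (v : pt K (s.+1 * d.+1)) (h : {poly K}).

Definition op_poly v (i : 'I_s.+1) : {poly K} := \sum_(j < d.+1) v (mxvec_index i j) *: 'X^j.

Lemma coef_opOf v (i : 'I_s.+1) : (opOf v)`_i = op_poly v i.
Proof.
rewrite /opOf coef_sum (bigD1 i) //= coefCM coefXn eqxx mulr1.
rewrite [X in _ + X]big1 ?addr0 // => k ne.
by rewrite coefCM coefXn eq_sym (negPf ne : (k == i :> nat) = false) mulr0.
Qed.

Lemma size_opOf_le v : (size (opOf v) <= s.+1)%N.
Proof.
apply: (leq_trans (size_sum _ _ _)); apply/bigmax_leqP => i _.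
apply: leq_trans (size_polyMleq _ _) _; rewrite size_polyXn addnS /=.
by rewrite (leq_trans (leq_add (size_polyC_leq1 _) (leqnn _))).
Qed.

Lemma size_opOf v : op_poly v ord_max != 0 -> size (opOf v) = s.+1.
Proof.
move=> nz; apply/eqP; rewrite eqn_leq size_opOf_le ltnNge; apply: contra nz => le.
by rewrite -coef_opOf /= nth_default.
Qed.

Lemma lead_opOf v : size (opOf v) = s.+1 -> lead_coef (opOf v) = op_poly v ord_max.
Proof. by move=> sz; rewrite lead_coefE sz -coef_opOf. Qed.

(** Coordinates of the operator [h d^a]. *)
Definition dir (a : nat) h : 'I_(s.+1 * d.+1) -> K :=
  mxvec (\matrix_(i < s.+1, j < d.+1) (if val i == a then h`_j else 0)) 0.

Lemma dirE a h i j : dir a h (mxvec_index i j) = if val i == a then h`_j else 0.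
Proof. by rewrite /dir mxvecE mxE. Qed.

Lemma op_poly_shift v c a h i : (size h <= d.+1)%N ->
  op_poly (shift v c (dir a h)) i = op_poly v i + c *: (if val i == a then h else 0).
Proof.
move=> sh; rewrite /op_poly /shift.
under eq_bigr do rewrite scalerDl.
rewrite big_split /=; congr (_ + _); case: ifP => ia; last first.
  by rewrite scaler0 big1 // => j _; rewrite dirE ia mulr0 scale0r.
rewrite -[in RHS](coefK h) (poly_def (size h)) scaler_sumr.
rewrite (big_ord_widen d.+1 (fun j => c *: (h`_j *: 'X^j))) // [RHS]big_mkcond /=.
apply: eq_bigr => j _; rewrite dirE ia -scalerA; case: ltnP => // le.
by rewrite nth_default // scale0r scaler0.
Qed.

Definition jet (al : K) v i m : K := sexp (op_poly v i) al m.

Lemma jet_shift al v c a h i m : (size h <= d.+1)%N ->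
  jet al (shift v c (dir a h)) i m =
  jet al v i m + c * (if val i == a then sexp h al m else 0).
Proof.
move=> sh; rewrite /jet op_poly_shift // /sexp comp_polyD comp_polyZ coefD coefZ.
by case: ifP => //; rewrite comp_poly0 coef0.
Qed.

Lemma jet0 al v i : jet al v i 0%N = (op_poly v i).[al].
Proof. by rewrite /jet /sexp -horner_coef0 horner_comp !hornerE. Qed.

Lemma polyfun_jet al i m : polyfun (fun v => jet al v i m).
Proof.
apply: (@polyfun_ext _ _ (fun v : pt K (s.+1 * d.+1) =>
  \sum_(j < d.+1) v (mxvec_index i j) * (('X + al%:P) ^+ j)`_m)).
  apply: polyfun_sum => j _; apply: polyfun_mul; first exact: polyfun_var.
  exact: polyfun_cst.
move=> v; rewrite /jet /sexp /op_poly linear_sum coef_sum; apply: eq_bigr => j _ /=.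
by rewrite comp_polyZ coefZ rmorphXn /= comp_polyX.
Qed.

Lemma local_sol_solves al v a : [pchar K] =i pred0 -> (op_poly v ord_max).[al] != 0 ->
  solves (opOf v) al (local_sol (jet al v) a).
Proof.
move=> char0 nz k; rewrite (sapplyE _ _ (size_opOf_le v)) series_sum.
have nz0 : jet al v ord_max 0%N != 0 by rewrite jet0.
rewrite -[RHS](local_sol_op char0 a k nz0) /op_coef; apply: eq_bigr => i _.
rewrite seriesM; apply: eq_bigr => m _.
by rewrite coef_opOf iter_sder.
Qed.
End Operators.

Lemma sexp_XsubC_exp (K : fieldType) (q : {poly K}) (a : K) k m :
  sexp (q * ('X - a%:P) ^+ k) a m = if (m < k)%N then 0 else (q \Po ('X + a%:P))`_(m - k).
Proof.
rewrite /sexp comp_polyM rmorphXn /= comp_polyB comp_polyX comp_polyC addrK.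
by rewrite coefMXn.
Qed.

Section Composition.
Variables (K : fieldType) (r s d : nat) (g : 'I_r -> nat -> K).
Hypothesis char0 : [pchar K] =i pred0.
Notation rows := ('I_r * 'I_s)%type.
Implicit Types (v : pt K (s.+1 * d.+1)) (rho : rows).

Let al j := g j 0%N.

Definition comp_series v rho : series K :=
  scomp (local_sol (jet (al rho.1) v) rho.2) (al rho.1) (g rho.1).
Definition taylor_mx v rho k : K := comp_series v rho k.

(** Nonzero exactly when the leading coefficient of [L] avoids all the points [g j 0], and a common
    denominator for all Taylor coefficients. *)
Definition ordinary_den v := \prod_j jet (al j) v ord_max 0%N.

Lemma ordinary_den_neq0 v j : ordinary_den v != 0 -> jet (al j) v ord_max 0%N != 0.
Proof. by move/prodf_neq0 => h; apply: h. Qed.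

Lemma polyfun_ordinary_den : polyfun ordinary_den.
Proof. by apply: polyfun_prod => j _; apply: polyfun_jet. Qed.

Lemma ratfun_inv_jet j : ratfun ordinary_den (fun v => (jet (al j) v ord_max 0%N)^-1).
Proof.
apply: (@ratfun_inv_factor _ _ _ _
   (fun v => \prod_(k | k != j) jet (al k) v ord_max 0%N)).
- exact: polyfun_jet.
- by apply: polyfun_prod => k _; apply: polyfun_jet.
by move=> v; rewrite /ordinary_den (bigD1 j).
Qed.

Let gt j : series K := (g j : series K) - sconst (al j).

Lemma taylor_mxE v rho k : taylor_mx v rho k =
  \sum_(i < k.+1) local_sol (jet (al rho.1) v) rho.2 i * (gt rho.1 ^+ i) k.
Proof. by rewrite /taylor_mx /comp_series (@scompE _ _ _ _ k.+1). Qed.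

Lemma ratfun_taylor rho k : ratfun ordinary_den (fun v => taylor_mx v rho k).
Proof.
have pD := polyfun_ordinary_den.
apply: (ratfun_eq _ (fun v _ => esym (taylor_mxE v rho k))).
apply: ratfun_sum => // i _; apply: ratfun_mul; last exact: ratfun_cst.
apply: ratfun_local_sol => //; last exact: ratfun_inv_jet.
by move=> i' m; apply: ratfun_poly; apply: polyfun_jet.
Qed.

Let gt0 j i : (i < 1)%N -> gt j i = 0.
Proof. by case: i => // _; rewrite /gt seriesD seriesN sconstE subrr. Qed.

Let gtS j i : gt j i.+1 = g j i.+1.
Proof. by rewrite /gt seriesD seriesN sconstE subr0. Qed.

Let gt_low j k i : (i < k)%N -> (gt j ^+ k) i = 0.
Proof. by move=> lik; apply: (seriesX_low (gt0 j) k).1; rewrite muln1. Qed.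

Let gt_diag j k : (gt j ^+ k) k = g j 1%N ^+ k.
Proof. by have := (seriesX_low (gt0 j) k).2; rewrite muln1 gtS. Qed.

(** Below [x^s] a local solution is a monomial, so the first [s] columns depend on [g] only. *)
Lemma taylor_low v rho k : (k < s)%N -> taylor_mx v rho k = (gt rho.1 ^+ rho.2) k.
Proof.
move=> lks; rewrite taylor_mxE.
case: (ltnP k rho.2) => [lk|lk].
  rewrite gt_low // big1 // => i _.
  have lik : (i <= k)%N by rewrite -ltnS.
  rewrite local_sol_init ?(leq_ltn_trans lik) // ltn_eqF ?mul0r //.
  exact: leq_ltn_trans lk.
have lk' : (rho.2 < k.+1)%N by [].
rewrite (bigD1 (Ordinal lk')) //= local_sol_init // eqxx mul1r big1 ?addr0 // => i ne.
have lik : (i <= k)%N by rewrite -ltnS.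
by rewrite local_sol_init ?(leq_ltn_trans lik) // (negPf ne : (i == rho.2 :> nat) = _) mul0r.
Qed.

(** The rows at such a root form a triangular matrix with the powers of [g_j'(0)] on the
    diagonal. *)
Lemma taylor_col_free v j : g j 1%N != 0 -> col_free (taylor_mx v) s.
Proof.
move=> b0 x hx y.
have H m : forall y : 'I_s, (s - y <= m)%N -> x y = 0.
  elim: m => [|m IH] {}y; first by have := ltn_ord y; lia.
  move=> lm; have := hx (j, y).
  rewrite (bigD1 y) //= taylor_low // gt_diag big1 ?addr0 => [/eqP|z ne].
    by rewrite mulf_eq0 expf_eq0 (negPf b0) andbF => /eqP.
  rewrite taylor_low //=; case: (ltngtP z y) => [lt|gtz|e].
  - by rewrite gt_low ?mul0r.
  - by rewrite IH ?mulr0 //; have := ltn_ord z; lia.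
  by case/eqP: ne; apply: val_inj.
exact: (H s y (leq_subr _ _)).
Qed.

(* A solution at a critical root composed with [gamma x^2 + ...] has valuation at most *)
(* [2 (s - 1)], so its vanishing is detected by the first [r s - 1] coefficients.    *)
Lemma taylor_left_kernel v (lam : rows -> K) m :
  (forall j, g j 1%N != 0 \/ (val j = 0%N /\ g j 2%N != 0)) ->
  (s.*2 <= m.+1)%N ->
  (forall k, (k < m)%N -> \sum_rho lam rho * taylor_mx v rho k = 0) ->
  (forall rho, g rho.1 1%N != 0 -> lam rho = 0) -> forall rho, lam rho = 0.
Proof.
move=> hG hm ker hfree rho0; apply/eqP; apply: contrapT => /negP nz.
case: rho0 nz => j0 a00 nz; have b0 : g j0 1%N = 0.
  by apply/eqP; apply: contrapT => /negP /(hfree (j0, a00)) z; rewrite z eqxx in nz.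
have [j00 c0] : val j0 = 0%N /\ g j0 2%N != 0.
  by case: (hG j0) => //; rewrite b0 eqxx.
have ex : exists a, [exists b : 'I_s, (val b == a) && (lam (j0, b) != 0)].
  by exists (val a00); apply/existsP; exists a00; rewrite eqxx.
case: (ex_minnP ex) => a /existsP [b /andP [/eqP ba lb]] mina.
have lb0 (c : 'I_s) : (c < b)%N -> lam (j0, c) = 0.
  move=> lcb; apply/eqP; apply: contraLR lcb => lc; rewrite -leqNgt ba; apply: mina.
  by apply/existsP; exists c; rewrite eqxx.
have gt2 i : (i < 2)%N -> gt j0 i = 0.
  by case: i => [|[|]] // _; [exact: gt0|rewrite gtS b0].
(* In column [2 b] only the row [(j0, b)] contributes, with a power of [g j0 2]: other roots have
   weight 0, smaller indices have weight 0 by minimality, and larger indices have valuation above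
   [2 b]. *)
have := ker b.*2; rewrite (_ : (b.*2 < m)%N) => [/(_ isT)|]; last first.
  by have := ltn_ord b; lia.
rewrite (bigD1 (j0, b)) //= big1 ?addr0 => [|rho ne]; last first.
  case: rho ne => j c ne; have [jj|nj] := eqVneq j j0; last first.
    rewrite hfree ?mul0r //=; case: (hG j) => // -[vj _].
    by case/eqP: nj; apply: val_inj; rewrite vj j00.
  rewrite jj in ne *; have {}ne : c != b by apply: contraNneq ne => ->.
  case: (ltngtP c b) => [lt|gtb|e]; first by rewrite lb0 ?mul0r.
  - rewrite taylor_mxE big1 ?mulr0 // => i _ /=.
    case: (leqP i b) => [lib|lbi].
      rewrite local_sol_init ?(leq_ltn_trans lib) // ltn_eqF ?mul0r //.
      exact: leq_ltn_trans gtb.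
    by rewrite (seriesX_low gt2 i).1 ?mulr0 //; lia.
  by case/eqP: ne; apply: val_inj.
rewrite taylor_mxE.
have lb2 : (b < b.*2.+1)%N by rewrite ltnS -addnn leq_addr.
rewrite (bigD1 (Ordinal lb2)) //= local_sol_init // eqxx mul1r.
have gb : (gt j0 ^+ b) b.*2 = gt j0 2%N ^+ b.
  by rewrite -muln2 (seriesX_low gt2 b).2.
rewrite gb big1 ?addr0 => [/eqP|i ne].
  by rewrite mulf_eq0 (negPf lb) expf_eq0 gtS (negPf c0) andbF.
case: (ltngtP i b) => [lib|lbi|e].
- rewrite local_sol_init ?(ltn_trans lib) // ltn_eqF ?mul0r //.
- by rewrite (seriesX_low gt2 i).1 ?mulr0 //; lia.
by case/eqP: ne; apply: val_inj.
Qed.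

Section Slot.
Variables (rho0 : rows) (h : {poly K}) (kap M : nat).
Hypothesis sh : (size h <= d.+1)%N.
Hypothesis h_other : forall j, j != rho0.1 -> forall m, (m < M)%N -> sexp h (al j) m = 0.
Hypothesis h_low : forall m, (m < kap)%N -> sexp h (al rho0.1) m = 0.
Hypothesis lt_kM : (kap < M)%N.

Notation e := (dir (d := d) (s := s) rho0.2 h).

(** Rate of change of the entry in row [rho0] and column [s + kap]: the change of the local solution
    at that index, carried through the composition by the leading term of the corresponding power of
    [g - g 0]. *)
Definition slot_coef v : K := - (sexp h (al rho0.1) kap * (rho0.2 `!)%:R /
  (jet (al rho0.1) v ord_max 0%N * ((kap + s) ^_ s)%:R)) * g rho0.1 1%N ^+ (s + kap).

Lemma jet_slot_lead j v c : jet (al j) (shift v c e) ord_max 0%N = jet (al j) v ord_max 0%N.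
Proof. by rewrite jet_shift //= gtn_eqF ?mulr0 ?addr0. Qed.

Lemma ordinary_den_slot v c : ordinary_den (shift v c e) = ordinary_den v.
Proof. by apply: eq_bigr => j _; rewrite jet_slot_lead. Qed.

Lemma slot_coef_shift v c a (h' : {poly K}) : (size h' <= d.+1)%N -> (a < s)%N ->
  slot_coef (shift v c (dir a h')) = slot_coef v.
Proof. by move=> sh' la; rewrite /slot_coef jet_shift //= gtn_eqF // mulr0 addr0. Qed.

Lemma taylor_slot_low v c rho k : ordinary_den v != 0 -> (k < s + kap)%N ->
  taylor_mx (shift v c e) rho k = taylor_mx v rho k.
Proof.
move=> Dv lk; rewrite !taylor_mxE; apply: eq_bigr => i _; congr (_ * _).
have li : (i <= k)%N by rewrite -ltnS.
have [ej|ne] := eqVneq rho.1 rho0.1.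
  apply: (@local_sol_perturb_low _ _ char0 _ _ (sexp h (al rho0.1)) c rho0.2 _ kap) => //.
  - exact: ordinary_den_neq0.
  - by move=> i' m; rewrite ej jet_shift.
  exact: leq_ltn_trans lk.
apply: (@local_sol_perturb_low _ _ char0 _ _ (sexp h (al rho.1)) c rho0.2 _ M) => //.
- exact: ordinary_den_neq0.
- by move=> i' m; rewrite jet_shift.
- exact: h_other.
by lia.
Qed.

(** Rows of other roots see [h] only from order [M > kap] on. Rows of the same root but another
    index are unmoved at [s + kap], because their solution has initial coefficient 0 at [rho0.2]. *)
Lemma taylor_slot_other v c rho k : ordinary_den v != 0 -> (k <= s + kap)%N ->
  rho != rho0 -> taylor_mx (shift v c e) rho k = taylor_mx v rho k.
Proof.
move=> Dv lk ne; rewrite !taylor_mxE; apply: eq_bigr => i _; congr (_ * _).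
have li : (i <= k)%N by rewrite -ltnS.
have [ej|nj] := eqVneq rho.1 rho0.1; last first.
  apply: (@local_sol_perturb_low _ _ char0 _ _ (sexp h (al rho.1)) c rho0.2 _ M) => //.
  - exact: ordinary_den_neq0.
  - by move=> i' m; rewrite jet_shift.
  - exact: h_other.
  by lia.
have na : (rho.2 == rho0.2 :> nat) = false.
  apply/negP => /eqP ea; case/eqP: ne; case: (rho) ej ea => [j a]; case: (rho0) => [j' a'] /=.
  by move=> -> /val_inj ->.
have hb i' m : jet (al rho.1) (shift v c e) i' m = jet (al rho.1) v i' m +
    c * (if val i' == val rho0.2 then sexp h (al rho0.1) m else 0).
  by rewrite ej jet_shift.
have nz := ordinary_den_neq0 rho.1 Dv.
case: (ltnP i (s + kap)) => [lt|ge].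
  exact: (local_sol_perturb_low char0 _ nz hb h_low).
have -> : (i : nat) = (s + kap)%N by apply/eqP; rewrite eqn_leq ge (leq_trans li lk).
by rewrite (local_sol_perturb char0 _ nz hb h_low) na mulr0 subr0.
Qed.

Lemma taylor_slot v c : ordinary_den v != 0 ->
  taylor_mx (shift v c e) rho0 (s + kap) = taylor_mx v rho0 (s + kap) + c * slot_coef v.
Proof.
move=> Dv; rewrite !taylor_mxE !(big_ord_recr (s + kap)) /=.
have hb i' m : jet (al rho0.1) (shift v c e) i' m = jet (al rho0.1) v i' m +
    c * (if val i' == val rho0.2 then sexp h (al rho0.1) m else 0).
  by rewrite jet_shift.
have nz := ordinary_den_neq0 rho0.1 Dv.
rewrite (local_sol_perturb char0 _ nz hb h_low) eqxx gt_diag.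
set S1 := (\sum_(i < _) _); set S2 := (\sum_(i < _) _); have -> : S1 = S2; last first.
  by rewrite /slot_coef; ring.
apply: eq_bigr => i _; congr (_ * _).
exact: (local_sol_perturb_low char0 _ nz hb h_low).
Qed.
End Slot.
End Composition.

(** * Codimension of the degenerate operators *)

Section MinorEquation.
Variables (K : fieldType) (R : finType).
Implicit Types (T : R -> nat -> K).

(** The minor on the rows [I] and [rho] and on the first [k] columns and [c], expanded along its
    border; with the other entries fixed it is affine in [T rho c]. *)
Definition minor_eq T k (I : 'I_k -> R) rho c : K :=
  \det (minor_mx T I) * T rho c -
  \sum_(x < k) \sum_(y < k) T rho x * (\adj (minor_mx T I)) x y * T (I y) c.

Lemma minor_mx_agree T T' k (I : 'I_k -> R) :
  (forall rho i, (i < k)%N -> T' rho i = T rho i) -> minor_mx T' I = minor_mx T I.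
Proof. by move=> h; apply/matrixP => x y; rewrite !mxE h. Qed.

Lemma minor_eq_change T T' k (I : 'I_k -> R) rho c :
  (forall rho i, (i < k)%N -> T' rho i = T rho i) ->
  (forall x, T' (I x) c = T (I x) c) ->
  minor_eq T' I rho c =
  minor_eq T I rho c + (T' rho c - T rho c) * \det (minor_mx T I).
Proof.
move=> h hI; rewrite /minor_eq (minor_mx_agree I h).
under eq_bigr do under eq_bigr do rewrite hI h //.
by ring.
Qed.
End MinorEquation.

(** * Hermite interpolation at the constant terms of the roots *)

Section SlotPoly.
Variables (K : fieldType) (r M : nat) (al : 'I_r -> K).
Hypothesis al_inj : injective al.
Implicit Types (E : {poly K}) (j : 'I_r).

(** Order [k] at [al j], provided [E] does not vanish there, and order at least [M] at the other
    points. The cofactor [E] serves to adjust the degree. *)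
Definition slot_poly E j k : {poly K} :=
  E * \prod_(i | i != j) ('X - (al i)%:P) ^+ M * ('X - (al j)%:P) ^+ k.

Lemma slot_poly_other E j k i m : i != j -> (m < M)%N -> sexp (slot_poly E j k) (al i) m = 0.
Proof.
move=> ne lm; rewrite /slot_poly (bigD1 i) //=; set Q := \prod_(_ | _) _.
rewrite (_ : _ * _ = E * Q * ('X - (al j)%:P) ^+ k * ('X - (al i)%:P) ^+ M); last by ring.
by rewrite sexp_XsubC_exp lm.
Qed.

Lemma slot_poly_low E j k m : (m < k)%N -> sexp (slot_poly E j k) (al j) m = 0.
Proof. by move=> lm; rewrite /slot_poly sexp_XsubC_exp lm. Qed.

Lemma slot_poly_top E j k : E.[al j] != 0 -> sexp (slot_poly E j k) (al j) k != 0.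
Proof.
move=> Ej; rewrite /slot_poly sexp_XsubC_exp ltnn subnn -horner_coef0 horner_comp.
rewrite !hornerE mulf_neq0 // horner_prod; apply/prodf_neq0 => i ne.
by rewrite horner_exp expf_neq0 // !hornerE subr_eq0 (inj_eq al_inj) eq_sym.
Qed.

Lemma slot_poly_monic E j k : E \is monic -> slot_poly E j k \is monic.
Proof.
move=> mE; rewrite /slot_poly !rpredM ?rpredX ?monicXsubC //.
by apply: rpred_prod => i _; rewrite rpredX ?monicXsubC.
Qed.

Lemma size_slot_poly E j k : E \is monic ->
  size (slot_poly E j k) = (size E + r.-1 * M + k)%N.
Proof.
move=> mE.
have H (F : {poly K}) a e : F != 0 -> size (F * ('X - a%:P) ^+ e) = (size F + e)%N.
  move=> F0; rewrite size_Mmonic ?monic_exp ?monicXsubC // size_exp_XsubC.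
  by rewrite addnS.
have prodE l : size (E * \prod_(i <- l | i != j) ('X - (al i)%:P) ^+ M) =
    (size E + count (fun i => i != j) l * M)%N.
  elim: l => [|i l IH]; first by rewrite big_nil mulr1 mul0n addn0.
  rewrite big_cons /=; case: ifP => ni; last by rewrite IH.
  rewrite mulrCA mulrC H; first by rewrite IH add1n mulSn -addnA [(M + _)%N]addnC.
  rewrite monic_neq0 // rpredM //; apply: rpred_prod => i' _.
  by rewrite rpredX ?monicXsubC.
rewrite /slot_poly H.
  rewrite prodE; congr (_ + _ * _ + _)%N.
  transitivity #|predC1 j|; last by rewrite cardC1 card_ord.
  by rewrite -sum1_count -sum1_card; apply: eq_bigl.
rewrite monic_neq0 // rpredM //; apply: rpred_prod => i' _.
by rewrite rpredX ?monicXsubC.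
Qed.
End SlotPoly.

(** * Strata cut out by a nonzero minor and two equations *)

Section Strata.
Variables (K : fieldType) (r s d : nat) (g : 'I_r -> nat -> K).
Hypothesis char0 : [pchar K] =i pred0.
Notation rows := ('I_r * 'I_s)%type.
Notation al := (fun j => g j 0%N).
Hypothesis al_inj : injective al.
Hypothesis r_gt0 : (0 < r)%N.
(** Columns [s] to [s r] react to orders of vanishing 0 to [s r - s], so vanishing to order [M] is
    invisible in all of them. *)
Let M := (s * r - s + 1)%N.
Hypothesis hd : (M * r <= d)%N.
Implicit Types (v : pt K (s.+1 * d.+1)) (rho : rows).
Notation T := (@taylor_mx K r s d g).
Notation D0 := (@ordinary_den K r s d g).
Notation n := (s.+1 * d.+1)%N.

Section OneSlot.
Variables (rho : rows) (c : nat) (E : {poly K}).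
Hypothesis rho_free : g rho.1 1%N != 0.
Hypothesis c_ge : (s <= c)%N.
Hypothesis c_le : (c <= s * r)%N.
Hypothesis E_monic : E \is monic.
Hypothesis E_al : E.[g rho.1 0%N] != 0.
Let kap := (c - s)%N.
Let h := slot_poly M al E rho.1 kap.
Hypothesis sh : (size h <= d.+1)%N.
Definition slot_dir : 'I_n -> K := dir rho.2 h.
Definition slot_den v : K := slot_coef g rho h kap v.

Let cE : (s + kap)%N = c. Proof. by rewrite /kap subnKC. Qed.
Let kM : (kap < M)%N. Proof. by move: c_ge c_le; rewrite /kap /M; clear; lia. Qed.
Let h_other j : j != rho.1 -> forall m, (m < M)%N -> sexp h (g j 0%N) m = 0.
Proof. by move=> ne m lm; apply: (slot_poly_other al). Qed.
Let h_low m : (m < kap)%N -> sexp h (g rho.1 0%N) m = 0.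
Proof. exact: (slot_poly_low M al). Qed.

Lemma slot_D0 v x : D0 (shift v x slot_dir) = D0 v.
Proof. exact: ordinary_den_slot. Qed.

Lemma slot_T_low v x rho' k : D0 v != 0 -> (k < c)%N ->
  T (shift v x slot_dir) rho' k = T v rho' k.
Proof. by move=> Dv lk; apply: (taylor_slot_low char0 sh h_other h_low kM) => //; rewrite cE. Qed.

Lemma slot_T_other v x rho' k : D0 v != 0 -> (k <= c)%N -> rho' != rho ->
  T (shift v x slot_dir) rho' k = T v rho' k.
Proof. by move=> Dv lk; apply: (taylor_slot_other char0 sh h_other h_low kM) => //; rewrite cE. Qed.

Lemma slot_T v x : D0 v != 0 -> T (shift v x slot_dir) rho c = T v rho c + x * slot_den v.
Proof. by move=> Dv; rewrite -cE; apply: taylor_slot. Qed.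

Lemma slot_den_shift v x a (h' : {poly K}) : (size h' <= d.+1)%N -> (a < s)%N ->
  slot_den (shift v x (dir a h')) = slot_den v.
Proof. by move=> *; apply: slot_coef_shift. Qed.

Lemma slot_den_neq0 v : D0 v != 0 -> slot_den v != 0.
Proof.
move=> Dv; rewrite /slot_den /slot_coef mulf_neq0 ?expf_neq0 // oppr_eq0.
rewrite !mulf_neq0 ?invr_eq0 ?mulf_neq0 //.
- exact: (slot_poly_top M al_inj).
- exact: natf_fact_neq0.
- exact: (@ordinary_den_neq0 _ _ _ _ g v rho.1).
exact: ffact_neq0.
Qed.

Lemma ratfun_slot_den : ratfun D0 slot_den.
Proof.
have rinv := @ratfun_inv_jet K r s d g rho.1.
apply: (ratfun_eq (ratfun_mul (ratfun_cst _ (- (sexp h (g rho.1 0%N) kap * (rho.2 `!)%:R /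
  ((kap + s) ^_ s)%:R) * g rho.1 1%N ^+ (s + kap))) rinv)) => v Dv.
rewrite /slot_den /slot_coef invfM; ring.
Qed.
End OneSlot.

Section Stratum.
Variables (k : nat) (I : 'I_k -> rows) (rho1 rho2 : rows) (c1 c2 : nat).
Hypotheses (free1 : g rho1.1 1%N != 0) (free2 : g rho2.1 1%N != 0).
Hypotheses (I1 : forall x, I x != rho1) (I2 : forall x, I x != rho2).
Hypotheses (sk : (s <= k)%N) (kc1 : (k <= c1)%N) (c2_le : (c2 <= s * r)%N).
(** The two sources of a pair of equations: one row in two consecutive columns, or two rows in one
    column. *)
Hypothesis slots : (rho1 = rho2 /\ c2 = c1.+1) \/
  [/\ rho1 != rho2, c2 = c1 & (c1.+1 < s * r)%N].

(** Two rows in one column would give [h1] and [h2] equal degrees, possibly in the same coefficient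
    of [L]. A linear factor not vanishing at the point of [rho2] raises the degree of [h2], so that
    in both cases the two top coefficients occupy different coordinates. *)
Let E2 : {poly K} := if rho1 == rho2 then 1 else 'X - (g rho2.1 0%N + 1)%:P.
Let h1 := slot_poly M al 1 rho1.1 (c1 - s).
Let h2 := slot_poly M al E2 rho2.1 (c2 - s).
Let dlt := (r.-1 * M + (c1 - s))%N.

Let one_al (x : K) : (1 : {poly K}).[x] != 0.
Proof. by rewrite hornerC oner_neq0. Qed.

Let c12 : (c1 <= c2)%N.
Proof. by case: slots => [[_ ->]|[_ -> _]]. Qed.

Let E2_monic : E2 \is monic.
Proof. by rewrite /E2; case: ifP => _; rewrite ?monic1 ?monicXsubC. Qed.

Let E2_al : E2.[g rho2.1 0%N] != 0.
Proof.
rewrite /E2; case: ifP => _; rewrite !hornerE ?oner_neq0 //.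
by rewrite opprD addNKr oppr_eq0 oner_neq0.
Qed.

Let size_h1 : size h1 = dlt.+1.
Proof. by rewrite size_slot_poly ?monic1 // size_poly1 add1n addSn. Qed.

Let size_h2 : size h2 = dlt.+2.
Proof.
rewrite size_slot_poly // /E2 /dlt; case: slots => [[e12 ->]|[ne12 -> _]].
  by rewrite e12 eqxx size_poly1 subSn ?(leq_trans sk) //; lia.
by rewrite (negPf ne12) size_XsubC; lia.
Qed.

Let dlt_lt : (dlt.+1 < d.+1)%N.
Proof.
rewrite ltnS; apply: leq_trans hd; rewrite /dlt /M.
have -> : ((s * r - s + 1) * r)%N = (r.-1 * (s * r - s + 1) + (s * r - s + 1))%N.
  by rewrite mulnC -{1}(prednK r_gt0) mulSn addnC.
by case: slots => [[_ e]|[_ e l]]; lia.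
Qed.

Let sh1 : (size h1 <= d.+1)%N. Proof. by rewrite size_h1 ltnW. Qed.
Let sh2 : (size h2 <= d.+1)%N. Proof. by rewrite size_h2. Qed.

Let e1 := slot_dir rho1 c1 1.
Let e2 := slot_dir rho2 c2 E2.
(** Coordinate of the top coefficient of the monic [h1]; [i2] is the same for [h2]. *)
Let i1 : 'I_n := mxvec_index (widen_ord (leqnSn s) rho1.2) (Ordinal (ltnW dlt_lt)).
Let i2 : 'I_n := mxvec_index (widen_ord (leqnSn s) rho2.2) (Ordinal dlt_lt).

Let e11 : e1 i1 = 1.
Proof.
rewrite /e1 /slot_dir dirE /= eqxx -/h1.
have := slot_poly_monic M al rho1.1 (c1 - s) (monic1 K).
by rewrite monicE lead_coefE -/h1 size_h1 => /eqP.
Qed.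

Let e12 : e1 i2 = 0.
Proof.
rewrite /e1 /slot_dir dirE /= -/h1; case: ifP => // _.
by rewrite nth_default // size_h1.
Qed.

Let e22 : e2 i2 = 1.
Proof.
rewrite /e2 /slot_dir dirE /= eqxx -/h2.
have := slot_poly_monic M al rho2.1 (c2 - s) E2_monic.
by rewrite monicE lead_coefE -/h2 size_h2 => /eqP.
Qed.

Let ni : i1 != i2.
Proof. by apply/eqP => e; have /eqP := e11; rewrite e e12 eq_sym oner_eq0. Qed.

Let Dm v := \det (minor_mx (T v) I).
Let D1 v := slot_den rho1 c1 1 v * Dm v.
Let D2 v := slot_den rho2 c2 E2 v * Dm v.
Let F1 v := minor_eq (T v) I rho1 c1.
Let F2 v := minor_eq (T v) I rho2 c2.

Let pD0 : polyfun D0 := polyfun_ordinary_den _ _ _.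
Let rT rho c : ratfun D0 (fun v => T v rho c) := ratfun_taylor _ _ _ _.

Let rDm : ratfun D0 Dm.
Proof. by apply: (ratfun_det pD0 (A := fun x y v => T v (I x) y)) => x y. Qed.

Let rD1 : ratfun D0 D1. Proof. by apply: ratfun_mul => //; apply: ratfun_slot_den. Qed.
Let rD2 : ratfun D0 D2. Proof. by apply: ratfun_mul => //; apply: ratfun_slot_den. Qed.

Let rF rho c : ratfun D0 (fun v => minor_eq (T v) I rho c).
Proof.
apply: ratfun_sub => //; first exact: ratfun_mul.
apply: ratfun_sum => // x _; apply: ratfun_sum => // y _; apply: ratfun_mul => //.
apply: ratfun_mul => //.
by apply: (ratfun_adj pD0 x y (A := fun x y v => T v (I x) y)) => a b.
Qed.

Let c1_ge : (s <= c1)%N := leq_trans sk kc1.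
Let c2_ge : (s <= c2)%N := leq_trans c1_ge c12.
Let c1_le : (c1 <= s * r)%N := leq_trans c12 c2_le.

Let T1 v x rho i : D0 v != 0 -> (i < k)%N -> T (shift v x e1) rho i = T v rho i.
Proof. by move=> Dv li; apply: slot_T_low => //; apply: leq_trans li kc1. Qed.
Let T2 v x rho i : D0 v != 0 -> (i < k)%N -> T (shift v x e2) rho i = T v rho i.
Proof. by move=> Dv li; apply: slot_T_low => //; apply: leq_trans li (leq_trans kc1 c12). Qed.

Let Dm1 v x : D0 v != 0 -> Dm (shift v x e1) = Dm v.
Proof. by move=> Dv; rewrite /Dm (minor_mx_agree I (fun rho i => T1 x rho Dv)). Qed.
Let Dm2 v x : D0 v != 0 -> Dm (shift v x e2) = Dm v.
Proof. by move=> Dv; rewrite /Dm (minor_mx_agree I (fun rho i => T2 x rho Dv)). Qed.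

Let D01 v x : D0 (shift v x e1) = D0 v. Proof. exact: slot_D0. Qed.
Let D02 v x : D0 (shift v x e2) = D0 v. Proof. exact: slot_D0. Qed.
Let D11 v x : D0 v != 0 -> D1 (shift v x e1) = D1 v.
Proof. by move=> Dv; rewrite /D1 Dm1 // slot_den_shift. Qed.
Let D12 v x : D0 v != 0 -> D1 (shift v x e2) = D1 v.
Proof. by move=> Dv; rewrite /D1 Dm2 // slot_den_shift. Qed.
Let D21 v x : D0 v != 0 -> D2 (shift v x e1) = D2 v.
Proof. by move=> Dv; rewrite /D2 Dm1 // slot_den_shift. Qed.
Let D22 v x : D0 v != 0 -> D2 (shift v x e2) = D2 v.
Proof. by move=> Dv; rewrite /D2 Dm2 // slot_den_shift. Qed.

Let F11 v x : D0 v != 0 -> F1 (shift v x e1) = F1 v + x * D1 v.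
Proof.
move=> Dv; rewrite /F1 (minor_eq_change _ (fun rho i => T1 x rho Dv)) => [|y].
  by rewrite slot_T // [T v _ _ + _]addrC addrK /D1 mulrA.
exact: slot_T_other.
Qed.

(** The second slot acts in another row or in a later column. *)
Let F12 v x : D0 v != 0 -> F1 (shift v x e2) = F1 v.
Proof.
have H rho : D0 v != 0 -> rho != rho2 \/ (c1 < c2)%N -> T (shift v x e2) rho c1 = T v rho c1.
  by move=> Dv [ne|lt]; [apply: slot_T_other|apply: slot_T_low].
move=> Dv; rewrite /F1 (minor_eq_change _ (fun rho i => T2 x rho Dv)) => [|y].
  rewrite H ?subrr ?mul0r ?addr0 //.
  by case: slots => [[_ ->]|[ne _ _]]; [right|left].
by apply: H => //; left.
Qed.

Let F22 v x : D0 v != 0 -> F2 (shift v x e2) = F2 v + x * D2 v.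
Proof.
move=> Dv; rewrite /F2 (minor_eq_change _ (fun rho i => T2 x rho Dv)) => [|y].
  by rewrite slot_T // [T v _ _ + _]addrC addrK /D2 mulrA.
exact: slot_T_other.
Qed.

Lemma stratum_alg_dependent : alg_dependent (fun v => [/\ D0 v != 0,
   \det (minor_mx (T v) I) != 0, col_in_span (T v) k c1 & col_in_span (T v) k c2]) n.-1.
Proof.
apply: (two_slots_alg_dependent ni e11 e12 e22 pD0 rD1 rD2 (rF rho1 c1) (rF rho2 c2)
  D01 D02 D11 D12 D21 D22 F11 F12 F22) => v [Dv Dmv sp1 sp2].
split=> //; try exact: minor_solve.
  by rewrite mulf_neq0 // slot_den_neq0.
by rewrite mulf_neq0 // slot_den_neq0.
Qed.

Lemma stratum_dim_ge (S : pt K n -> Prop) v0 :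
  (forall v, D0 v != 0 -> \det (minor_mx (T v) I) != 0 ->
     minor_eq (T v) I rho1 c1 = 0 -> minor_eq (T v) I rho2 c2 != 0 -> S v) ->
  D0 v0 != 0 -> \det (minor_mx (T v0) I) != 0 -> dim_ge S n.-1.
Proof.
move=> hS D0v0 Dm0.
apply: (one_slot_dim_ge e11 pD0 rD1 (rF rho1 c1) (rF rho2 c2)
  D01 D02 D11 D12 D21 F11 F12 F22 (v0 := v0)) => // [v Dv||].
- by rewrite mulf_eq0 negb_or => /andP [_ Dmv]; apply: hS.
- by rewrite mulf_neq0 // slot_den_neq0.
by rewrite mulf_neq0 // slot_den_neq0.
Qed.
End Stratum.
End Strata.

Section Codimension.
Variables (K : fieldType) (r s d : nat) (g : 'I_r -> nat -> K).
Hypothesis char0 : [pchar K] =i pred0.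
Notation rows := ('I_r * 'I_s)%type.
Hypothesis al_inj : injective (fun j => g j 0%N).
Hypothesis r_gt1 : (1 < r)%N.
Hypothesis s_gt0 : (0 < s)%N.
Hypothesis hd : ((s * r - s + 1) * r <= d)%N.
Hypothesis hG : forall j, g j 1%N != 0 \/ (val j = 0%N /\ g j 2%N != 0).
Implicit Types (v : pt K (s.+1 * d.+1)) (rho : rows).
Notation T := (@taylor_mx K r s d g).
Notation D0 := (@ordinary_den K r s d g).
Notation n := (s.+1 * d.+1)%N.
Notation N := (s * r).-1.

Let r_gt0 : (0 < r)%N := ltnW r_gt1.

Lemma predN : N.+1 = (s * r)%N.
Proof. by rewrite prednK // muln_gt0 s_gt0. Qed.

Lemma double_le : (s.*2 <= N.+1)%N.
Proof. by rewrite predN -muln2 leq_mul2l r_gt1 orbT. Qed.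

Lemma card_rows : #|{: rows}| = N.+1.
Proof. by rewrite card_prod !card_ord predN mulnC. Qed.

Let s_le : (s <= N)%N.
Proof. by rewrite -ltnS predN -[X in (X < _)%N]muln1 ltn_mul2l s_gt0. Qed.

Lemma taylor_free_s v : col_free (T v) s.
Proof.
apply: (@taylor_col_free _ _ _ _ _ _ (Ordinal r_gt1)).
by case: (hG (Ordinal r_gt1)) => // -[].
Qed.

Lemma taylor_kernel_free v (lam : rows -> K) :
  (forall k, (k < N)%N -> \sum_rho lam rho * T v rho k = 0) ->
  (forall rho, g rho.1 1%N != 0 -> lam rho = 0) -> forall rho, lam rho = 0.
Proof. exact: taylor_left_kernel hG double_le. Qed.

(** What this leaves out are the two good cases: the first [N + 1 = s r] columns are independent, or
    column [N] depends on the earlier ones and column [N + 1] does not. *)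
Definition degenerate v := D0 v != 0 /\
  (~ col_free (T v) N \/ [/\ col_free (T v) N, col_in_span (T v) N N &
                             col_in_span (T v) N N.+1]).

Lemma degenerate_alg_dependent : alg_dependent degenerate n.-1.
Proof.
(* [b] separates one row with columns [k] and [k + 1] from two rows with column [k]; the degenerate
   set is covered by finitely many strata of these kinds. *)
pose c2 (b : bool) k := if b then k.+1 else k.
pose side (k : nat) (I : 'I_k -> rows) (rho1 rho2 : rows) (b : bool) : Prop :=
  [/\ g rho1.1 1%N != 0 /\ g rho2.1 1%N != 0,
     (forall x, I x != rho1) /\ (forall x, I x != rho2), (s <= k)%N,
     (c2 b k <= s * r)%N &
     (rho1 = rho2 /\ b) \/ [/\ rho1 != rho2, ~~ b & (k.+1 < s * r)%N]].
pose W (k : 'I_(s * r)) (I : {ffun 'I_k -> rows}) rho1 rho2 b v := side k I rho1 rho2 b /\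
  [/\ D0 v != 0, \det (minor_mx (T v) I) != 0, col_in_span (T v) k k &
      col_in_span (T v) k (c2 b k)].
have depW k I rho1 rho2 b : alg_dependent (@W k I rho1 rho2 b) n.-1.
  have [sd|nsd] := pselect (side k I rho1 rho2 b); last first.
    by move=> t; exists 1; split=> [|v [] //]; apply: oner_neq0.
  apply: (@alg_dependent_sub _ _ _ (fun v => [/\ D0 v != 0,
     \det (minor_mx (T v) I) != 0, col_in_span (T v) k k &
     col_in_span (T v) k (c2 b k)])) => [v [] //|].
  case: sd => -[fr1 fr2] [I1 I2] sk c2k slots.
  apply: (stratum_alg_dependent char0 al_inj r_gt0 hd fr1 fr2 I1 I2) => //.
  by case: slots => [[e12 ->]|[ne /negPf -> lt]]; [left|right].
apply: (@alg_dependent_sub _ _ _ (fun v => exists k I rho1 rho2 b, @W k I rho1 rho2 b v)).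
  move=> v [Dv deg]; case: deg => [nf|[fN sp1 sp2]].
    have [k [I [rho1 [rho2 [[/andP [sk kN] fr1 fr2 ne] [I1 I2 dI sp]]]]]] :=
      rank_drop card_rows s_le (taylor_free_s (v := v)) (@taylor_kernel_free v) nf.
    have lk : (k < s * r)%N by rewrite -predN ltnW.
    have IE : [ffun x => I x] = I :> ('I_k -> rows) by apply: funext => x; rewrite ffunE.
    exists (Ordinal lk), [ffun x => I x], rho1, rho2, false; rewrite /W /side /= IE.
    by split=> //; split=> //; [exact: ltnW|right; split=> //; rewrite -predN].
  have [rho [I [fr I1 dI _]]] := full_rank_minor card_rows (@taylor_kernel_free v) fN.
  have lk : (N < s * r)%N by rewrite -predN.
  have IE : [ffun x => I x] = I :> ('I_N -> rows) by apply: funext => x; rewrite ffunE.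
  exists (Ordinal lk), [ffun x => I x], rho, rho, true; rewrite /W /side /= IE.
  by split=> //; split=> //; left.
do 5!(apply: alg_dependent_bigcup => ?); exact: depW.
Qed.

(** The operators with [D0 <> 0] contain a nonempty open part of a hyperplane, of dimension [n - 1],
    so they cannot all be degenerate. *)
Lemma exists_nondegenerate : exists2 v, D0 v != 0 & ~ degenerate v.
Proof.
apply: contrapT => h.
have sub v : D0 v != 0 -> degenerate v.
  by move=> Dv; apply: contrapT => nd; apply: h; exists v.
apply: (dim_ge_alg_dependent degenerate_alg_dependent).
apply: (dim_ge_sub sub).
pose i0 : 'I_n := mxvec_index ord0 ord0.
pose e (i : 'I_n) : K := (i == i0)%:R.
have e0 : e i0 = 1 by rewrite /e eqxx.
(* The operator [d^s]: its leading coefficient vanishes nowhere, and its coordinate [i0] is 0, so it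
   lies on the hyperplane. *)
pose w : 'I_n -> K := dir s 1.
pose y0 k := w (lift i0 k).
have wE : embed_hyper i0 y0 = w.
  apply: funext => i; case: (unliftP i0 i) => [k ->|->]; first by rewrite embed_hyper_lift.
  by rewrite embed_hyper0 /w /i0 dirE /= ltn_eqF.
have Dw : D0 w != 0.
  apply/prodf_neq0 => j _; rewrite jet0.
  have -> : op_poly w ord_max = 1.
    rewrite /op_poly big_ord_recl /w dirE /= eqxx coef1 scale1r expr0 big1 ?addr0 // => k _.
    by rewrite dirE /= eqxx coef1 scale0r.
  by rewrite hornerC oner_neq0.
have pe i : polyfun (fun y => @embed_hyper K n i0 y i) := polyfun_embed_hyper K i0 i.
apply: (@dim_ge_graph _ _ i0 e char0 e0 (fun y => D0 (embed_hyper i0 y)) (fun=> 0) _ y0).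
- exact: (polyfun_comp_poly (polyfun_ordinary_den _ _ _) pe).
- exact: ratfun_cst.
- move=> y Dy; rewrite (_ : (fun _ => _) = embed_hyper i0 y) //.
  by apply: funext => i; rewrite mul0r addr0.
by rewrite wE.
Qed.

(** At a nondegenerate operator some nonzero minor of size [N] omits just one row, and that row is
    free. Through two slots of this row the equation for column [N] is imposed and the one for
    column [N + 1] is avoided. *)
Lemma gap_dim_ge : dim_ge (fun v => [/\ D0 v != 0, col_free (T v) N,
  col_in_span (T v) N N & ~ col_in_span (T v) N N.+1]) n.-1.
Proof.
have [v0 Dv0 nd] := exists_nondegenerate.
have fN : col_free (T v0) N.
  by apply: contrapT => nf; apply: nd; split=> //; left.
have [rho [I [fr I1 dI cov]]] := full_rank_minor card_rows (@taylor_kernel_free v0) fN.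
apply: (stratum_dim_ge char0 al_inj r_gt0 hd fr fr I1 I1 s_le (leqnn _) _ _ _ Dv0 dI
  (c2 := N.+1)); [by rewrite predN|by left|].
move=> v Dv dv eq1 eq2; split=> //.
- exact: col_free_minor dv.
- exact: minor_solve_span dv cov eq1.
by move=> sp; case/eqP: eq2; apply: minor_solve.
Qed.
End Codimension.

(** * Minimal operators of nondegenerate operators *)

Lemma solves_lincomb (K : fieldType) (J : finType) (M : {poly {poly K}}) (a : K)
    (lam : J -> K) (F : J -> series K) : (forall j, solves M a (F j)) ->
  solves M a (fun i => \sum_j lam j * F j i).
Proof.
move=> sol n.
transitivity (\sum_j lam j * sapply M a (F j) n); last first.
  by rewrite big1 // => j _; rewrite sol mulr0.
under [RHS]eq_bigr do rewrite /sapply mulr_sumr.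
rewrite [RHS]exchange_big; apply: eq_bigr => i _ /=.
under [RHS]eq_bigr do rewrite /smul mulr_sumr.
rewrite [RHS]exchange_big; apply: eq_bigr => m _ /=.
rewrite iter_sder -sumrMnl mulr_sumr; apply: eq_bigr => j _.
by rewrite iter_sder [RHS]mulrCA mulrnAr [in RHS]mulrnAr [in RHS]mulrnAr.
Qed.

Section MinopJets.
Variables (K : fieldType) (R : finType) (M : {poly {poly K}}) (F : R -> series K) (N : nat).
Hypothesis char0 : [pchar K] =i pred0.
Hypothesis primM : op_primitive M.
Hypothesis sM : (size M <= N.+2)%N.
Hypothesis solF : forall rho, solves M 0 (F rho).
Let T (rho : R) (k : nat) : K := F rho k.

Lemma full_nonsingular : col_free T N.+1 -> ~~ root (lead_coef M) 0.
Proof.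
move=> free; have top : (M`_N.+1)`_0 != 0.
  apply: (nonsingular_top char0 primM sM) => j lj.
  have [lam hlam] := dual_vectors free lj.
  by exists (fun i => \sum_rho lam rho * F rho i); [exact: solves_lincomb|].
have size_M : size M = N.+2.
  apply/eqP; rewrite eqn_leq sM ltnNge; apply: contra top => le.
  by rewrite [M`_N.+1]nth_default // coef0.
by rewrite lead_coefE size_M rootE horner_coef0.
Qed.

Hypothesis free : col_free T N.
Hypothesis span : col_in_span T N N.
Hypothesis nspan : ~ col_in_span T N N.+1.

Lemma gap_low j : (j < N)%N -> exists2 f, solves M 0 f &
  forall i, (i < N)%N -> f i = (i == j)%:R.
Proof.
move=> lj; have [lam hlam] := dual_vectors free lj.
by exists (fun i => \sum_rho lam rho * F rho i); [exact: solves_lincomb|].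
Qed.

(** The columns at the exponents [0, ..., N - 1, N + 1]. *)
Let T' (rho : R) (y : nat) := if (y < N)%N then T rho y else T rho N.+1.

Let freeT' : col_free T' N.+1 := col_free_extend free nspan.

Let span_kernel (lam : R -> K) : (forall y, (y < N)%N -> \sum_rho lam rho * T rho y = 0) ->
  \sum_rho lam rho * T rho N = 0.
Proof.
have [z hz] := span; move=> ker; under eq_bigr do rewrite hz mulr_sumr.
rewrite exchange_big big1 // => y _ /=; under eq_bigr do rewrite mulrA.
by rewrite -mulr_suml ker ?mul0r.
Qed.

Lemma gap_high : exists2 f, solves M 0 f &
  forall i, (i < N.+2)%N -> f i = (i == N.+1)%:R.
Proof.
have [lam hlam] := dual_vectors freeT' (ltnSn N).
have ker y : (y < N)%N -> \sum_rho lam rho * T rho y = 0.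
  move=> ly; have := hlam y (ltnW ly); rewrite ltn_eqF // => E; rewrite -[RHS]E.
  by apply: eq_bigr => rho _; rewrite /T' ly.
exists (fun i => \sum_rho lam rho * F rho i); first exact: solves_lincomb.
move=> i; rewrite ltnS leq_eqVlt => /orP [/eqP ->|li].
  have := hlam N (ltnSn N); rewrite !eqxx => <-.
  by apply: eq_bigr => rho _; rewrite /T' ltnn.
rewrite ltn_eqF //; move: li; rewrite ltnS leq_eqVlt => /orP [/eqP ->|li].
  exact: span_kernel.
exact: ker.
Qed.

Lemma gap_minop_removable : removable_cost1_at0 M.
Proof. exact: gap_removable char0 primM sM gap_low gap_high. Qed.

Lemma gap_minop_apparent : #|R| = N.+1 -> apparent_sing0 M.
Proof.
move=> cR; split; first exact: gap_root char0 primM sM gap_low gap_high.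
have szM := gap_size char0 primM sM gap_low gap_high.
have [psi bij_psi] : exists psi : 'I_(size M).-1 -> R, bijective psi.
  by rewrite szM /= -cR; exists enum_val; apply: enum_val_bij.
exists (fun k => F (psi k)); split=> [k|c hc k]; first exact: solF.
have [psi' psiK psi'K] := bij_psi.
rewrite -(psiK k); apply: (square_row_free cR freeT' (lam := fun rho => c (psi' rho))).
move=> y ly; rewrite (reindex psi (onW_bij _ bij_psi)) /= /T'.
by case: (y < N)%N; [rewrite -[RHS](hc y)|rewrite -[RHS](hc N.+1)];
  apply: eq_bigr => x _; rewrite psiK.
Qed.
End MinopJets.

Lemma ordinary_denP (K : fieldType) (r s d : nat) (g : 'I_r -> nat -> K)
    (v : pt K (s.+1 * d.+1)) : (0 < r)%N ->
  ordinary_den g v != 0 <->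
  size (opOf v) = s.+1 /\ forall j, ~~ root (lead_coef (opOf v)) (g j 0%N).
Proof.
move=> r0; split=> [Dv|[sz nr]].
  have nz : op_poly v ord_max != 0.
    apply: contraTneq (ordinary_den_neq0 (Ordinal r0) Dv) => z.
    by rewrite jet0 z horner0 eqxx.
  split=> [|j]; first exact: size_opOf.
  rewrite lead_opOf ?size_opOf // rootE -jet0; exact: ordinary_den_neq0.
by apply/prodf_neq0 => j _; rewrite jet0 -lead_opOf // -rootE nr.
Qed.

Unset Implicit Arguments.

Theorem theorem18
  (C : fieldType) (K : closedFieldType) (iota : {rmorphism C -> K})
  (charC0 : [pchar C] =i pred0)
  (Kalg : forall z : K, exists p : {poly C}, p != 0 /\ root (map_poly iota p) z)
  (P : {poly {poly C}})  (* P(x,y), outer variable y *)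
  (hrP : (1 < (size P).-1)%N)
  (hsqf : sqfree (map_poly (fun q : {poly C} => @FracField.tofrac _ q : {fraction {poly C}}) P))
  (hnodiv : forall q : {poly K}, (1 < size q)%N ->
      ~ exists h : {poly {poly K}},
          map_poly (map_poly iota) P = map_poly polyC q * h)
  (hS1 : size (map_poly (fun q : {poly C} => q.[0]) P) = size P /\
         sqfree (map_poly (fun q : {poly C} => q.[0]) P))
  (g : 'I_(size P).-1 -> nat -> K)
  (hg : forall h, is_ser_root (map_poly (map_poly iota) P) h <->
                  exists i, h = g i)
  (hG1 : forall i : 'I_(size P).-1, val i != 0%N -> g i 1%N != 0)
  (hG2 : forall i : 'I_(size P).-1, val i = 0%N -> g i 1%N != 0 \/ g i 2%N != 0)
  (rL dL : nat) (hrL : (0 < rL)%N)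
  (hdL : ((rL * (size P).-1 - rL + 1) * (size P).-1 <= dL)%N) :
  let PK := map_poly (map_poly iota) P in
  let V := fun v : pt K (rL.+1 * dL.+1) =>
    size (opOf v) = rL.+1 /\
    forall i, ~~ root (lead_coef (opOf v)) (g i 0%N) in
  let X := fun v => V v /\
    exists M, is_minop PK (opOf v) M /\ apparent_sing0 M in
  let Y := fun v => V v /\
    exists M, [/\ is_minop PK (opOf v) M, apparent_sing0 M &
                  ~ removable_cost1_at0 M] in
  dim_gt X Y.
Proof.
move=> PK V X Y.
have char0 : [pchar K] =i pred0 by move=> p; rewrite (fmorph_pchar iota).
have hG j : g j 1%N != 0 \/ (val j = 0%N /\ g j 2%N != 0).
  have [j0|nj] := eqVneq (val j) 0%N; last by left; apply: hG1.
  by case: (hG2 j j0); [left|right].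
have al_inj : injective (fun j => g j 0%N) := ser_root_coef0_inj charC0 hrP hS1 hg.
have r_gt0 := ltnW hrP.
have VP (v : pt K (rL.+1 * dL.+1)) : ordinary_den g v != 0 <-> V v by apply: ordinary_denP.
pose N := (rL * (size P).-1).-1.
have NE : N.+1 = (rL * (size P).-1)%N by apply: predN.
have card_rows : #|{: 'I_(size P).-1 * 'I_rL}| = N.+1 by apply: card_rows.
have annih (v : pt K (rL.+1 * dL.+1)) : ordinary_den g v != 0 ->
    exists2 Q : {poly {poly K}}, Q != 0 /\ (size Q <= N.+2)%N &
      annihilates_comp PK (opOf v) Q.
  move=> Dv; have [sz nr] := (VP v).1 Dv.
  have sPK : size PK = size P := size_PK iota P.
  have [||||Q [Q0 sQ] annQ] := @exists_annihilator K PK (opOf v) rL.-1.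
  - by rewrite sz prednK.
  - by rewrite sPK; case: size hrP => // -[].
  - exact: lead_PK_0.
  - move=> h hr; split; first exact: ser_root_deriv hr.
    by have [i ->] := (hg h).1 hr; have := nr i; rewrite rootE.
  by exists Q => //; split=> //; rewrite NE -sPK -[X in (X * _)%N]prednK.
have minop_facts (v : pt K (rL.+1 * dL.+1)) M : ordinary_den g v != 0 -> is_minop PK (opOf v) M ->
    (size M <= N.+2)%N /\ forall rho, solves M 0 (comp_series g v rho).
  move=> Dv [M0 primM annM minM]; split.
    by have [Q [Q0 sQ] annQ] := annih v Dv; apply: leq_trans (minM Q Q0 annQ) sQ.
  move=> [j a]; apply: annM; first by apply/hg; exists j.
  apply: local_sol_solves => //; rewrite -jet0; exact: ordinary_den_neq0.
(* One less than the number of coordinates: [X] contains a graph over a hyperplane, while [Y]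
   satisfies two equations. *)
exists (rL.+1 * dL.+1).-1; split.
  apply: dim_ge_sub (gap_dim_ge char0 al_inj hrP hrL hdL hG) => v [Dv fr sp nsp].
  split; first exact/VP.
  have [Q [Q0 _] annQ] := annih v Dv; have [M minM] := exists_minop Q0 annQ.
  exists M; split=> //; have [sM solM] := minop_facts v M Dv minM.
  have [_ primM _ _] := minM.
  exact: (gap_minop_apparent char0 primM sM solM fr sp nsp card_rows).
apply: dim_ge_alg_dependent.
apply: alg_dependent_sub (degenerate_alg_dependent char0 al_inj hrP hrL hdL hG).
(* Each good case contradicts membership in [Y]: a gap makes [M] removable at cost one, and full
   independence makes it nonsingular at 0. *)
move=> v [/VP Dv [M [minM appM nrem]]]; split=> //; apply: contrapT => /not_orP [/contrapT fr nd].
have [sM solM] := minop_facts v M Dv minM; have [_ primM _ _] := minM.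
have [sp|nsp] := pselect (col_in_span (@taylor_mx K _ _ _ g v) N N).
  have [sp'|nsp'] := pselect (col_in_span (@taylor_mx K _ _ _ g v) N N.+1).
    by apply: nd.
  by apply: nrem; apply: (gap_minop_removable char0 primM sM solM fr sp nsp').
have fr' : col_free (@taylor_mx K _ _ _ g v) N.+1.
  by apply: contrapT => nf; apply: nsp; apply: col_dependent.
have [rt _] := appM.
by move: rt; apply/negP; apply: (full_nonsingular char0 primM sM solM fr').
Qed.
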